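(* Let $n\ge1$ and $\beta_1,\dots,\beta_n>0$. Let $\Pi_{flat}$ be the point-to-line last passage time $$\Pi_{flat}=\max_{\text{all up/right paths }\pi}\ \sum_{(i,j)\in\pi}\omega_{i,j}$$ where $\omega_{i,j}$, for $i,j\ge1$ with $i+j\le n+1$, are independent exponential random variables with $\omega_{i,j}\sim\mathrm{Exponential}(\beta_i+\beta_{n+1-j})$. Then for every $a\in\mathbb{R}$, $$\mathbf{Pr}(\Pi_{flat}\le a)=\det(I-\chi K\chi)_{L^2(\mathbb{R})},$$ where $\chi(x)=\mathbf{1}_{\{x\ge\max\{a,0\}\}}$ and $$K(x,y)=-\frac{1}{2\pi\mathbf{i}}\oint_\gamma dw\,e^{-(x+y)w}\prod_{i=1}^n\frac{\beta_i+w}{\beta_i-w},$$ with $\gamma$ a counter clockwise oriented closed contour containing all the poles at $w=\beta_i$.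
   Context: Let $\Delta=\{(i,j):i,j\ge1,\ i+j\le n+1\}$ with boundary $\partial\Delta=\{(i,j)\in\Delta:i+j=n+1\}$. An up/right path in $\Delta$ is a lattice path from $(1,1)$ to (a point of) $\partial\Delta$ each of whose steps is $(1,0)$ or $(0,1)$. $\mathrm{Exponential}(\beta)$ is the exponential law with rate $\beta$. $\chi$ acts by multiplication, so $\chi K\chi$ has kernel $\chi(x)K(x,y)\chi(y)$. Fredholm determinant: $\det(I-K)_{L^2(\Omega,\mu)}=1+\sum_{k\ge1}\frac{(-1)^k}{k!}\int_{\Omega^k}d\mu(z_1)\cdots d\mu(z_k)\det(K(z_i,z_j))_{1\le i,j\le k}$, here with Lebesgue measure on $\mathbb{R}$. *)

(* Defs.v *)
(* Complex numbers are [R[i]] for [R : realType]. [complex.Re] and [complex.Im]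
   are the [R]-valued projections; unqualified, [Re] and [Im] are the
   [R[i]]-valued ones of [numClosedFieldType]. *)
From HB Require Import structures.
From mathcomp Require Import all_boot all_order all_algebra finmap.
From mathcomp Require Import complex.
From mathcomp Require Import all_classical all_reals all_analysis.

Set Implicit Arguments.
Unset Strict Implicit.
Unset Printing Implicit Defensive.

Import Order.TTheory GRing.Theory Num.Theory.
Import numFieldNormedType.Exports.

Local Open Scope classical_set_scope.
Local Open Scope ring_scope.
Local Open Scope complex_scope.

Section LastPassage.

Definition in_Delta (n : nat) (p : nat * nat) : bool :=
  [&& (1 <= p.1)%N, (1 <= p.2)%N & (p.1 + p.2 <= n.+1)%N].

Definition in_bdDelta (n : nat) (p : nat * nat) : bool :=
  in_Delta n p && (p.1 + p.2 == n.+1)%N.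

Definition ur_step (p q : nat * nat) : bool :=
  (q == (p.1.+1, p.2)) || (q == (p.1, p.2.+1)).

(* The default value (0, 0) of [head] and [last] is outside [Delta], so the
   empty sequence is not a path. *)
Definition ur_path (n : nat) (s : seq (nat * nat)) : bool :=
  [&& head (0, 0)%N s == (1, 1)%N, sorted ur_step s, all (in_Delta n) s
    & in_bdDelta n (last (0, 0)%N s)].

Definition path_weight (R : realType) (w : nat * nat -> R)
    (s : seq (nat * nat)) : R :=
  \sum_(p <- s) w p.

(* For [1 <= n] this supremum is a maximum, see [Pi_flat_max] below. *)
Definition Pi_flat (R : realType) (n : nat) (w : nat * nat -> R) : R :=
  sup [set path_weight w s | s in [set s | ur_path n s]].

Lemma sum_last_ur (p : nat * nat) (s : seq (nat * nat)) : path ur_step p s ->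
  ((last p s).1 + (last p s).2 = p.1 + p.2 + size s)%N.
Proof.
elim: s p => [|q s IH] p /=; first by rewrite addn0.
case/andP=> /orP[] /eqP-> /IH -> /=; first by rewrite !addSn addnS.
by rewrite !(addSn, addnS).
Qed.

Lemma finite_ur_path (n : nat) : finite_set [set s | ur_path n s].
Proof.
pose f (t : n.-tuple ('I_n.+2 * 'I_n.+2)) : seq (nat * nat) :=
  [seq (val q.1, val q.2) | q <- t].
apply: (@sub_finite_set _ _ (f @` setT)); last first.
  by apply: finite_image; exact: finite_finset.
move=> s /=; case: s => [|p s] /and4P[]; first by [].
move=> /= /eqP -> /sum_last_ur /= sz al /andP[_ /eqP e].
have {e} sz : size ((1, 1)%N :: s) = n.
  by move: sz; rewrite e /= !addSn add0n => -[].
have st : size [seq (inord q.1, inord q.2) : 'I_n.+2 * 'I_n.+2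
    | q <- (1, 1)%N :: s] == n by rewrite size_map sz.
exists (Tuple st) => //; rewrite /f.
rewrite -[RHS]map_id; apply: etrans (esym (map_comp _ _ _)) _.
apply/eq_in_map => -[i j] ij /=.
have /allP /(_ _ ij) /and3P[_ _ /= h] : all (in_Delta n) ((1, 1)%N :: s) by [].
rewrite !inordK //.
  by rewrite ltnS (leq_trans _ h)// leq_addl.
by rewrite ltnS (leq_trans _ h)// leq_addr.
Qed.

Lemma seq_max (R : realType) (x : R) (l : seq R) :
  exists2 M, M \in x :: l & {in x :: l, forall y, y <= M}.
Proof.
elim: l x => [|z l IH] x.
  by exists x => [|y]; rewrite !inE// => /eqP->.
have [M Ml MM] := IH z; have [xM|/ltW Mx] := leP x M.
  exists M; first by rewrite inE Ml orbT.
  by move=> y; rewrite inE => /orP[/eqP->//|/MM].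
exists x; first by rewrite inE eqxx.
move=> y; rewrite inE => /orP[/eqP->//|/MM yM]; exact: le_trans yM Mx.
Qed.

Lemma Pi_flat_max (R : realType) (n : nat) (w : nat * nat -> R) : (1 <= n)%N ->
  (exists2 s, ur_path n s & Pi_flat n w = path_weight w s) /\
  (forall s, ur_path n s -> path_weight w s <= Pi_flat n w).
Proof.
move=> n1; set A := [set path_weight w s | s in [set s | ur_path n s]].
have finA : finite_set A by apply: finite_image; exact: finite_ur_path.
have A0 : A !=set0.
  pose s := [seq (k.+1, 1)%N | k <- iota 0 n].
  exists (path_weight w s), s => //; rewrite /= /s.
  case: n n1 {A finA s} => [//|n] _; apply/and4P; split => //=.
  - have ip k : path ur_step (k.+1, 1)%N [seq (j.+1, 1)%N | j <- iota k.+1 n].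
      by elim: n k => [//|n' IH] k /=; rewrite IH /ur_step eqxx.
    exact: ip.
  - apply/allP => p /mapP[k].
    by rewrite mem_iota /in_Delta /= => /andP[_ h] ->; rewrite addn1 ltnS.
  - rewrite (last_map (fun k => (k.+1, 1)%N) (iota 1 n) 0%N).
    have -> : last 0%N (iota 1 n) = n.
      case: n => [//|n]; rewrite -[1%N]/(0 + 1)%N iotaDl -nth_last size_map.
      by rewrite size_iota (nth_map 0%N) ?size_iota// nth_iota// add1n.
    by rewrite /in_bdDelta /in_Delta /= addn1 eqxx leqnn.
have [M AM Mub] : exists2 M, A M & ubound A M.
  have /finite_seqP[[|x l] lA] := finA; first by move: A0 => [y]; rewrite lA.
  have [M Ml MM] := seq_max x l.
  by exists M; rewrite lA //= => y /MM.
have MA : has_ubound A by exists M.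
have supE : sup A = M.
  apply/eqP; rewrite eq_le (ge_sup A0 Mub) /=; exact: ub_le_sup.
split; first by have [s us wM] := AM; exists s => //; rewrite /Pi_flat supE.
by move=> s us; apply: (ub_le_sup MA); exists s.
Qed.

End LastPassage.

(* Mutual independence: the product rule over every finite subfamily. *)
Definition mutually_independent (R : realType) (d d' : measure_display)
    (T : measurableType d) (T' : measurableType d') (P : probability T R)
    (I : choiceType) (D : set I) (X : I -> {RV P >-> T'}) : Prop :=
  forall (J : {fset I}) (B : I -> set T'),
    [set` J] `<=` D -> (forall i, measurable (B i)) ->
    fine (P (\bigcap_(i in [set` J]) (X i @^-1` B i))) =
    \prod_(i <- J) fine (P (X i @^-1` B i)).

Definition has_exponential_law (R : realType) (d : measure_display)
    (T : measurableType d) (P : probability T R) (X : {RV P >-> R})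
    (rate : R) : Prop :=
  forall B : set R, measurable B ->
    distribution P X B = exponential_prob rate B.

Section Complex.
Context (R : realType).

Definition cexp (z : R[i]) : R[i] :=
  (expR (complex.Re z) * cos (complex.Im z)) +i*
  (expR (complex.Re z) * sin (complex.Im z)).

Definition cintegrable (d : measure_display) (T : measurableType d)
    (mu : {measure set T -> \bar R}) (D : set T) (f : T -> R[i]) : Prop :=
  mu.-integrable D (fun x => (complex.Re (f x))%:E) /\
  mu.-integrable D (fun x => (complex.Im (f x))%:E).

Definition cintegral (d : measure_display) (T : measurableType d)
    (mu : {measure set T -> \bar R}) (D : set T) (f : T -> R[i]) : R[i] :=
  (\int[mu]_(x in D) complex.Re (f x)) +i* (\int[mu]_(x in D) complex.Im (f x)).

Definition C1_arc (g : R -> R[i]) : Prop :=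
  [/\ forall t, derivable (@complex.Re R \o g) t 1,
      forall t, derivable (@complex.Im R \o g) t 1,
      continuous (derive1 (@complex.Re R \o g)) &
      continuous (derive1 (@complex.Im R \o g))].

Definition arc_deriv (g : R -> R[i]) (t : R) : R[i] :=
  derive1 (@complex.Re R \o g) t +i* derive1 (@complex.Im R \o g) t.

(* A closed piecewise-C^1 contour is a cyclic concatenation of [m] arcs
   [g k], each parametrized by [0, 1]. The values of [g k] outside [0, 1] are
   irrelevant; they are there because every C^1 arc on [0, 1] (with one-sided
   derivatives at the ends) extends to a C^1 function on the line. *)
Definition closed_contour (m : nat) (g : 'I_m -> R -> R[i]) : Prop :=
  (forall k, C1_arc (g k)) /\ (forall k, g k 1 = g (ordS k) 0).

Definition contour_integral (m : nat) (g : 'I_m -> R -> R[i])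
    (f : R[i] -> R[i]) : R[i] :=
  \sum_(k < m) cintegral lebesgue_measure `[0, 1]
    (fun t => f (g k t) * arc_deriv (g k) t).

Definition winding_number (m : nat) (g : 'I_m -> R -> R[i]) (z : R[i]) : R[i] :=
  (0 +i* (2 * pi))^-1 * contour_integral g (fun w => (w - z)^-1).

(* The contour does not meet [z] and goes around it once, counterclockwise. *)
Definition encloses_ccw (m : nat) (g : 'I_m -> R -> R[i]) (z : R[i]) : Prop :=
  (forall k t, 0 <= t <= 1 -> g k t != z) /\ winding_number g z = 1.

End Complex.

Section ConsMeasure.
Local Open Scope ereal_scope.
Context (R : realType) (d : measure_display) (T : measurableType d) (k : nat).
Variables (mu : {sigma_finite_measure set T -> \bar R})
  (nu : {sigma_finite_measure set (k.-tuple T) -> \bar R}).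

Let tcons (p : T * k.-tuple T) : k.+1.-tuple T := [tuple of p.1 :: p.2].

Let measurable_tcons : measurable_fun [set: T * k.-tuple T] tcons.
Proof. exact: (measurable_cons measurable_fst measurable_snd). Qed.

(* The product measure [mu \x nu], transported along
   [T * k.-tuple T ~ k.+1.-tuple T]. *)
Definition cons_measure : set (k.+1.-tuple T) -> \bar R :=
  pushforward (mu \x nu) tcons.

Let cons_measure0 : cons_measure set0 = 0.
Proof. by rewrite /cons_measure /pushforward preimage_set0 measure0. Qed.

Let cons_measure_ge0 A : 0 <= cons_measure A.
Proof. exact: measure_ge0. Qed.

Let cons_measure_sigma_additive : semi_sigma_additive cons_measure.
Proof.
move=> F mF tF mUF; rewrite /cons_measure /pushforward preimage_bigcup.
apply: measure_semi_sigma_additive.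
- by move=> n; rewrite -[X in measurable X]setTI; exact: measurable_tcons.
- apply/trivIsetP => /= i j _ _ ij; rewrite -preimage_setI.
  by move/trivIsetP : tF => /(_ _ _ _ _ ij) ->//; rewrite preimage_set0.
- by rewrite -preimage_bigcup -[X in measurable X]setTI; exact: measurable_tcons.
Qed.

HB.instance Definition _ := isMeasure.Build _ _ _ cons_measure
  cons_measure0 cons_measure_ge0 cons_measure_sigma_additive.

Let cons_measure_sigma_finite : sigma_finite setT cons_measure.
Proof.
have /sigma_finiteP[F [TF ndF Foo]] := sigma_finiteT mu.
have /sigma_finiteP[G [TG ndG Goo]] := sigma_finiteT nu.
pose h (t : k.+1.-tuple T) : T * k.-tuple T := (thead t, [tuple of behead t]).
have hK p : h (tcons p) = p.
  by case: p => x t; rewrite /h /tcons /= theadE; congr pair; exact: val_inj.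
have mh : measurable_fun [set: k.+1.-tuple T] h.
  apply: measurable_fun_pair; [exact: measurable_tnth|exact: measurable_behead].
exists (fun i => h @^-1` (F i `*` G i)).
  apply/esym; rewrite -subTset => t _.
  have [i _ Fi] : (\bigcup_i F i) (h t).1 by rewrite -TF.
  have [j _ Gj] : (\bigcup_i G i) (h t).2 by rewrite -TG.
  exists (maxn i j) => //; split.
    by move: Fi; exact/subsetPset/ndF/leq_maxl.
  by move: Gj; exact/subsetPset/ndG/leq_maxr.
move=> i; have [mFi Fi] := Foo i; have [mGi Gi] := Goo i; split.
  by rewrite -[X in measurable X]setTI; apply: mh => //; exact: measurableX.
rewrite /cons_measure /pushforward -comp_preimage.
rewrite (_ : h \o tcons = id); last by apply/funext => p; exact: hK.
by rewrite preimage_id product_measure1E// lte_mul_pinfty// ge0_fin_numE.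
Qed.

HB.instance Definition _ := Measure_isSigmaFinite.Build _ _ _ cons_measure
  cons_measure_sigma_finite.

End ConsMeasure.

Section Fredholm.
Context (R : realType) (d : measure_display) (T : measurableType d).
Variable mu : {sigma_finite_measure set T -> \bar R}.

(* The k-fold product measure of [mu]; [0.-tuple T] is a single point. *)
Fixpoint power_measure (k : nat) :
    {sigma_finite_measure set (k.-tuple T) -> \bar R} :=
  match k with
  | 0%N => dirac [tuple]
  | k'.+1 => cons_measure mu (power_measure k')
  end.

Definition kernel_minor (K : T -> T -> R[i]) (k : nat) (z : k.-tuple T) : R[i] :=
  \det (\matrix_(i < k, j < k) K (tnth z i) (tnth z j)).

Definition fredholm_term (K : T -> T -> R[i]) (k : nat) : R[i] :=
  (-1) ^+ k / k`!%:R * cintegral (power_measure k) setT (kernel_minor K (k := k)).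

Definition fredholm_partial (K : T -> T -> R[i]) (m : nat) :
    (R[i] : numFieldType) :=
  1 + \sum_(1 <= k < m.+1) fredholm_term K k.

(* All the integrals and the series converge; without this [fredholm_det] may
   be a meaningless default value. *)
Definition fredholm_defined (K : T -> T -> R[i]) : Prop :=
  (forall k, cintegrable (power_measure k) setT (kernel_minor K (k := k))) /\
  cvgn (fredholm_partial K).

Definition fredholm_det (K : T -> T -> R[i]) : R[i] :=
  limn (fredholm_partial K).

End Fredholm.

Section FlatKernel.
Context (R : realType).

Definition flat_kernel (n : nat) (beta : nat -> R) (m : nat)
    (g : 'I_m -> R -> R[i]) (x y : R) : R[i] :=
  - (0 +i* (2 * pi))^-1 * contour_integral g (fun w =>
      cexp (- (x + y)%:C * w) *
      \prod_(1 <= i < n.+1) (((beta i)%:C + w) / ((beta i)%:C - w))).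

Definition chi (a x : R) : R := \1_[set u | Num.max a 0 <= u] x.

Definition cutoff (a : R) (K : R -> R -> R[i]) (x y : R) : R[i] :=
  (chi a x)%:C * K x y * (chi a y)%:C.

End FlatKernel.

(* Main.v *)
Require Import Defs.
From HB Require Import structures.
From mathcomp Require Import all_boot all_order all_algebra finmap.
From mathcomp Require Import fingroup perm complex.
From mathcomp Require Import all_classical all_reals all_analysis.
From mathcomp Require Import measurable_realfun.
From mathcomp Require Import ring lra zify.

Set Implicit Arguments.
Unset Strict Implicit.
Unset Printing Implicit Defensive.

Import Order.TTheory GRing.Theory Num.Theory.
Import numFieldNormedType.Exports.

Local Open Scope classical_set_scope.
Local Open Scope ring_scope.

(** Why the formula holds. Write [b_l = beta_(l+1)] for [l < n] and let
    [B f x] be [1 / (2 pi i)] times the contour integral of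
    [e^(xw) f(w) / prod_l (w - b_l)], for a real polynomial [f]. Both sides are
    expressed through the functions [B f], and of the contour only the following
    is used: [B] is linear in [f], multiplying [f] by [X] differentiates [B f],
    multiples of [prod_l (X - b_l)] are sent to [0], and [B f 0] is the
    coefficient of degree [n - 1] of [f] when [f] has degree below [n]
    ([residue_functional], [contour_residue_functional]). These rules determine
    [B] ([residue_unique]), since the [B f] solve a triangular system of linear
    differential equations, and they hold whether or not the [beta_i] are
    distinct. Uniqueness also gives the addition formula [residue_add], which writes
    [B (f * g) (x + y)] as a sum of [n] products.

    The right hand side. The kernel is a function of [x + y], namely
    [(-1)^(n+1) B p (- (x + y))] with [p = prod_l (X + b_l)]
    ([flat_kernelE]), so by the addition formula it has rank [n], and its
    Fredholm determinant on [[A, +oo[], where [A] is the maximum of [a] and [0],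
    is [det (1 - G)] for the matrix [G] of pairings of the two families of
    factors ([fredholm_finite_rank], [fredholm_hankel]). Integration by parts
    evaluates the pairings ([gramE]). The addition formula at [A = A + 0] and at
    [- A = A - 2A] then identifies [det (1 - G)], up to a sign and an
    exponential, with the determinant of the functions
    [p_r(d/dx) (B h_s x - B h_s (- x))] at [x = A], where
    [h_s = prod_(l < s) (X - b_l)] and [p_r = prod_(l > r) (b_l - X)]
    ([det_flat_fun]).

    The left hand side. Place the weight [omega (i + 1, n - c)] at the cell
    [i <= c]; its rate is [b_i + b_c], and the last passage times [L(i, c)] to
    the boundary of [Delta] satisfy
    [L(i, c) = weight(i, c) + max (L(i + 1, c), L(i, c - 1))], with
    [L(0, n - 1)] the time in question ([Pi_flat_lpp]). The probability that
    [L(0, c) <= a_0, ..., L(c, c) <= a_c] for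
    [a_0 >= ... >= a_c >= 0] is a determinant of the same shape with the
    argument [a_r] in row [r] ([bd_cdf], [bd_correct_all]). This is proved by
    adding the weights one by one. A new weight is independent of the earlier
    ones, so it acts on the distribution function as a convolution with an
    exponential density, that is, as the inverse of a first order differential
    operator; on the determinant that operator changes one row and leaves the
    others ([is_derive_bd_cdf], [bd_cdf_site]). A weight on the diagonal
    contributes a factor ([bd_cdf_corner]). When all the [a_r] are equal to [A]
    the determinant is the one found above ([bd_cdf_flat]). *)

(** * Derivatives of explicit functions *)

Section Derivation.
Context (R : realType).
Implicit Types (f g : R -> R) (x a b k : R).

Lemma is_derive_cstE x k : is_derive x 1 (fun _ : R => k) 0.
Proof. exact: is_derive_cst. Qed.

Lemma is_derive_addE f g x a b : is_derive x 1 f a -> is_derive x 1 g b ->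
  is_derive x 1 (fun y => f y + g y) (a + b).
Proof. by move=> df dg; exact: (is_deriveD df dg). Qed.

Lemma is_derive_subE f g x a b : is_derive x 1 f a -> is_derive x 1 g b ->
  is_derive x 1 (fun y => f y - g y) (a - b).
Proof. by move=> df dg; exact: (is_deriveB df dg). Qed.

Lemma is_derive_mulE f g x a b : is_derive x 1 f a -> is_derive x 1 g b ->
  is_derive x 1 (fun y => f y * g y) (a * g x + f x * b).
Proof.
move=> df dg; have := is_deriveM df dg.
rewrite (_ : f * g = fun y => f y * g y)// => /is_derive_eq; apply.
by rewrite /GRing.scale /= addrC mulrC (mulrC (f x)) mulrC (mulrC b).
Qed.

Lemma is_derive_mulcE f x a k : is_derive x 1 f a ->
  is_derive x 1 (fun y => k * f y) (k * a).
Proof.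
move=> df; refine (is_derive_eq (is_derive_mulE (is_derive_cstE x k) df) _).
by rewrite mul0r add0r.
Qed.

Lemma is_derive_affine x k a : is_derive x 1 (fun y => k * y + a) k.
Proof.
refine (is_derive_eq (is_derive_addE (is_derive_mulcE k (is_derive_id x 1))
  (is_derive_cstE x a)) _).
by rewrite mulr1 addr0.
Qed.

Lemma is_derive_affine_comp f x a k c : is_derive (k * x + c) 1 f a ->
  is_derive x 1 (fun y => f (k * y + c)) (k * a).
Proof.
move=> df; rewrite mulrC.
exact: (is_derive1_comp (f := f) (g := fun y => k * y + c) df (is_derive_affine x k c)).
Qed.

Lemma is_derive_expE f x a : is_derive x 1 f a ->
  is_derive x 1 (fun y => expR (f y)) (a * expR (f x)).
Proof.
by move=> df; rewrite mulrC; exact: (is_derive1_comp (f := expR) (is_derive_expR (f x)) df).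
Qed.

Lemma is_derive_sumE (I : Type) (r : seq I) (P : pred I) (f : I -> R -> R)
    (a : I -> R) x :
  (forall i, is_derive x 1 (f i) (a i)) ->
  is_derive x 1 (fun y => \sum_(i <- r | P i) f i y) (\sum_(i <- r | P i) a i).
Proof.
move=> df; elim: r => [|i r ih].
  by under eq_fun do rewrite big_nil; rewrite big_nil; exact: is_derive_cstE.
under eq_fun do rewrite big_cons; rewrite big_cons.
by case: (P i) => //; exact: is_derive_addE.
Qed.

Lemma is_derive_continuous f x a : is_derive x 1 f a -> {for x, continuous f}.
Proof.
by case=> df _; apply: differentiable_continuous; exact/derivable1_diffP.
Qed.

End Derivation.

(** * Residue functionals *)

Section ResidueFunctional.
Context (R : realType).
Implicit Types (b : nat -> R) (f g h p : {poly R}).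

Definition rootprod b (i j : nat) : {poly R} := \prod_(i <= l < j) ('X - (b l)%:P).

(** The rules satisfied by
    [B f x = 1 / (2 pi i) * oint e^(xw) f(w) / prod_(l < n) (w - b_l) dw].
    They replace an evaluation by residues, whose form depends on which of the
    [b_l] coincide. *)
Definition residue_functional (n : nat) b (B : {poly R} -> R -> R) : Prop :=
  [/\ forall x, linear (B^~ x : {poly R} -> R^o),
      forall f (x : R), is_derive x 1 (B f) (B ('X * f) x),
      forall f x, B (rootprod b 0 n * f) x = 0 &
      forall f, (size f <= n)%N -> B f 0 = f`_n.-1].

Lemma linear_ode (u : R -> R) (k : R) :
  (forall x : R, is_derive x 1 u (k * u x)) -> forall x, u x = u 0 * expR (k * x).
Proof.
move=> du x; pose v y := u y * expR (- k * y + 0).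
have dv (y : R) : is_derive y 1 v 0.
  refine (is_derive_eq (is_derive_mulE (du y) (is_derive_expE (is_derive_affine y _ _))) _).
  lra.
have : v x = v 0 by exact: is_derive_0_is_cst.
rewrite /v !mulr0 !addr0 expR0 mulr1 => <-.
by rewrite -mulrA -expRD mulNr addNr expR0 mulr1.
Qed.

(** The functions [Z g] solve triangular linear equations: removing one factor
    of [rootprod b 0 n] at a time, [Z ((X - b_l) g) = 0] turns
    [(Z g)' = Z (X g)] into [(Z g)' = b_l * Z g]. *)
Lemma residue_unique n b (Z : {poly R} -> R -> R) :
  (forall x, linear (Z^~ x : {poly R} -> R^o)) ->
  (forall g (x : R), is_derive x 1 (Z g) (Z ('X * g) x)) ->
  (forall g x, Z (rootprod b 0 n * g) x = 0) ->
  (forall g, Z g 0 = 0) -> forall g x, Z g x = 0.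
Proof.
move=> Zlin Zder Zann Z0.
suff H j : (j <= n)%N -> forall g x, Z (rootprod b 0 (n - j) * g) x = 0.
  by move=> g x; have := H n (leqnn n) g x; rewrite subnn /rootprod big_geq// mul1r.
elim: j => [|j ih] jn g x; first by rewrite subn0 Zann.
have {}ih := ih (ltnW jn); set m := (n - j.+1)%N.
have mE : (n - j = m.+1)%N by rewrite /m subnSK.
rewrite mE /rootprod big_nat_recr//= -/(rootprod b 0 m) in ih.
set h := _ * g.
have Zh y : Z (('X - (b m)%:P) * h) y = 0.
  by rewrite /h mulrA -(mulrC (rootprod b 0 m)) ih.
have dh (y : R) : is_derive y 1 (Z h) (b m * Z h y).
  refine (is_derive_eq (Zder _ _) _).
  have -> : 'X * h = b m *: h + ('X - (b m)%:P) * h.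
    by rewrite -mul_polyC; ring.
  by rewrite Zlin Zh addr0.
by rewrite (linear_ode dh) Z0 mul0r.
Qed.

Section RootProducts.
Variable b : nat -> R.
Local Notation rp := (rootprod b).

Lemma rootprod_nil i : rp i i = 1.
Proof. by rewrite /rootprod big_geq. Qed.

Lemma rootprodS i j : (i < j)%N -> rp i j = ('X - (b i)%:P) * rp i.+1 j.
Proof. by move=> ij; rewrite /rootprod big_ltn. Qed.

Lemma rootprodSr i j : (i <= j)%N -> rp i j.+1 = rp i j * ('X - (b j)%:P).
Proof. by move=> ij; rewrite /rootprod big_nat_recr. Qed.

Lemma rootprod_cat i k j : (i <= k)%N -> (k <= j)%N -> rp i j = rp i k * rp k j.
Proof. by move=> ik kj; rewrite /rootprod (big_cat_nat ik kj). Qed.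

Lemma rootprod_monic i j : rp i j \is monic.
Proof. by apply: monic_prod => l _; exact: monicXsubC. Qed.

Lemma size_rootprod i j : size (rp i j) = (j - i).+1.
Proof. by rewrite /rootprod size_prod_XsubC size_iota. Qed.

End RootProducts.

Section ResidueTheory.
Variables (n : nat) (b : nat -> R) (B : {poly R} -> R -> R).
Hypotheses (n0 : (0 < n)%N) (resB : residue_functional n b B).
Local Notation rp := (rootprod b).

Lemma residueP k f g x : B (k *: f + g) x = k * B f x + B g x.
Proof. by case: resB => lB _ _ _; rewrite lB. Qed.

Lemma residue0 x : B 0 x = 0.
Proof.
have := residueP 1 0 0 x; rewrite scaler0 add0r mul1r => /eqP.
by rewrite -subr_eq0 opprD addNKr oppr_eq0 => /eqP.
Qed.

Lemma residueD f g x : B (f + g) x = B f x + B g x.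
Proof. by have := residueP 1 f g x; rewrite scale1r mul1r. Qed.

Lemma residueZ k f x : B (k *: f) x = k * B f x.
Proof. by have := residueP k f 0 x; rewrite residue0 !addr0. Qed.

Lemma residueN f x : B (- f) x = - B f x.
Proof. by rewrite -scaleN1r residueZ mulN1r. Qed.

Lemma residueB f g x : B (f - g) x = B f x - B g x.
Proof. by rewrite residueD residueN. Qed.

Lemma residue_derive f (x : R) : is_derive x 1 (B f) (B ('X * f) x).
Proof. by case: resB. Qed.

Lemma residue_ann f x : B (rp 0 n * f) x = 0.
Proof. by case: resB. Qed.

Lemma residue_init f : (size f <= n)%N -> B f 0 = f`_n.-1.
Proof. by case: resB => _ _ _; apply. Qed.

(** [B] sees a polynomial only modulo [rp 0 n], and [rp i.+1 n], [rp 0 j] are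
   dual bases of this quotient for the form [B (f * g) 0]. *)
Lemma residue_dual i j : (i < n)%N -> (j < n)%N ->
  B (rp i.+1 n * rp 0 j) 0 = (i == j)%:R.
Proof.
move=> im jn; case: (ltngtP i j) => ij.
- rewrite (rootprod_cat b (leq0n i.+1) ij) mulrCA mulrA -(rootprod_cat b (leq0n _) im).
  exact: residue_ann.
- rewrite residue_init.
    rewrite nth_default// size_Mmonic ?monic_neq0 ?rootprod_monic//.
    rewrite !size_rootprod; move: ij im; lia.
  rewrite size_Mmonic ?monic_neq0 ?rootprod_monic// !size_rootprod; move: ij im; lia.
- rewrite -ij residue_init.
    have mon := monicMr (rp 0 i) (rootprod_monic b i.+1 n).
    have := mon; rewrite rootprod_monic => /monicP.
    rewrite lead_coefE size_Mmonic ?monic_neq0 ?rootprod_monic// !size_rootprod.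
    have -> : n.-1 = ((i - 0).+1 + (n - i.+1).+1).-2 by lia.
    by rewrite mulrC => ->.
  rewrite size_Mmonic ?monic_neq0 ?rootprod_monic// !size_rootprod; lia.
Qed.

(** The case [x + 0] of the addition formula, by induction on [g]: multiplying
    [g] by [X] shifts the two dual bases against each other, and the two extreme
    terms vanish because they contain [rp 0 n]. *)
Lemma residue_expand0 f g x :
  B (f * g) x = \sum_(0 <= j < n) B (f * rp j.+1 n) x * B (g * rp 0 j) 0.
Proof.
elim/poly_ind: g f => [|g c ih] f.
  by rewrite mulr0 residue0 big1// => j _; rewrite mul0r residue0 mulr0.
have split_gc h z : B (h * (g * 'X + c%:P)) z = B (h * 'X * g) z + c * B h z.
  rewrite -residueZ -residueD -mul_polyC; congr (B _ _); ring.
have split_gc0 j : B ((g * 'X + c%:P) * rp 0 j) 0 =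
    B (g * rp 0 j.+1) 0 + b j * B (g * rp 0 j) 0 + c * B (rp 0 j) 0.
  rewrite -!residueZ -!residueD -!mul_polyC rootprodSr//; congr (B _ _); ring.
have split_T j : (j < n)%N -> B (f * 'X * rp j.+1 n) x =
    B (f * rp j n) x + b j * B (f * rp j.+1 n) x.
  move=> jn; rewrite -!residueZ -!residueD -!mul_polyC (rootprodS b jn).
  congr (B _ _); ring.
rewrite split_gc ih.
have -> : c * B f x = \sum_(0 <= j < n) B (f * rp j.+1 n) x * (c * B (rp 0 j) 0).
  have h j : (j < n)%N -> B (rp 0 j) 0 = (n.-1 == j)%:R.
    move=> jn; rewrite -(residue_dual (i := n.-1)) ?prednK//.
    by rewrite rootprod_nil mul1r.
  rewrite (big_cat_nat (n := n.-1)) ?leq_pred//= big_nat big1 ?add0r; last first.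
    by move=> j /andP[_ jn]; rewrite h ?(leq_trans jn) ?leq_pred// gtn_eqF// !mulr0.
  rewrite -[in \sum_(_ <= _ < n) _](prednK n0) big_nat1 prednK// rootprod_nil mulr1.
  by rewrite h ?prednK// eqxx mulr1 mulrC.
under [in RHS]eq_bigr do rewrite split_gc0 !mulrDr.
rewrite !big_split /=; congr (_ + _).
rewrite big_nat; under eq_bigr => j /andP[_ jn] do rewrite split_T// mulrDl.
rewrite -big_nat big_split /=; congr (_ + _); last by apply: eq_bigr => j _; ring.
rewrite -(prednK n0) big_nat_recl// [RHS]big_nat_recr//= prednK//.
rewrite (mulrC f) residue_ann mul0r add0r.
by rewrite (mulrC g) residue_ann mulr0 addr0.
Qed.

(** Addition formula: the residue functional of [w |-> exp ((x + y) w)] splits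
    along the dual bases, like a power of the companion matrix would. *)
Lemma residue_add f g x y :
  B (f * g) (x + y) = \sum_(0 <= j < n) B (f * rp j.+1 n) x * B (g * rp 0 j) y.
Proof.
apply/eqP; rewrite -subr_eq0; apply/eqP; move: y.
pose Z g y := B (f * g) (x + y) -
  \sum_(0 <= j < n) B (f * rp j.+1 n) x * B (g * rp 0 j) y.
suff: forall g y, Z g y = 0 by exact.
apply: (@residue_unique n b).
- move=> z k p q; rewrite /Z /GRing.scale /= mulrDr -scalerAr residueP.
  under eq_bigr do rewrite mulrDl -scalerAl residueP mulrDr.
  rewrite big_split /= mulrBr mulr_sumr.
  rewrite [X in _ - (X + _)](eq_bigr (fun j => k * (B (f * rp j.+1 n) x * B (p * rp 0 j) z))).
    ring.
  by move=> j _; ring.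
- move=> p y; apply: is_derive_subE.
    have h := residue_derive (f * p) (1 * y + x).
    have := is_derive_affine_comp h; rewrite mul1r.
    under eq_fun do rewrite mul1r addrC.
    by rewrite mulrA (mulrC 'X f) -mulrA mul1r addrC.
  apply: is_derive_sumE => j; apply: is_derive_mulcE.
  by rewrite -mulrA; exact: residue_derive.
- move=> p y; rewrite /Z mulrCA residue_ann big1 ?subr0// => j _.
  by rewrite -mulrA residue_ann mulr0.
- by move=> p; rewrite /Z addr0 residue_expand0 subrr.
Qed.

End ResidueTheory.

End ResidueFunctional.

(** * Exponential decay and integration over half-lines *)

Section Decay.
Context (R : realType).
Local Notation mu := (@lebesgue_measure R).

Lemma is_derive_expRN (d A x : R) :
  is_derive x 1 (fun y : R => expR (- d * (y - A))) (- d * expR (- d * (x - A))).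
Proof.
have h := is_derive_expE (is_derive_affine x (- d) (d * A)).
have e y : - d * (y - A) = - d * y + d * A by ring.
by rewrite e; under eq_fun do rewrite e.
Qed.

Lemma continuous_expRN (d A : R) : continuous (fun y : R => expR (- d * (y - A))).
Proof. by move=> x; exact: is_derive_continuous (is_derive_expRN d A x). Qed.

Lemma cvg_expRN (d A : R) : 0 < d ->
  (fun y : R => expR (- d * (y - A))) x @[x --> +oo%R] --> (0 : R).
Proof.
move=> d0; have e y : expR (- d * (y - A)) = expR (d * A) * expR (- (d * y)).
  by rewrite -expRD; congr expR; ring.
under eq_fun do rewrite e.
rewrite -(mulr0 (expR (d * A))); apply: cvgM; first exact: cvg_cst.
apply: (@cvg_comp _ _ _ (fun y => d * y) (fun z => expR (- z)) _ (pinfty_nbhs R)).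
  exact: gt0_cvgMry.
exact: cvgr_expR.
Qed.

Lemma integrable_expRN (d A C : R) : 0 < d ->
  mu.-integrable `[A, +oo[ (fun y => (C * expR (- d * (y - A)))%:E).
Proof.
move=> d0; suff h : mu.-integrable `[A, +oo[ (fun y => (expR (- d * (y - A)))%:E).
  apply: eq_integrable (integrableZl _ C h) => // y _.
apply/integrableP; split.
  apply/measurable_EFinP; apply: measurable_funTS.
  exact: (@continuous_measurable_fun R _ (@continuous_expRN d A)).
under eq_integral do rewrite /= ger0_norm ?expR_ge0//.
pose E x := - d^-1 * expR (- d * (x - A)).
have dE (x : R) : is_derive x 1 E (expR (- d * (x - A))).
  refine (is_derive_eq (is_derive_mulcE (- d^-1) (is_derive_expRN d A x)) _).
  by rewrite mulrA mulrNN mulVf ?gt_eqF// mul1r.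
rewrite (@ge0_continuous_FTC2y _ _ E _ 0).
- by rewrite -EFinB ltry.
- by move=> x _; exact: expR_ge0.
- by apply: continuous_subspaceT; exact: continuous_expRN.
- by rewrite -(mulr0 (- d^-1)); apply: cvgM; [exact: cvg_cst|exact: cvg_expRN].
- by move=> x _; exact: ex_derive.
- by apply: cvg_at_right_filter; exact: is_derive_continuous (dE A).
- by move=> x _; rewrite derive1E derive_val.
Qed.

Lemma integrable_decay (f : R -> R) (d A C : R) : 0 < d -> continuous f ->
  (forall y, A <= y -> `|f y| <= C * expR (- d * (y - A))) ->
  mu.-integrable `[A, +oo[ (EFin \o f).
Proof.
move=> d0 cf fC; apply: le_integrable (integrable_expRN A C d0) => //.
  by apply/measurable_EFinP; apply: measurable_funTS; exact: (@continuous_measurable_fun R).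
move=> y /=; rewrite in_itv/= andbT => Ay.
by rewrite lee_fin (le_trans (fC _ Ay))// ler_norm.
Qed.

(** Adding a multiple of [exp (- d y)] makes the integrand nonnegative, which
    gives access to the fundamental theorem on a half-line. *)
Lemma Rintegral_decay (F f : R -> R) (d A C : R) : 0 < d -> continuous f ->
  (forall y : R, is_derive y 1 F (f y)) ->
  (forall y, A <= y -> `|f y| <= C * expR (- d * (y - A))) ->
  (forall y, A <= y -> `|F y| <= C * expR (- d * (y - A))) ->
  \int[mu]_(y in `[A, +oo[) f y = - F A.
Proof.
move=> d0 cf dF fC FC.
pose e (y : R) : R := C * expR (- d * (y - A)); pose E (y : R) : R := - d^-1 * e y.
have ce : continuous e.
  by move=> x; apply: is_derive_continuous (is_derive_mulcE C (is_derive_expRN d A x)).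
have dE (x : R) : is_derive x 1 E (e x).
  have h := is_derive_mulcE (- d^-1) (is_derive_mulcE C (is_derive_expRN d A x)).
  refine (is_derive_eq h _); rewrite /e.
  by field; rewrite gt_eqF.
have cve : e x @[x --> +oo%R] --> (0 : R).
  by rewrite -(mulr0 C); apply: cvgM; [exact: cvg_cst|exact: cvg_expRN].
have cvE : E x @[x --> +oo%R] --> (0 : R).
  by rewrite -(mulr0 (- d^-1)); apply: cvgM => //; exact: cvg_cst.
have cvF : F x @[x --> +oo%R] --> (0 : R).
  apply: norm_cvg0; apply: (@squeeze_cvgr _ _ _ _ (cst 0) e) => //; last exact: cvg_cst.
  by near=> y; rewrite normr_ge0 FC.
have ftc (G g : R -> R) : (forall y, A <= y -> 0 <= g y) -> continuous g ->
    (forall y : R, is_derive y 1 G (g y)) -> G x @[x --> +oo%R] --> (0 : R) ->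
    \int[mu]_(y in `[A, +oo[) g y = - G A.
  move=> g0 cg dG cvG; rewrite (@Rintegral_ge0_continuous_FTC2y _ g G A 0) ?sub0r//.
  - exact: continuous_subspaceT.
  - by apply: cvg_at_right_filter; exact: is_derive_continuous (dG A).
  - by move=> x _; rewrite derive1E; have h := dG x; rewrite derive_val.
have ie : mu.-integrable `[A, +oo[ (EFin \o e) by exact: integrable_expRN.
have if_ : mu.-integrable `[A, +oo[ (EFin \o f) by exact: integrable_decay fC.
have e0 y : A <= y -> 0 <= e y by move=> Ay; exact: le_trans (fC _ Ay).
have := ftc (fun y => F y + E y) (fun y => f y + e y).
rewrite RintegralD// (ftc E e)// opprD => h.
apply: (addIr (- E A)); apply: h.
- by move=> y Ay; have := fC y Ay; rewrite ler_norml /e => /andP[+ _]; lra.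
- by move=> x; apply: continuousD; [exact: cf|exact: ce].
- by rewrite -(addr0 0); apply: cvgD.
Unshelve. all: end_near. Qed.

End Decay.

(** * Exponential decay for linear differential equations *)

Section DecayODE.
Context (R : realType).

(** Compare [u] with the solution: the function [g] of the proof is
    nondecreasing, because [exp (k s) u s] has derivative [exp (k s) e s]. *)
Lemma decay_ode_le (u e : R -> R) (k d C : R) : 0 <= C -> d < k ->
  (forall x : R, is_derive x 1 u (- k * u x + e x)) ->
  (forall s, 0 <= s -> e s <= C * expR (- d * s)) ->
  forall s, 0 <= s -> u s <= (`|u 0| + C / (k - d)) * expR (- d * s).
Proof.
move=> C0 dk du eC s s0; have kd0 : 0 < k - d by rewrite subr_gt0.
pose g y := C / (k - d) * expR ((k - d) * y + 0) - expR (k * y + 0) * u y.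
have dg (y : R) : is_derive y 1 g (expR (k * y) * (C * expR (- d * y) - e y)).
  have h1 := is_derive_mulcE (C / (k - d)) (is_derive_expE (is_derive_affine y (k - d) 0)).
  have h2 := is_derive_mulE (is_derive_expE (is_derive_affine y k 0)) (du y).
  refine (is_derive_eq (is_derive_subE h1 h2) _); rewrite !addr0.
  rewrite (_ : (k - d) * y = k * y + - d * y) ?expRD; last by ring.
  by field; rewrite gt_eqF.
have gge : g 0 <= g s.
  apply: (@ger0_derive1_ndecry R g 0) => //.
  - move=> x; rewrite in_itv/= andbT => /ltW x0; rewrite derive1E derive_val.
    by rewrite mulr_ge0 ?expR_ge0// subr_ge0 eC.
  - by apply: continuous_subspaceT => x; exact: is_derive_continuous (dg x).
move: gge; rewrite /g !mulr0 !addr0 expR0 mulr1 mul1r.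
rewrite (_ : (k - d) * s = k * s + - d * s) ?expRD; last by ring.
set E := expR (k * s) => h; have E0 : 0 < E by exact: expR_gt0.
have D1 : 1 <= E * expR (- d * s).
  by rewrite /E -expRD -[leLHS]expR0 ler_expR -mulrDl mulr_ge0// ltW.
have Ck : 0 <= C / (k - d) by rewrite divr_ge0// ltW.
rewrite -(ler_pM2l E0); apply: le_trans (_ : u 0 + C / (k - d) * (E * expR (- d * s)) <= _).
  by move: h; lra.
rewrite [leRHS]mulrCA [leRHS]mulrDl lerD2r (le_trans (ler_norm _))//.
by rewrite -[leLHS]mulr1 ler_wpM2l.
Qed.

Lemma decay_ode (u e : R -> R) (k d C : R) : d < k ->
  (forall x : R, is_derive x 1 u (- k * u x + e x)) ->
  (forall s, 0 <= s -> `|e s| <= C * expR (- d * s)) ->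
  forall s, 0 <= s -> `|u s| <= (`|u 0| + C / (k - d)) * expR (- d * s).
Proof.
move=> dk du eC s s0.
have C0 : 0 <= C.
  by have := eC 0 (lexx 0); rewrite mulr0 expR0 mulr1; exact: le_trans.
have e1 t : 0 <= t -> e t <= C * expR (- d * t).
  by move=> t0; exact: le_trans (ler_norm _) (eC _ t0).
have e2 t : 0 <= t -> - e t <= C * expR (- d * t).
  by move=> t0; rewrite (le_trans _ (eC _ t0))// ler_normr lexx orbT.
have h1 := decay_ode_le C0 dk du e1 s0.
have du' (x : R) : is_derive x 1 (fun y => - u y) (- k * (- u x) + - e x).
  by refine (is_derive_eq (is_deriveN (du x)) _); ring.
have := decay_ode_le C0 dk du' e2 s0.
by rewrite normrN => h2; rewrite ler_norml lerNl h1 h2.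
Qed.

End DecayODE.

(** * Pairing residues over a half-line *)

Section Pairing.
Context (R : realType).
Variables (n : nat) (b : nat -> R) (B : {poly R} -> R -> R).
Hypotheses (n0 : (0 < n)%N) (resB : residue_functional n b B).
Hypothesis b_gt0 : forall l, (l < n)%N -> 0 < b l.
Local Notation rp := (rootprod b).
Local Notation mu := (@lebesgue_measure R).
Implicit Types (f g h : {poly R}).

Lemma is_derive_residue_sub f (c y : R) :
  is_derive y 1 (fun z => B f (c - z)) (- B ('X * f) (c - y)).
Proof.
have e (z : R) : -1 * z + c = c - z by ring.
have := is_derive_affine_comp (residue_derive resB f (-1 * y + c)).
by under eq_fun do rewrite e; rewrite e mulN1r.
Qed.

Lemma continuous_residue_sub f (c : R) : continuous (fun y => B f (c - y)).
Proof. by move=> y; exact: is_derive_continuous (is_derive_residue_sub f c y). Qed.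

(** [B f] is a combination of the functions [x ^ m * exp (b_l x)]; peeling the
    factors of [rp 0 n] as for uniqueness avoids naming them. *)
Lemma residue_decay : exists2 d, 0 < d & forall f, exists C, forall s, 0 <= s ->
  `|B f (- s)| <= C * expR (- d * s).
Proof.
(* A rate below all the [b_l], so that resonances cost no power of [s]. *)
have [d d0 db] : exists2 d, 0 < d & forall l, (l < n)%N -> d < b l.
  elim: n b_gt0 => [|m ih] bm; first by exists 1.
  have [l lm|d d0 dm] := ih; first by apply: bm; rewrite ltnS ltnW.
  exists (Num.min d (b m / 2)).
    by rewrite lt_min d0 divr_gt0// bm.
  move=> l; rewrite ltnS leq_eqVlt => /predU1P[->|lm].
    by rewrite gt_min ltr_pdivrMr// ltr_pMr ?bm// ltr1n orbT.
  by rewrite gt_min dm.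
exists d => //.
suff H j : (j <= n)%N -> forall f, exists C, forall s, 0 <= s ->
    `|B (rp 0 (n - j) * f) (- s)| <= C * expR (- d * s).
  by move=> f; have := H n (leqnn n) f; rewrite subnn rootprod_nil mul1r.
elim: j => [|j ih] jn f.
  by exists 0 => s _; rewrite subn0 (residue_ann resB) normr0 mul0r.
have [C HC] := ih (ltnW jn) f; set m := (n - j.+1)%N.
have mE : (n - j = m.+1)%N by rewrite /m subnSK.
have mn : (m < n)%N by rewrite /m; lia.
rewrite mE rootprodSr// in HC; set h := rp 0 m * f.
pose e s := - B (('X - (b m)%:P) * h) (- s).
exists (`|B h (- 0)| + C / (b m - d)); apply: (@decay_ode R (fun s => B h (- s)) e).
- exact: db.
- move=> x.
  have := is_derive_residue_sub h 0 x.
  under eq_fun do rewrite sub0r.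
  rewrite sub0r => dh; refine (is_derive_eq dh _).
  rewrite /e mulrBl (residueB resB) mul_polyC (residueZ resB); ring.
- move=> s s0; rewrite /e normrN /h mulrA (mulrC _ (rp 0 m)); exact: HC.
Qed.

Variable A : R.
Hypothesis A0 : 0 <= A.

(** The entries of the Gram matrix below have this form: [h] comes from a
    factor at [A - y], [f] from a factor at [- A - y]. *)
Definition pairing f h := \int[mu]_(y in `[A, +oo[) (B f (- A - y) * B h (A - y)).

Lemma continuous_pairing f h : continuous (fun y => B f (- A - y) * B h (A - y)).
Proof. by move=> y; apply: continuousM; exact: continuous_residue_sub. Qed.

Lemma residue_pairing_decay : exists2 d, 0 < d & forall f h, exists C,
  forall y, A <= y -> `|B f (- A - y) * B h (A - y)| <= C * expR (- d * (y - A)).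
Proof.
have [d d0 dB] := residue_decay; exists d => // f h.
have [C HC] := dB f; have [C' HC'] := dB h.
exists (C * C') => y Ay.
have yA : 0 <= y - A by rewrite subr_ge0.
have yA' : 0 <= A + y by rewrite addr_ge0// (le_trans A0).
have C0 : 0 <= C.
  by have := HC 0 (lexx 0); rewrite mulr0 expR0 mulr1; exact: le_trans.
rewrite normrM -mulrA ler_pM//.
  rewrite -opprD (le_trans (HC _ yA'))// -[leRHS]mulr1 ler_wpM2l//.
  by rewrite -expR0 ler_expR mulNr oppr_le0 mulr_ge0// ltW.
by rewrite -[A - y]opprB; exact: HC'.
Qed.

Lemma integrable_pairing f h :
  mu.-integrable `[A, +oo[ (fun y => (B f (- A - y) * B h (A - y))%:E).
Proof.
have [d d0 /(_ f h)[C HC]] := residue_pairing_decay.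
exact: (@integrable_decay R (fun y => B f (- A - y) * B h (A - y)) d A C d0
  (@continuous_pairing f h) HC).
Qed.

Lemma pairing_parts f h :
  pairing ('X * f) h + pairing f ('X * h) = B f (- A - A) * B h 0.
Proof.
rewrite /pairing -RintegralD//; try exact: integrable_pairing.
have [d d0 dB] := residue_pairing_decay.
have [C0 H0] := dB f h; have [C1 H1] := dB ('X * f) h; have [C2 H2] := dB f ('X * h).
pose C := `|C0| + (`|C1| + `|C2|).
pose g y := B ('X * f) (- A - y) * B h (A - y) + B f (- A - y) * B ('X * h) (A - y).
apply: (@etrans _ _ (- - (B f (- A - A) * B h (A - A)))); last by rewrite subrr opprK.
apply: (@Rintegral_decay R (fun y => - (B f (- A - y) * B h (A - y))) g d A C d0).
- by move=> y; exact: (continuousD (@continuous_pairing ('X * f) h y)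
  (@continuous_pairing f ('X * h) y)).
- move=> y; refine (is_derive_eq (is_deriveN (is_derive_mulE
    (is_derive_residue_sub f (- A) y) (is_derive_residue_sub h A y))) _).
  rewrite /g; ring.
- move=> y Ay; rewrite (le_trans (ler_normD _ _))//.
  have e0 := expR_ge0 (- d * (y - A)).
  have := H1 y Ay; have := H2 y Ay.
  have := ler_wpM2r e0 (ler_norm C1); have := ler_wpM2r e0 (ler_norm C2).
  have : 0 <= `|C0| * expR (- d * (y - A)) by rewrite mulr_ge0.
  rewrite /C !mulrDl; lra.
- move=> y Ay; rewrite normrN (le_trans (H0 _ Ay))// ler_wpM2r ?expR_ge0//.
  by rewrite /C (le_trans (ler_norm _))// lerDl addr_ge0.
Qed.

Lemma pairingD f g h : pairing (f + g) h = pairing f h + pairing g h.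
Proof.
rewrite /pairing -RintegralD//; try exact: integrable_pairing.
by apply: eq_Rintegral => y _; rewrite (residueD resB) mulrDl.
Qed.

Lemma pairingZ k f h : pairing (k *: f) h = k * pairing f h.
Proof.
rewrite /pairing -RintegralZl//; last exact: integrable_pairing.
by apply: eq_Rintegral => y _; rewrite (residueZ resB) mulrA.
Qed.

Lemma pairing_subr k f h : pairing f (('X - k%:P) * h) = pairing f ('X * h) - k * pairing f h.
Proof.
rewrite /pairing -RintegralZl//; last exact: integrable_pairing.
rewrite -RintegralB//; [|exact: integrable_pairing|]; last first.
  by apply: eq_integrable (integrable_pairing (k *: f) h) => //= y _;
    rewrite (residueZ resB) mulrA.
apply: eq_Rintegral => y _.
by rewrite mulrBl (residueB resB) mul_polyC (residueZ resB); ring.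
Qed.

Definition sumprod (i j : nat) : {poly R} := \prod_(i <= l < j) ('X + (b l)%:P).

Lemma sumprod_nil i : sumprod i i = 1.
Proof. by rewrite /sumprod big_geq. Qed.

Lemma sumprod_cat i k j : (i <= k)%N -> (k <= j)%N ->
  sumprod i j = sumprod i k * sumprod k j.
Proof. by move=> ik kj; rewrite /sumprod (big_cat_nat ik kj). Qed.

Lemma sumprodSr i j : (i <= j)%N -> sumprod i j.+1 = sumprod i j * ('X + (b j)%:P).
Proof. by move=> ij; rewrite /sumprod big_nat_recr. Qed.

(** Each factor [X + b_l] moves across by parts to become [- (X - b_l)], and the
    last one produces a multiple of [rp 0 n], on which [B] vanishes. *)
Lemma pairing_sumprod f l : (l < n)%N ->
  pairing (f * sumprod 0 l.+1) (rp l.+1 n) = (-1) ^+ l * B f (- A - A).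
Proof.
have move_factor g k h : pairing (g * ('X + k%:P)) h =
    B g (- A - A) * B h 0 - pairing g (('X - k%:P) * h).
  rewrite -pairing_parts pairing_subr mulrDr (mulrC g k%:P) mul_polyC pairingD pairingZ.
  rewrite (mulrC g); ring.
elim: l f => [|l ih] f ln; rewrite sumprodSr// mulrA move_factor -rootprodS//.
  rewrite sumprod_nil mulr1 expr0 mul1r.
  have := residue_dual n0 resB ln ln; rewrite rootprod_nil mulr1 eqxx => ->.
  rewrite mulr1 (_ : pairing f (rp 0 n) = 0) ?subr0//.
  rewrite -[RHS](mul0r (fine (mu `[A, +oo[))) -Rintegral_cst//.
  apply: eq_Rintegral => y _.
  by rewrite -[rp 0 n]mulr1 (residue_ann resB) mulr0.
rewrite ih ?(ltnW ln)//.
have := residue_dual n0 resB ln n0; rewrite rootprod_nil mulr1 => ->.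
by rewrite mulr0 sub0r exprS mulN1r mulNr.
Qed.

End Pairing.

(** * The rank n splitting and its Gram matrix *)

Section FlatFunction.
Context (R : realType).
Variables (n : nat) (b : nat -> R) (B : {poly R} -> R -> R).
Hypotheses (n0 : (0 < n)%N) (resB : residue_functional n b B).
Local Notation rp := (rootprod b).
Implicit Types (f g h p : {poly R}).

Definition diffprod (i j : nat) : {poly R} := \prod_(i <= l < j) ((b l)%:P - 'X).

Lemma diffprod_nil i : diffprod i i = 1.
Proof. by rewrite /diffprod big_geq. Qed.

Lemma diffprodS i j : (i < j)%N -> diffprod i j = ((b i)%:P - 'X) * diffprod i.+1 j.
Proof. by move=> ij; rewrite /diffprod big_ltn. Qed.

Lemma diffprodSr i j : (i <= j)%N -> diffprod i j.+1 = diffprod i j * ((b j)%:P - 'X).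
Proof. by move=> ij; rewrite /diffprod big_nat_recr. Qed.

Lemma diffprodE i j : diffprod i j = (-1) ^+ (j - i) *: rp i j.
Proof.
rewrite /diffprod /rootprod (eq_bigr (fun l => (-1)%:P * ('X - (b l)%:P))); last first.
  by move=> l _; rewrite polyCN mulN1r opprB.
by rewrite big_split /= prodr_const_nat -rmorphXn mul_polyC.
Qed.

Lemma comp_diffprod i j : diffprod i j \Po - 'X = sumprod b i j.
Proof.
rewrite rmorph_prod; apply: eq_bigr => l _.
by rewrite /= rmorphB /= comp_polyC comp_polyX opprK addrC.
Qed.

(** [flat_fun f p] is the constant coefficient operator [p(d/dx)] applied to
    the odd function [x |-> B f x - B f (- x)]. *)
Definition flat_fun f p x := B (p * f) x - B ((p \Po - 'X) * f) (- x).

Lemma is_derive_flat_fun f p (x : R) :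
  is_derive x 1 (flat_fun f p) (flat_fun f ('X * p) x).
Proof.
have dN := is_derive_residue_sub resB ((p \Po - 'X) * f) 0 x.
have dP := residue_derive resB (p * f) x.
have -> : flat_fun f p = fun y => B (p * f) y - B ((p \Po - 'X) * f) (0 - y).
  by apply/funext => y; rewrite sub0r.
refine (is_derive_eq (is_derive_subE dP dN) _).
rewrite /flat_fun rmorphM /= comp_polyX sub0r opprK mulNr mulNr (residueN resB) opprK.
by rewrite !mulrA.
Qed.

Lemma flat_funDr f p q x : flat_fun f (p + q) x = flat_fun f p x + flat_fun f q x.
Proof. by rewrite /flat_fun rmorphD /= !mulrDl !(residueD resB); ring. Qed.

Lemma flat_funZr f k p x : flat_fun f (k *: p) x = k * flat_fun f p x.
Proof. by rewrite /flat_fun linearZ /= -!scalerAl !(residueZ resB) mulrBr. Qed.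

Lemma flat_funDl f g p x : flat_fun (f + g) p x = flat_fun f p x + flat_fun g p x.
Proof. by rewrite /flat_fun !mulrDr !(residueD resB); ring. Qed.

Lemma flat_funZl f k p x : flat_fun (k *: f) p x = k * flat_fun f p x.
Proof. by rewrite /flat_fun -!scalerAr !(residueZ resB) mulrBr. Qed.

Lemma flat_fun_even f p q x : q \Po - 'X = q -> flat_fun f (q * p) x = flat_fun (q * f) p x.
Proof.
move=> qe; rewrite /flat_fun rmorphM /= qe; congr (B _ _ - B _ _); ring.
Qed.

Lemma flat_fun_ann f p x : flat_fun (rp 0 n * f) p x = 0.
Proof. by rewrite /flat_fun !(mulrCA _ (rp 0 n)) !(residue_ann resB) subrr. Qed.

Lemma flat_fun0 f : flat_fun f 1 0 = 0.
Proof. by rewrite /flat_fun rmorph1 !mul1r oppr0 subrr. Qed.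

(** Cancelling all the factors but one leaves a single pole. *)
Lemma residue_exp f l x : (l < n)%N -> f = rp 0 l * rp l.+1 n ->
  B f x = expR (b l * x).
Proof.
move=> ln ->; set h := _ * _.
have dB (y : R) : is_derive y 1 (B h) (b l * B h y).
  refine (is_derive_eq (residue_derive resB _ y) _).
  rewrite -(residueZ resB) -[RHS]addr0 -[0 in RHS](residue_ann resB 1 y).
  rewrite -(residueD resB) -mul_polyC (rootprod_cat b (leq0n l) (ltnW ln)) (rootprodS b ln).
  congr (B _ _); rewrite /h; ring.
rewrite (linear_ode dB); suff -> : B h 0 = 1 by rewrite mul1r.
by rewrite /h mulrC (residue_dual n0 resB)// eqxx.
Qed.

Variable A : R.
Hypotheses (A0 : 0 <= A) (b_gt0 : forall l, (l < n)%N -> 0 < b l).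
Local Notation mu := (@lebesgue_measure R).

(** Shifting the arguments by [A] makes both factors decay exponentially on
    [[A, +oo[], as [A - x] and [- A - y] are nonpositive there. *)
Definition decay_left (j : nat) (x : R) : R := B (rp j.+1 n) (A - x).
Definition decay_right (j : nat) (y : R) : R :=
  (-1) ^+ n.+1 * B (sumprod b 0 n * rp 0 j) (- A - y).

(** A function of [x + y] built from [B] has rank at most [n]. *)
Lemma hankel_split x y :
  (-1) ^+ n.+1 * B (sumprod b 0 n) (- (x + y)) =
  \sum_(j < n) decay_left j x * decay_right j y.
Proof.
have -> : - (x + y) = (A - x) + (- A - y) by ring.
rewrite -[sumprod b 0 n]mul1r (residue_add n0 resB) big_mkord mulr_sumr.
by apply: eq_bigr => j _; rewrite /decay_left /decay_right !mul1r mulrCA.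
Qed.

Definition gram : 'M[R]_n :=
  \matrix_(j, l) \int[mu]_(y in `[A, +oo[) (decay_right j y * decay_left l y).

(** The factors [X + b_i] with [i <= l] of [sumprod b 0 n] are the ones that
    integration by parts can absorb into [rp l.+1 n]. *)
Lemma gramE (j l : 'I_n) :
  gram j l = (-1) ^+ (n.-1 - l) * B (sumprod b l.+1 n * rp 0 j) (- A - A).
Proof.
rewrite mxE /decay_left /decay_right.
under eq_Rintegral do rewrite -mulrA.
rewrite RintegralZl//; last first.
  exact: (integrable_pairing n0 resB b_gt0 A0).
have -> : sumprod b 0 n * rp 0 j = (sumprod b l.+1 n * rp 0 j) * sumprod b 0 l.+1.
  by rewrite (sumprod_cat b (leq0n l.+1) (ltn_ord l)); ring.
have := pairing_sumprod n0 resB b_gt0 A0 (sumprod b l.+1 n * rp 0 j) (ltn_ord l).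
rewrite /pairing => ->; rewrite mulrA -exprD; congr (_ * _).
have -> : (n.+1 + l = (n.-1 - l) + (l.+1).*2)%N by have := ltn_ord l; rewrite -addnn; lia.
by rewrite exprD -muln2 mulnC exprM sqrrN expr1n expr1n mulr1.
Qed.

Lemma sign_prod m : \prod_(r < m) (-1) ^+ (m.-1 - r) = (-1) ^+ 'C(m, 2) :> R.
Proof.
rewrite prodrXr; congr (_ ^+ _); case: m => [|m]; first by rewrite big_ord0.
rewrite -bin2_sum big_mkord (reindex_inj rev_ord_inj) /=.
by apply: eq_bigr => i _; rewrite subSS; have := ltn_ord i; lia.
Qed.

(** The addition formula at [A = A + 0] and [- A = A - 2 A] splits the matrix
    into a triangular one, with the exponentials [exp (b_s A)] on its diagonal,
    and [1 - gram]. *)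
Lemma det_flat_fun :
  \det (\matrix_(s < n, r < n) flat_fun (rp 0 s) (diffprod r.+1 n) A) =
  (-1) ^+ 'C(n, 2) * expR (A * \sum_(r < n) b r) * \det (1%:M - gram).
Proof.
pose X : 'M[R]_n := \matrix_(s, j) B (rp 0 s * rp j.+1 n) A.
pose D : 'rV[R]_n := \row_r (-1) ^+ (n.-1 - r).
have gE (j r : 'I_n) : (1%:M - gram) j r = (j == r)%:R - gram j r.
  by rewrite mxE [X in X + _]mxE [X in _ + X]mxE.
have sqD k : (-1) ^+ k * (-1) ^+ k = 1 :> R by rewrite -expr2 sqrr_sign.
have -> : (\matrix_(s < n, r < n) flat_fun (rp 0 s) (diffprod r.+1 n) A) =
    X *m (1%:M - gram) *m diag_mx D.
  apply/matrixP => s r; rewrite mul_mx_diag [LHS]mxE [RHS]mxE [(_ *m _) _ _]mxE.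
  rewrite [D _ _]mxE mulr_suml /flat_fun comp_diffprod.
  have dB g : B (g * rp 0 s) A = \sum_(j < n) X s j * B (g * rp 0 j) 0.
    rewrite -[A in LHS]addr0 mulrC (residue_add n0 resB) big_mkord.
    by apply: eq_bigr => j _; rewrite mxE.
  have sB g : B (g * rp 0 s) (- A) = \sum_(j < n) X s j * B (g * rp 0 j) (- A - A).
    have -> : - A = A + (- A - A) by ring.
    rewrite mulrC (residue_add n0 resB) big_mkord.
    by apply: eq_bigr => j _; rewrite mxE; congr (_ * B _ _); ring.
  rewrite dB sB -sumrB; apply: eq_bigr => j _.
  rewrite gE gramE -mulrBr -mulrA; congr (_ * _).
  rewrite diffprodE -scalerAl (residueZ resB) (residue_dual n0 resB)// mulrBl.
  rewrite [X in _ = _ - X]mulrAC sqD mul1r; congr (_ - _).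
  by rewrite mulrC eq_sym; congr (_%:R * _ ^+ _); have := ltn_ord r; lia.
rewrite !det_mulmx det_diag.
have -> : \det X = expR (A * \sum_(r < n) b r).
  rewrite -det_tr det_trig; last first.
    apply/is_trig_mxP => j s js; rewrite !mxE.
    rewrite (rootprod_cat b (leq0n j.+1) js) mulrAC -(rootprod_cat b (leq0n _) (ltn_ord j)).
    by rewrite (residue_ann resB).
  rewrite mulr_sumr expR_sum; apply: eq_bigr => s _.
  by rewrite !mxE (residue_exp (l := s))// mulrC.
under eq_bigr do rewrite mxE.
rewrite sign_prod; ring.
Qed.

End FlatFunction.

(** * Derivatives of determinants *)

Section DeterminantDerivative.
Context (R : realType).

Lemma is_derive_prodE (I : eqType) (r : seq I) (f : I -> R -> R) (d : I -> R) (x : R) :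
  uniq r -> (forall i, is_derive x 1 (f i) (d i)) ->
  is_derive x 1 (fun y => \prod_(i <- r) f i y)
    (\sum_(k <- r) \prod_(i <- r) (if i == k then d i else f i x)).
Proof.
move=> + df; elim: r => [_|k r ih /= /andP[kr ur]].
  by under eq_fun do rewrite big_nil; rewrite big_nil; exact: is_derive_cstE.
under eq_fun do rewrite big_cons.
refine (is_derive_eq (is_derive_mulE (df k) (ih ur)) _).
rewrite big_cons big_cons eqxx; congr (_ * _ + _).
  by apply: eq_big_seq => i ir; rewrite ifN//; apply: contraNneq kr => <-.
rewrite mulr_sumr; apply: eq_big_seq => l lr.
by rewrite big_cons ifN//; apply: contraNneq kr => ->.
Qed.

Definition set_row m (i0 : 'I_m) (D M : 'M[R]_m) : 'M[R]_m :=
  \matrix_(i, j) (if i == i0 then D i j else M i j).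

Lemma row'_set_row m (i0 : 'I_m) (D M : 'M[R]_m) : row' i0 (set_row i0 D M) = row' i0 M.
Proof. by apply/matrixP => i j; rewrite !mxE eq_sym (negbTE (neq_lift _ _)). Qed.

Lemma row_set_row m (i0 : 'I_m) (D M : 'M[R]_m) : row i0 (set_row i0 D M) = row i0 D.
Proof. by apply/matrixP => i j; rewrite !mxE eqxx. Qed.

Lemma set_row_id m (i0 : 'I_m) (M : 'M[R]_m) : set_row i0 M M = M.
Proof. by apply/matrixP => i j; rewrite !mxE; case: ifP. Qed.

Lemma det_set_row_lin m (i0 : 'I_m) (k l : R) (D E F M : 'M[R]_m) :
  row i0 F = k *: row i0 D + l *: row i0 E ->
  \det (set_row i0 F M) = k * \det (set_row i0 D M) + l * \det (set_row i0 E M).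
Proof.
move=> e; apply: (@determinant_multilinear _ _ _ _ _ i0).
- by rewrite !row_set_row.
- by rewrite !row'_set_row.
- by rewrite !row'_set_row.
Qed.

(** The determinant is a sum of products with one factor from each row. *)
Lemma is_derive_det m (M : R -> 'M[R]_m) (D : 'M[R]_m) (x : R) :
  (forall i j, is_derive x 1 (fun y => M y i j) (D i j)) ->
  is_derive x 1 (fun y => \det (M y)) (\sum_i \det (set_row i D (M x))).
Proof.
move=> dM; rewrite /determinant exchange_big /=; apply: is_derive_sumE => s.
rewrite -mulr_sumr; apply: is_derive_mulcE.
refine (is_derive_eq (is_derive_prodE (index_enum_uniq _) (fun i => dM i (s i))) _).
by apply: eq_bigr => k _; apply: eq_bigr => i _; rewrite mxE.
Qed.

End DeterminantDerivative.

(** * A determinant for last passage times along a boundary *)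

Section BoundaryFunction.
Context (R : realType).
Variables (n : nat) (b : nat -> R) (B : {poly R} -> R -> R).
Hypotheses (n0 : (0 < n)%N) (resB : residue_functional n b B).
Hypothesis b_gt0 : forall l, (l < n)%N -> 0 < b l.
Local Notation rp := (rootprod b).
Local Notation flat := (flat_fun B).

(** Row [r < k] carries the additional factor [b_c + X] as long as the weight at
    [(r, c)], of rate [b_r + b_c], has not been added. *)
Definition row_op (c k r : nat) : {poly R} :=
  if (k <= r)%N then diffprod b r.+1 c.+1
  else ((b c)%:P + 'X) * diffprod b r.+1 c.+1.

Definition bd_mx (c k : nat) (a : nat -> R) : 'M[R]_c.+1 :=
  \matrix_(r, s) flat (rp 0 s * rp c.+1 n) (row_op c k r) (a r).

(** For nonincreasing [a] with nonnegative entries, [bd_cdf c k a] is the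
    probability that the last passage times [L r] of a boundary are at most
    [a r] for all [r <= c], where [L r] is measured at the cell [(r, c)] if
    [k <= r] and at [(r, c - 1)] if [r < k]. *)
Definition bd_cdf (c k : nat) (a : nat -> R) : R :=
  (-1) ^+ 'C(c.+1, 2) / (\prod_(s < k) (b s + b c)) *
  expR (- \sum_(r < c.+1) b r * a r) * \det (bd_mx c k a).

(** The last row then consists of odd functions at [0]. *)
Lemma bd_cdf0 c k a : (k <= c)%N -> a c = 0 -> bd_cdf c k a = 0.
Proof.
move=> kc ac; rewrite /bd_cdf (expand_det_row _ ord_max) [X in _ * X]big1 ?mulr0// => s _.
by rewrite mxE /row_op kc diffprod_nil ac flat_fun0 mul0r.
Qed.

(** The single weight at the corner, of rate [2 b_0]. *)
Lemma bd_cdf_corner00 a : bd_cdf 0 0 a = 1 - expR (- (2 * b 0) * a 0%N).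
Proof.
rewrite /bd_cdf /= big_ord0 invr1 !mulr1 expr0 mul1r big_ord1.
rewrite det_mx11 mxE /row_op leq0n diffprod_nil /flat_fun rmorph1 !mul1r.
rewrite !(residue_exp n0 resB _ n0 (f := rp 0 0 * rp 1 n))// mulrBr -!expRD.
by rewrite addNr expR0; congr (_ - expR _); rewrite /=; ring.
Qed.

(** A diagonal site is independent of everything before it. In the determinant,
    [b_c ^ 2 - d^2/dx^2] kills the last function and turns the others into
    triangular combinations of the functions of the previous column. *)
Lemma bd_cdf_corner c a : (c.+1 < n)%N ->
  bd_cdf c.+1 c.+1 a = (1 - expR (- (2 * b c.+1) * a c.+1)) * bd_cdf c 0 a.
Proof.
move=> cn; set C := c.+1.
have Cn : (C < n)%N by [].
have evenE (r s : nat) x : (r < C)%N ->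
    flat (rp 0 s * rp C.+1 n) (row_op C C r) x =
    - flat (('X + (b C)%:P) * rp 0 s * rp C n) (diffprod b r.+1 C) x.
  move=> rC; rewrite /row_op leqNgt rC /=.
  rewrite diffprodSr//.
  have qe : (((b C)%:P + 'X) * ((b C)%:P - 'X)) \Po - 'X = ((b C)%:P + 'X) * ((b C)%:P - 'X).
    by rewrite rmorphM rmorphD rmorphB /= comp_polyC comp_polyX opprK mulrC.
  rewrite (_ : _ * (_ * _) = (((b C)%:P + 'X) * ((b C)%:P - 'X)) * diffprod b r.+1 C);
    last by ring.
  rewrite (flat_fun_even _ _ _ _ qe) -[RHS]mulN1r -(flat_funZl resB) -mul_polyC polyCN
    (rootprodS b Cn).
  congr (flat _ _ _); ring.
have lastE (r : nat) x : (r < C)%N ->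
    flat (rp 0 C * rp C.+1 n) (row_op C C r) x = 0.
  move=> rC; rewrite evenE// -mulrA -(rootprod_cat b)//; last exact: ltnW.
  by rewrite mulrC (flat_fun_ann resB) oppr0.
rewrite /bd_cdf (expand_det_col _ ord_max) [X in _ * X]big_ord_recr /=
  [X in X + _]big1 => [|r _]; last first.
  by rewrite mxE lastE ?mul0r//=.
rewrite add0r mxE /row_op leqnn diffprod_nil.
have -> : flat (rp 0 C * rp C.+1 n) 1 (a C) = expR (b C * a C) - expR (- (b C * a C)).
  by rewrite /flat_fun rmorph1 !mul1r !(residue_exp n0 resB _ Cn (f := rp 0 C * rp C.+1 n))//
    mulrN.
rewrite /cofactor addnn -muln2 mulnC exprM sqrrN expr1n expr1n mul1r.
pose U : 'M[R]_C := \matrix_(i, j) ((i == j)%:R * (b j + b C) + (i == j.+1 :> nat)%:R).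
have -> : row' ord_max (col' ord_max (bd_mx C C a)) = - 1 *: (bd_mx c 0 a *m U).
  apply/matrixP => r s; rewrite [LHS]mxE [in LHS]mxE [in LHS]mxE [RHS]mxE [in RHS]mxE.
  rewrite !lift_max evenE// mulN1r; congr (- _).
  have -> : ('X + (b C)%:P) * rp 0 s * rp C n =
      rp 0 s.+1 * rp C n + (b s + b C) *: (rp 0 s * rp C n).
    by rewrite -mul_polyC polyCD rootprodSr//; ring.
  rewrite (flat_funDl resB) (flat_funZl resB).
  rewrite (bigD1 s)//= mxE [U _ _]mxE eqxx mul1r (_ : (s == s.+1 :> nat) = false) ?addr0;
    last first.
    by apply/negbTE; rewrite neq_ltn leqnn.
  rewrite [LHS]addrC; congr (_ + _); first by rewrite mulrC.
  have [sc|sc] := ltnP s.+1 C.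
    rewrite (bigD1 (Ordinal sc)) /=; last by rewrite -val_eqE /= neq_ltn leqnn orbT.
    rewrite !mxE /= eqxx -val_eqE /= gtn_eqF// mul0r add0r mulr1.
    rewrite big1 ?addr0// => i /andP[is1 is2]; rewrite !mxE.
    rewrite -val_eqE /= in is1; rewrite -val_eqE /= in is2.
    by rewrite -val_eqE /= (negbTE is1) (negbTE is2) mul0r addr0 mulr0.
  have -> : s.+1 = C by apply/eqP; rewrite eqn_leq sc ltn_ord.
  rewrite -(rootprod_cat b) ?(ltnW cn)// -[rp 0 n]mulr1 (flat_fun_ann resB).
  rewrite big1// => i is1; rewrite !mxE (negbTE is1) mul0r add0r.
  rewrite (_ : (i == s.+1 :> nat) = false) ?mulr0//; apply/negbTE.
  by rewrite neq_ltn (leq_trans (ltn_ord i) sc).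
have detU : \det U = \prod_(s < C) (b s + b C).
  rewrite det_trig; last first.
    apply/is_trig_mxP => i j ij; rewrite mxE.
    by rewrite -val_eqE /= ltn_eqF// mul0r add0r ltn_eqF// ltnS ltnW.
  apply: eq_bigr => s _; rewrite mxE eqxx mul1r (_ : (s == s.+1 :> nat) = false) ?addr0//.
  by apply/negbTE; rewrite neq_ltn leqnn.
have prod0 : \prod_(s < C) (b s + b C) != 0.
  apply/prodf_neq0 => s _; rewrite gt_eqF// addr_gt0// b_gt0//.
  by rewrite (ltn_trans (ltn_ord s)).
have binE : 'C(C.+1, 2) = ('C(C, 2) + C)%N by rewrite binS bin1.
have sgnE : (-1) ^+ C * (-1) ^+ C = 1 :> R by rewrite -expr2 sqrr_sign.
have expE : expR (b C * a C) * expR (- (b C * a C)) = 1.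
  by rewrite -expRD subrr expR0.
have expE2 : expR (- (2 * b C) * a C) = expR (- (b C * a C)) * expR (- (b C * a C)).
  by rewrite -expRD; congr expR; ring.
have sumE : expR (- \sum_(r < C.+1) b r * a r) =
    expR (- \sum_(r < C) b r * a r) * expR (- (b C * a C)).
  by rewrite big_ord_recr opprD expRD.
rewrite detZ det_mulmx detU binE exprD big_ord0 invr1 mulr1 sumE expE2.
rewrite -/C; move: expE sgnE; set x := expR (b C * a C); set y := expR (- _).
set z := expR _; set sg := (-1) ^+ C; set P := \prod_(s < C) _; set s2 := (-1) ^+ 'C(C, 2).
set D := \det _ => xy sgsg.
have -> : s2 * sg / P * (z * y) * ((x - y) * (sg * (D * P))) =
    (P / P) * (sg * sg) * s2 * z * (x * y - y * y) * D by ring.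
by rewrite divff// xy sgsg; ring.
Qed.

(** The boundary condition [a] with its entries [k, ..., j] replaced by the
    common value [t]; it occurs while the weight of the cell [(k, c)] is integrated. *)
Definition bd_shift (k j : nat) (a : nat -> R) (t : R) (r : nat) : R :=
  if (k <= r <= j)%N then t else a r.

(** The argument is [t] on the rows [k, ..., j]. Differentiating row [r] with
    [k < r] gives [b_r] times itself minus row [r - 1]: the latter does not
    contribute, the former cancels against the exponential prefactor. On row [k]
    what remains is [X - b_k + (b_k + b_c) = b_c + X], the operator of that row
    for [k.+1]. *)
Lemma is_derive_bd_cdf c k j a (t : R) : (c < n)%N -> (k < c)%N -> (k <= j <= c)%N ->
  is_derive t 1 (fun t => expR ((b k + b c) * t) * bd_cdf c k (bd_shift k j a t))
    ((b k + b c) * expR ((b k + b c) * t) * bd_cdf c k.+1 (bd_shift k j a t)).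
Proof.
move=> cn kc /andP[kj jc]; set lam := b k + b c.
have kc' : (k < c.+1)%N by rewrite ltnS ltnW.
pose k' := Ordinal kc'.
pose I r := (k <= r <= j)%N.
pose M t := bd_mx c k (bd_shift k j a t).
pose f s := rp 0 s * rp c.+1 n.
pose D : 'M[R]_c.+1 := \matrix_(r, s)
  (if I r then flat (f s) ('X * row_op c k r) t else 0).
have dM (r s : 'I_c.+1) : is_derive t 1 (fun y => M y r s) (D r s).
  have -> : (fun y => M y r s) = fun y => flat (f s) (row_op c k r) (bd_shift k j a y r).
    by apply/funext => y; rewrite mxE.
  rewrite mxE /bd_shift /I; case: ifP => _; last exact: is_derive_cstE.
  exact: (is_derive_flat_fun resB).
pose S y := \sum_(r < c.+1) b r * bd_shift k j a y r.
have dS : is_derive t 1 S (\sum_(r < c.+1) (if I r then b r else 0)).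
  apply: is_derive_sumE => r; rewrite /bd_shift /I; case: ifP => _.
    refine (is_derive_eq (is_derive_mulcE (b r) (is_derive_id t 1)) _); exact: mulr1.
  exact: is_derive_cstE.
have detD (r : 'I_c.+1) : \det (set_row r D (M t)) =
    (if I r then b r else 0) * \det (M t) +
    (r == k')%:R * (\det (set_row k' D (M t)) - b k * \det (M t)).
  have [->|rk] := eqVneq r k'; first by rewrite /I /= leqnn kj mul1r addrC subrK.
  rewrite mul0r addr0; case: ifP => Ir; last first.
    rewrite mul0r (expand_det_row _ r) big1// => s _.
    by rewrite mxE eqxx mxE Ir mul0r.
  have kr : (k < r)%N.
    by move: Ir; rewrite /I leq_eqVlt => /andP[/predU1P[e|//] _];
      rewrite -val_eqE /= e eqxx in rk.
  have rc : (r.-1 < c.+1)%N by rewrite (leq_ltn_trans (leq_pred _)).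
  pose r' := Ordinal rc.
  have r'r : (r'.+1 = r)%N by rewrite /= prednK// (leq_ltn_trans _ kr).
  have Ir' : I r'.
    by rewrite /I -ltnS r'r kr/= (leq_trans (leq_pred _))//; move: Ir => /andP[].
  pose E : 'M[R]_c.+1 := \matrix_(i, s) M t r' s.
  rewrite (@det_set_row_lin _ _ _ (b r) (-1) (M t) E); last first.
    apply/rowP => s; rewrite !mxE Ir /bd_shift -/(I r) -/(I r') Ir Ir'.
    rewrite mulN1r -(flat_funZr resB) -mulN1r -(flat_funZr resB) -(flat_funDr resB).
    congr (flat _ _ _); rewrite /row_op (ltnW kr) (_ : (k <= r')%N); last first.
      by rewrite -ltnS r'r.
    rewrite r'r (diffprodS b (i := r)) ?ltn_ord// -!mul_polyC polyCN; ring.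
  rewrite set_row_id (_ : \det (set_row r E (M t)) = 0) ?mulr0 ?addr0//.
  apply: (@determinant_alternate _ _ _ r r');
    first by rewrite -val_eqE /= -r'r neq_ltn ltnS leqnn orbT.
  move=> s; rewrite !mxE eqxx ifN ?mxE//.
  by rewrite -val_eqE /= -{2}r'r neq_ltn ltnS leqnn.
pose C := (-1) ^+ 'C(c.+1, 2) / (\prod_(s < k) (b s + b c)).
have -> : (fun t => expR (lam * t) * bd_cdf c k (bd_shift k j a t)) =
    fun y => C * (expR (lam * y + 0 - S y) * \det (M y)).
  apply/funext => y; rewrite /bd_cdf -/C -/(M y) -/(S y) addr0 expRD; ring.
have dE := is_derive_expE (is_derive_subE (is_derive_affine t lam 0) dS).
refine (is_derive_eq (is_derive_mulcE C (is_derive_mulE dE (is_derive_det dM))) _).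
have sumD : \sum_r \det (set_row r D (M t)) =
    (\sum_(r < c.+1) (if I r then b r else 0)) * \det (M t) +
    (\det (set_row k' D (M t)) - b k * \det (M t)).
  rewrite (eq_bigr _ (fun r _ => detD r)) big_split /= -mulr_suml; congr (_ + _).
  rewrite (bigD1 k')//= eqxx mul1r big1 ?addr0// => r rk.
  by rewrite (negbTE rk) mul0r.
have detE : \det (bd_mx c k.+1 (bd_shift k j a t)) =
    \det (set_row k' D (M t)) + b c * \det (M t).
  have -> : bd_mx c k.+1 (bd_shift k j a t) =
      set_row k' (bd_mx c k.+1 (bd_shift k j a t)) (M t).
    apply/matrixP => r s; rewrite !mxE; case: eqVneq => // rk.
    by rewrite /row_op ltn_neqAle eq_sym -[(r : nat) == k]/(r == k') rk.
  rewrite (@det_set_row_lin _ _ _ 1 (b c) D (M t)) ?mul1r ?set_row_id//.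
  apply/rowP => s; rewrite !mxE /I /= leqnn kj /= mul1r -/(f s) /bd_shift leqnn kj /=.
  rewrite -(flat_funZr resB) -(flat_funDr resB) /row_op leqnn ltnn -mul_polyC.
  congr (flat _ _ _); ring.
have lam0 : lam != 0.
  by rewrite gt_eqF// addr_gt0// b_gt0// (ltn_trans kc).
have prod0 : \prod_(s < k) (b s + b c) != 0.
  apply/prodf_neq0 => s _; rewrite gt_eqF// addr_gt0// b_gt0//.
  by rewrite (ltn_trans (ltn_ord s))// (ltn_trans kc).
have prodE : \prod_(s < k.+1) (b s + b c) = (\prod_(s < k) (b s + b c)) * lam.
  by rewrite big_ord_recr.
rewrite /bd_cdf detE sumD -/(S t) prodE addr0 expRD /C.
move: lam0; rewrite /lam => lam0.
by field; rewrite lam0 prod0.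
Qed.

End BoundaryFunction.

(** * Adding an independent exponential variable *)

Section ExponentialConvolution.
Context (R : realType) (d : measure_display) (T : measurableType d).
Variable P : probability T R.
Local Notation mu := (@lebesgue_measure R).
Local Open Scope ereal_scope.

(** The law of [W] has the exponential density by Radon-Nikodym. *)
Lemma integral_exponential_law (W : {RV P >-> R}) (lam : R) (f : R -> \bar R) :
  (0 < lam)%R -> has_exponential_law W lam ->
  measurable_fun setT f -> (forall x, 0 <= f x <= 1) ->
  \int[distribution P W]_x f x = \int[mu]_x (f x * (exponential_pdf lam x)%:E).
Proof.
move=> lam0 lawW mf f01.
have f0 x : 0 <= f x by case/andP: (f01 x).
have mW : measurable_fun setT (W : T -> measurableTypeR R) by exact:
  (@measurable_funPT _ _ _ _ W).
pose V : {RV P >-> measurableTypeR R} := HB.pack (W : T -> measurableTypeR R)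
  (isMeasurableFun.Build _ _ _ _ _ mW).
have mf' : measurable_fun setT (f : measurableTypeR R -> \bar R) by exact: mf.
have -> : \int[distribution P W]_x f x = \int[distribution P V]_x f x.
  by rewrite !ge0_integral_distribution.
have lawV (A : set (measurableTypeR R)) : measurable A ->
  distribution P V A = exponential_prob lam A by exact: lawW.
have intf : (distribution P V).-integrable setT f.
  apply/integrableP; split => //.
  apply: (@le_lt_trans _ _ (\int[distribution P V]_x (cst 1 x))).
    apply: ge0_le_integral => //; first exact: measurableT_comp.
    by move=> x _; rewrite gee0_abs//; case/andP: (f01 x).
  rewrite integral_cst// mul1e (_ : _ setT = 1) ?ltry//;
    exact: (@probability_setT _ _ _ (distribution P V)).
have dom : distribution P V `<< mu.
  apply/null_content_dominatesP => A mA muA0.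
  rewrite lawV//; apply: null_set_integral => //.
  by apply: measurable_funTS; apply/measurable_EFinP; exact: measurable_exponential_pdf.
rewrite -(Radon_Nikodym_change_of_variables dom)//=.
apply: ae_eq_integral => //.
- by apply: emeasurable_funM.
- apply: emeasurable_funM => //=.
  by apply/measurable_EFinP; exact: measurable_exponential_pdf.
- apply: ae_eqe_mul2l => /=.
  rewrite Radon_NikodymE//=.
  case: cid => /= h [h1 h2 h3].
  apply: integral_ae_eq => //=.
  + by apply/measurable_EFinP; exact: measurable_exponential_pdf.
  + by move=> E _ mE; rewrite -h3// lawV.
Qed.

(** The pair [(W, Y)] has the product law, and its sections over [w] are the
    events [Y <= s - w]. *)
Lemma exponential_convolution (Y W : {RV P >-> R}) (lam s : R) :
  (0 < lam)%R -> has_exponential_law W lam ->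
  (forall A B, measurable A -> measurable B ->
    P (Y @^-1` A `&` W @^-1` B) = P (Y @^-1` A) * P (W @^-1` B)) ->
  P [set t | Y t + Num.max (W t) 0 <= s]%R =
  \int[mu]_(w in `[0%R, +oo[) (P [set t | Y t <= s - w]%R * (lam * expR (- lam * w))%:E).
Proof.
move=> lam0 lawW ind.
have mZ : measurable_fun setT (fun t => (W t, Y t)) by exact: measurable_fun_pair.
pose Z : {RV P >-> (R * R)%type} := HB.pack (fun t => (W t, Y t))
  (isMeasurableFun.Build _ _ _ _ _ mZ).
pose h (z : R * R) := (z.2 + Num.max z.1 0)%R.
have mh : measurable_fun setT h.
  by apply: measurable_funD => //; apply: measurable_maxr.
pose E := h @^-1` `]-oo, s].
have mE : measurable E by rewrite -[E]setTI; exact: mh.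
transitivity ((distribution P W \x distribution P Y) E).
  rewrite (product_measure_unique (m' := distribution P Z))//.
  move=> A B mA mB; rewrite /distribution /= /pushforward muleC -ind//.
  by congr (P _); apply/seteqP; split => t /= [].
rewrite /product_measure1.
have secE w : distribution P Y (xsection E w) = P [set t | Y t <= s - Num.max w 0]%R.
  congr (P _); apply/seteqP; split => t /=.
    by rewrite /xsection/= inE /E /h /= in_itv /= lerBrDr.
  by rewrite /xsection/= inE /E /h /= in_itv /= lerBrDr.
have F01 w : 0 <= (distribution P Y \o xsection E) w <= 1.
  by rewrite measure_ge0 probability_le1//; exact: measurable_xsection.
have mF : measurable_fun setT (distribution P Y \o xsection E).
  exact: measurable_fun_xsection.
rewrite (integral_exponential_law lam0 lawW mF F01) /=.
rewrite [RHS]integral_mkcond; apply: eq_integral => w _.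
rewrite patchE; case: ifPn => w0.
  have {}w0 : (0 <= w)%R by move: w0; rewrite inE/= in_itv/= andbT.
  have wE : Num.max w 0%R = w by apply/max_idPl.
  by rewrite secE exponential_pdfE// wE.
rewrite lt0_exponential_pdf ?mule0// ltNge; apply: contra w0 => w0.
by rewrite inE/= in_itv/= w0.
Qed.

Lemma exponential_convolution_ge0 (Y W : {RV P >-> R}) (lam s : R) :
  (0 < lam)%R -> has_exponential_law W lam ->
  (forall A B, measurable A -> measurable B ->
    P (Y @^-1` A `&` W @^-1` B) = P (Y @^-1` A) * P (W @^-1` B)) ->
  (forall t, 0 <= Y t)%R -> (0 <= s)%R ->
  fine (P [set t | Y t + Num.max (W t) 0 <= s]%R) =
  (\int[mu]_(w in `[0, s]) (fine (P [set t | Y t <= s - w]) * (lam * expR (- lam * w))))%R.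
Proof.
move=> lam0 lawW ind Y0 s0; rewrite (exponential_convolution s lam0 lawW ind).
rewrite /Rintegral; congr fine.
rewrite [LHS]integral_mkcond [RHS]integral_mkcond; apply: eq_integral => w _.
rewrite !patchE !mem_setE !in_itv /= andbT.
case: (leP 0%R w) => //= w0; case: (leP w s) => ws.
  rewrite [RHS]EFinM fineK// fin_num_measure//.
  by rewrite -[X in measurable X]setTI;
    apply: (measurable_funPT Y measurableT _ (measurable_itv `]-oo, (s - w)%R])).
rewrite (_ : [set t | _] = set0) ?measure0 ?mul0e//.
by apply/seteqP; split => t //=; rewrite leNgt (lt_le_trans _ (Y0 t))// subr_lt0.
Qed.

Lemma integrable_exponential_convolution (Y : {RV P >-> R}) (lam s : R) : (0 < lam)%R ->
  mu.-integrable `[0%R, s]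
    (fun w => (fine (P [set t | Y t <= s - w]%R) * (lam * expR (- lam * w)))%:E).
Proof.
move=> lam0.
have mP r : measurable [set t | Y t <= r]%R.
  by rewrite -[X in measurable X]setTI;
    apply: (measurable_funPT Y measurableT _ (measurable_itv `]-oo, r])).
apply: (@measurable_bounded_integrable _ _ _ mu
  (fun w => fine (P [set t | Y t <= s - w]%R) * (lam * expR (- lam * w)))%R) => //.
- exact: (compact_finite_measure (@segment_compact R 0 s)).
- apply: measurable_funM.
    apply: nonincreasing_measurable => //= r r' rr'.
    rewrite fine_le ?fin_num_measure// le_measure ?inE// => t /= /le_trans; apply.
    by rewrite lerD2l lerN2.
  apply: measurable_funM => //.
  apply: measurable_funTS; apply: continuous_measurable_fun.
  rewrite (_ : (fun x => _) = fun x => expR (- lam * (x - 0))%R).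
    exact: continuous_expRN.
  by apply/funext => x; rewrite subr0.
- exists lam; split; first by rewrite num_real.
  move=> M lamM w /=; rewrite in_itv/= => /andP[w0 _]; rewrite (le_trans _ (ltW lamM))//.
  rewrite ger0_norm ?mulr_ge0 ?fine_ge0 ?expR_ge0 ?(ltW lam0)//.
  rewrite -[leRHS]mul1r ler_pM ?mulr_ge0 ?fine_ge0 ?expR_ge0 ?(ltW lam0)//.
    by rewrite -lee_fin fineK ?fin_num_measure// probability_le1.
  rewrite -[leRHS]mulr1 ler_wpM2l ?(ltW lam0)// -expR0 ler_expR mulNr oppr_le0.
  by rewrite mulr_ge0// ltW.
Qed.

End ExponentialConvolution.

(** * Integrating the determinant against one exponential weight *)

Section PiecewisePrimitive.
Context (R : realType).
Local Notation mu := (@lebesgue_measure R).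

Lemma Rintegral_primitive (F g : R -> R) (lo hi : R) : lo <= hi ->
  (forall x : R, is_derive x 1 F (g x)) -> continuous g ->
  \int[mu]_(x in `[lo, hi]) g x = F hi - F lo.
Proof.
move=> + dF cg; rewrite le_eqVlt => /predU1P[->|lohi].
  by rewrite set_itv1 Rintegral_set1 subrr.
have cF x : {for x, continuous F} := is_derive_continuous (dF x).
rewrite /Rintegral (@continuous_FTC2 _ g F)//.
- exact: continuous_subspaceT.
- split; [by move=> x _; exact: ex_derive| |].
    by apply: cvg_at_right_filter; exact: cF.
  by apply: cvg_at_left_filter; exact: cF.
- by move=> x _; rewrite derive1E derive_val.
Qed.

(** One step of an integration over a concatenation of intervals, for an
    integrand with a different primitive on each of them. *)
Lemma Rintegral_extend (f F g : R -> R) (v lo hi top : R) :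
  v <= lo -> lo <= hi -> hi <= top -> mu.-integrable `[v, top] (EFin \o f) ->
  (forall x : R, is_derive x 1 F (g x)) -> continuous g ->
  (forall x, lo <= x <= hi -> f x = g x) ->
  \int[mu]_(x in `[v, hi]) f x = \int[mu]_(x in `[v, lo]) f x + (F hi - F lo).
Proof.
move=> vlo lohi hitop intf dF cg fg.
have intf' : mu.-integrable `[v, hi] (EFin \o f).
  apply: integrableS intf => // x /=; rewrite !in_itv/= => /andP[-> /le_trans]; exact.
rewrite -(Rintegral_primitive lohi dF cg).
have := @Rintegral_itvB R f (BLeft v) (BRight hi) lo intf'.
rewrite !bnd_simp => /(_ vlo lohi) => /eqP; rewrite subr_eq addrC => /eqP ->.
congr (_ + _); rewrite Rintegral_itv_obnd_cbnd; last first.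
  apply: integrableS intf' => // x /=; rewrite !in_itv/= => /andP[+ ->].
  by move=> /ltW; rewrite andbT; exact: le_trans.
by apply: eq_Rintegral => x; rewrite inE/= in_itv/=; exact: fg.
Qed.

End PiecewisePrimitive.

Section BoundaryStep.
Context (R : realType).
Variables (n : nat) (b : nat -> R) (B : {poly R} -> R -> R).
Hypotheses (n0 : (0 < n)%N) (resB : residue_functional n b B).
Hypothesis b_gt0 : forall l, (l < n)%N -> 0 < b l.
Local Notation mu := (@lebesgue_measure R).
Local Notation cdf := (bd_cdf n b B).

Lemma eq_bd_cdf c k (a a' : nat -> R) : (forall r, (r <= c)%N -> a r = a' r) ->
  cdf c k a = cdf c k a'.
Proof.
move=> aa'; rewrite /bd_cdf (_ : bd_mx n b B c k a = bd_mx n b B c k a').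
  by rewrite (eq_bigr (fun r : 'I_c.+1 => b r * a' r))// => r _; rewrite aa'// -ltnS.
by apply/matrixP => r s; rewrite !mxE aa'// -ltnS.
Qed.

Lemma continuous_bd_cdf c k i j a : continuous (fun t => cdf c k (bd_shift i j a t)).
Proof.
move=> t; pose M y := bd_mx n b B c k (bd_shift i j a y).
have dM (r s : 'I_c.+1) : is_derive t 1 (fun y => M y r s) (if (i <= r <= j)%N then
    flat_fun B (rootprod b 0 s * rootprod b c.+1 n) ('X * row_op b c k r) t else 0).
  have -> : (fun y => M y r s) = fun y => flat_fun B (rootprod b 0 s * rootprod b c.+1 n)
      (row_op b c k r) (bd_shift i j a y r).
    by apply/funext => y; rewrite mxE.
  rewrite /bd_shift; case: ifP => _; last exact: is_derive_cstE.
  exact: (is_derive_flat_fun resB).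
pose D : 'M[R]_c.+1 := \matrix_(r, s) (if (i <= r <= j)%N then
    flat_fun B (rootprod b 0 s * rootprod b c.+1 n) ('X * row_op b c k r) t else 0).
pose S y := \sum_(r < c.+1) b r * bd_shift i j a y r.
have dS : is_derive t 1 S (\sum_(r < c.+1) (if (i <= r <= j)%N then b r * 1 else 0)).
  apply: is_derive_sumE => r; rewrite /bd_shift; case: ifP => _.
    exact: (is_derive_mulcE (b r) (is_derive_id t 1)).
  exact: is_derive_cstE.
have dE := is_derive_expE (is_derive_mulcE (-1) dS).
have dM' (r s : 'I_c.+1) : is_derive t 1 (fun y => M y r s) (D r s).
  by rewrite mxE; exact: dM.
pose C := (-1) ^+ 'C(c.+1, 2) / (\prod_(s < k) (b s + b c)) : R.
have -> : (fun y => cdf c k (bd_shift i j a y)) =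
    fun y => C * (expR (-1 * S y) * \det (M y)).
  by apply/funext => y; rewrite /bd_cdf mulN1r mulrA.
exact: is_derive_continuous (is_derive_mulcE C (is_derive_mulE dE (is_derive_det dM'))).
Qed.

(** If the weight at [(k, c)] is [w] and [t = a_k - w], then [L(k, c) <= a_k] says
    that both [L(k + 1, c)] and [L(k, c - 1)] are at most [t]. As the [L(r, c)]
    decrease in [r], the bound [t] extends to all the rows [r > k]. *)
Definition bd_cut (k : nat) (a : nat -> R) (t : R) (r : nat) : R :=
  if (r < k)%N then a r else if (r == k)%N then t else Num.min (a r) t.

(** The minima in [bd_cut] make the integrand piecewise smooth: on the piece
    where [a_k - w] lies between [a_(j+1)] and [a_j], the rows [k, ..., j] share
    the same argument. The primitives of consecutive pieces agree at the
    breakpoints, and the last one vanishes at the end since the smallest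
    argument is then [0]. *)
Lemma bd_cdf_site c k (a : nat -> R) (f : R -> R) : (c < n)%N -> (k < c)%N ->
  (forall r, (r < c)%N -> a r.+1 <= a r) -> 0 <= a c ->
  let lam := b k + b c in
  mu.-integrable `[0, a k] (EFin \o f) ->
  (forall w, 0 <= w <= a k ->
    f w = cdf c k.+1 (bd_cut k a (a k - w)) * (lam * expR (- lam * w))) ->
  \int[mu]_(w in `[0, a k]) f w = cdf c k a.
Proof.
move=> cn kc a_noninc ac0 lam intf fE.
have amono i j : (i <= j)%N -> (j <= c)%N -> a j <= a i.
  elim: j => [|j ih]; first by rewrite leqn0 => /eqP ->.
  rewrite leq_eqVlt => /predU1P[->//|ij] jc.
  exact: le_trans (a_noninc _ jc) (ih ij (ltnW jc)).
pose v j := if (j <= c)%N then a k - a j else a k.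
pose Psi j w := - (expR (- lam * w) * cdf c k (bd_shift k j a (a k - w))).
pose psi j w := cdf c k.+1 (bd_shift k j a (a k - w)) * (lam * expR (- lam * w)).
have dPsi j (w : R) : (k <= j <= c)%N -> is_derive w 1 (Psi j) (psi j w).
  move=> kjc.
  have h := is_derive_affine_comp (x := w) (k := -1) (c := a k)
    (is_derive_bd_cdf resB b_gt0 a (-1 * w + a k) cn kc kjc).
  have -> : Psi j = fun y => - expR (- lam * a k) * (expR (lam * (-1 * y + a k)) *
      cdf c k (bd_shift k j a (-1 * y + a k))).
    apply/funext => y; rewrite /Psi.
    have -> : expR (- lam * y) = expR (- lam * a k) * expR (lam * (-1 * y + a k)).
      by rewrite -expRD; congr expR; ring.
    rewrite (_ : -1 * y + a k = a k - y); ring.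
  refine (is_derive_eq (is_derive_mulcE (- expR (- lam * a k)) h) _).
  rewrite /psi mulN1r [- w + _]addrC.
  have -> : expR (- lam * w) = expR (- lam * a k) * expR (lam * (a k - w)).
    by rewrite -expRD; congr expR; ring.
  rewrite -/lam; ring.
have cpsi j : continuous (psi j).
  move=> w.
  have h1 : {for w, continuous (fun y => cdf c k.+1 (bd_shift k j a (a k - y)))}.
    apply: (@continuous_comp _ _ _ (fun y => a k - y)
      (fun t => cdf c k.+1 (bd_shift k j a t))); last exact: continuous_bd_cdf.
    exact: is_derive_continuous (is_derive_subE (is_derive_cstE w (a k)) (is_derive_id w 1)).
  have h2 := is_derive_continuous (is_derive_mulcE lam
    (is_derive_expE (is_derive_mulcE (- lam) (is_derive_id w 1)))).
  exact: (continuousM h1 h2).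
have vk : v k = 0 by rewrite /v (ltnW kc) subrr.
have vmono j : (k <= j <= c)%N -> v j <= v j.+1.
  move=> /andP[kj jc]; rewrite /v jc; case: ltnP => jc'.
    by rewrite lerD2l lerN2 a_noninc.
  by rewrite gerBl (le_trans ac0)// amono.
have piece j w : (k <= j <= c)%N -> v j <= w <= v j.+1 -> f w = psi j w.
  move=> /andP[kj jc] /andP[w1 w2].
  have w0 : 0 <= w.
    by rewrite (le_trans _ w1)// /v jc subr_ge0 amono.
  have wa : w <= a k.
    rewrite (le_trans w2)// /v; case: ltnP => // jc'.
    by rewrite gerBl (le_trans ac0)// amono.
  rewrite fE ?w0//; congr (_ * _); apply: eq_bd_cdf => r rc.
  rewrite /bd_cut /bd_shift; case: (ltngtP r k) => //= [kr|->]; last by rewrite kj.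
  have [rj|jr] := leqP r j.
    apply/min_idPr; rewrite lerBlDl -lerBlDr (le_trans _ w1)// /v jc.
    by rewrite lerD2l lerN2 amono.
  apply/min_idPl; rewrite lerBrDr -lerBrDl (le_trans w2)// /v (leq_trans jr rc).
  by rewrite lerD2l lerN2 amono.
have vtop j : (k <= j <= c)%N -> v j.+1 <= a k.
  move=> /andP[kj jc]; rewrite /v; case: ltnP => // jc'.
  by rewrite gerBl (le_trans ac0)// amono.
have vge0 j : (k <= j <= c)%N -> 0 <= v j.
  by move=> /andP[kj jc]; rewrite /v jc subr_ge0 amono.
have ext j (kjc : (k <= j <= c)%N) :=
  Rintegral_extend (vge0 j kjc) (vmono j kjc) (vtop j kjc) intf
    (fun x => dPsi j x kjc) (@cpsi j) (fun x => piece j x kjc).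
have glue j : (j < c)%N -> Psi j (v j.+1) = Psi j.+1 (v j.+1).
  move=> jc; rewrite /Psi; congr (- (_ * _)); apply: eq_bd_cdf => r rc.
  rewrite /bd_shift /v jc opprB addrC subrK.
  case: (ltngtP r j.+1) => [|jr|->].
  - by rewrite ltnS => ->; rewrite andbT.
  - by rewrite (leqNgt r j) (ltnW jr).
  - by rewrite ltnn andbF; case: ifP.
have start : \int[mu]_(w in `[0, v k]) f w = 0.
  by rewrite vk set_itv1 Rintegral_set1.
have main i : (k + i <= c)%N ->
    \int[mu]_(w in `[0, v (k + i).+1]) f w = Psi (k + i)%N (v (k + i).+1) - Psi k 0.
  elim: i => [|i ih] ic; rewrite ext ?leq_addr//.
    by rewrite addn0 start add0r vk.
  by rewrite addnS in ic *; rewrite (ih (ltnW ic)) (glue _ ic) addrC addrA subrK.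
have kcc : (k <= c <= c)%N by rewrite (ltnW kc) leqnn.
have := main (c - k)%N; rewrite subnKC ?(ltnW kc)// {1 2}/v ltnn => ->//.
rewrite /Psi subrr subr0 mulr0 expR0 mul1r opprK.
rewrite bd_cdf0 ?(ltnW kc)//; last by rewrite /bd_shift kcc.
rewrite mulr0 oppr0 add0r; apply: eq_bd_cdf => r rc; rewrite /bd_shift.
by case: ifP => // /andP[kr rk]; congr a; apply/eqP; rewrite eqn_leq kr rk.
Qed.

End BoundaryStep.

(** * Independence of one variable from finitely many others *)

Section Independence.
Context (R : realType) (d : measure_display) (T : measurableType d).
Variable P : probability T R.
Local Open Scope ereal_scope.

(** A pi-system generating the sigma-algebra of the variables indexed by [J]. *)
Definition cylinders (I : choiceType) (X : I -> {RV P >-> R}) (J : {fset I}) : set (set T) :=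
  [set A | exists2 B : I -> set R, (forall i, measurable (B i)) &
    A = \bigcap_(i in [set` J]) (X i @^-1` B i)].

Lemma measurable_RV (X : {RV P >-> R}) (B : set R) : measurable B -> measurable (X @^-1` B).
Proof.
by move=> mB; rewrite -[X in measurable X]setTI; exact: (measurable_funPT X measurableT _ mB).
Qed.

Lemma cylinders_measurable (I : choiceType) (X : I -> {RV P >-> R}) (J : {fset I}) :
  cylinders X J `<=` measurable.
Proof.
move=> _ [B mB ->]; apply: fin_bigcap_measurable; first exact: finite_fset.
by move=> i _; exact: measurable_RV.
Qed.

Lemma setI_closed_cylinders (I : choiceType) (X : I -> {RV P >-> R}) (J : {fset I}) :
  setI_closed (cylinders X J).
Proof.
move=> _ _ [B mB ->] [C mC ->]; exists (fun i => B i `&` C i).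
  by move=> i; exact: measurableI.
by rewrite -bigcapI; apply: eq_bigcapr => i _; rewrite preimage_setI.
Qed.

Lemma cylindersT (I : choiceType) (X : I -> {RV P >-> R}) (J : {fset I}) :
  cylinders X J setT.
Proof.
by exists (fun=> setT) => //; rewrite bigcapT.
Qed.

Lemma sub_sigma_cylinders (I : choiceType) (X : I -> {RV P >-> R}) (J : {fset I}) A :
  <<s cylinders X J >> A -> measurable A.
Proof. exact: (smallest_sub (@sigma_algebra_measurable _ T) (@cylinders_measurable I X J)). Qed.

(** The two measures [A |-> P (A and X i0 in B)] and [A |-> P (X i0 in B) P A]
    agree on the cylinders by independence, hence on what these generate. *)
Lemma independent_cylinders (I : choiceType) (D : set I) (X : I -> {RV P >-> R})
    (J : {fset I}) (i0 : I) (A : set T) (B : set R) :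
  mutually_independent D X -> [set` J] `<=` D -> D i0 -> i0 \notin J ->
  <<s cylinders X J >> A -> measurable B ->
  P (A `&` X i0 @^-1` B) = P A * P (X i0 @^-1` B).
Proof.
move=> ind JD Di0 i0J sA mB.
have mXB := measurable_RV (X i0) mB.
have finP (E : set T) : measurable E -> P E = (fine (P E))%:E.
  by move=> mE; rewrite fineK// fin_num_measure.
pose r : {nonneg R} := NngNum (fine_ge0 (measure_ge0 P (X i0 @^-1` B))).
suff -> : P (A `&` X i0 @^-1` B) = mscale r P A by rewrite [RHS]muleC [in RHS](finP _ mXB).
apply: (@g_sigma_algebra_measure_unique _ R T (cylinders X J)
  (@cylinders_measurable I X J) (fun=> setT) (fun=> cylindersT X J) _
  (mrestr P mXB) (mscale r P) (@setI_closed_cylinders I X J)) => //.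
- by rewrite bigcup_const//; exists 0%N.
- move=> _ [C mC ->].
  pose C' i := if i == i0 then B else C i.
  have mC' i : measurable (C' i) by rewrite /C'; case: ifP.
  have CJ : \bigcap_(i in [set` J]) (X i @^-1` C i) = \bigcap_(i in [set` J]) (X i @^-1` C' i).
    apply: eq_bigcapr => i /= iJ; rewrite /C' ifN//.
    by apply: contraNneq i0J => <-.
  have JE : [set` (i0 |` J)%fset] = i0 |` [set` J].
    by apply/seteqP; split => i /=; rewrite !inE => /predU1P.
  have mA : measurable (\bigcap_(i in [set` J]) (X i @^-1` C i)).
    by apply: cylinders_measurable; exists C.
  have JD' : [set` (i0 |` J)%fset] `<=` D.
    by rewrite JE => i /= [->//|]; exact: JD.
  have := ind _ _ JD' mC'; rewrite JE bigcap_setU1 big_fsetU1//= -(ind _ _ JD mC') -CJ.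
  rewrite [C' i0]/C' eqxx => e.
  change (P ((\bigcap_(i in [set` J]) (X i @^-1` C i)) `&` X i0 @^-1` B) =
    (fine (P (X i0 @^-1` B)))%:E * P (\bigcap_(i in [set` J]) (X i @^-1` C i))).
  by rewrite setIC (finP _ (measurableI _ _ mXB mA)) e EFinM -finP// -finP.
- move=> _; change (P (setT `&` X i0 @^-1` B) < +oo).
  by rewrite setTI (le_lt_trans (probability_le1 _ mXB)) ?ltry.
Qed.

End Independence.

(** * The last passage recursion *)

Section LastPassageRecursion.
Context (R : realType).
Implicit Types (w : nat -> nat -> R).

(** [lpp w i c] is the last passage time from the cell [(i, c)] to the diagonal.
    The recursion is on [m = c - i]: both cells that can follow [(i, c)] on a
    path are one step closer to the diagonal. *)
Fixpoint lpp_diag w (m i : nat) : R :=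
  if m is m'.+1 then w i (i + m'.+1)%N + Num.max (lpp_diag w m' i.+1) (lpp_diag w m' i)
  else w i i.

Definition lpp w (i c : nat) : R := lpp_diag w (c - i) i.

Lemma lpp_corner w c : lpp w c c = w c c.
Proof. by rewrite /lpp subnn. Qed.

Lemma lppS w i c : (i <= c)%N ->
  lpp w i c.+1 = w i c.+1 + Num.max (lpp w i.+1 c.+1) (lpp w i c).
Proof.
by move=> ic; rewrite /lpp subSS subSn//= addnS subnKC.
Qed.

Lemma lpp_ge0 w : (forall i c, 0 <= w i c) -> forall i c, 0 <= lpp w i c.
Proof.
move=> w0 i c; rewrite /lpp; move: (c - i)%N => m; elim: m i => [|m ih] i //=.
by rewrite addr_ge0// le_max ih.
Qed.

Lemma lpp_le w : (forall i c, 0 <= w i c) ->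
  forall i j c, (i <= j)%N -> (j <= c)%N -> lpp w j c <= lpp w i c.
Proof.
move=> w0 i j [|c].
  by case: j => [|j]; rewrite ?ltn0// leqn0 => /eqP ->.
elim: j => [|j ih]; first by rewrite leqn0 => /eqP ->.
rewrite leq_eqVlt => /predU1P[->//|ij] jc.
apply: le_trans (ih ij (ltnW jc)); rewrite [leRHS]lppS//.
by rewrite -[leLHS]add0r lerD// le_max lexx.
Qed.

Lemma eq_lpp w w' i c : (i <= c)%N ->
  (forall i' c', (i <= i')%N -> (i' <= c')%N -> (c' <= c)%N -> w i' c' = w' i' c') ->
  lpp w i c = lpp w' i c.
Proof.
move=> ic ww; rewrite /lpp.
suff H k j : (i <= j)%N -> (j + k <= c)%N -> lpp_diag w k j = lpp_diag w' k j.
  by apply: H; rewrite ?subnKC.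
elim: k j => [|k ih] j ij jc /=; first by rewrite ww// -(addn0 j).
by rewrite ww ?leq_addr// !ih//; lia.
Qed.

Lemma measurable_lpp (d : measure_display) (T : measurableType d)
    (w : T -> nat -> nat -> R) (i c : nat) : (i <= c)%N ->
  (forall i' c', (i <= i')%N -> (i' <= c')%N -> (c' <= c)%N ->
    measurable_fun setT (fun t => w t i' c')) ->
  measurable_fun setT (fun t => lpp (w t) i c).
Proof.
move=> ic mw; rewrite /lpp.
suff H m j : (i <= j)%N -> (j + m <= c)%N -> measurable_fun setT (fun t => lpp_diag (w t) m j).
  by apply: H; rewrite ?subnKC.
elim: m j => [|m ih] j ij jc /=; first by apply: mw => //; rewrite -(addn0 j).
apply: measurable_funD; first by apply: mw; rewrite ?leq_addr.
apply: measurable_maxr; apply: ih => //.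
- exact: leqW.
- by rewrite addSnnS.
- by rewrite (leq_trans _ jc)// leq_add2l.
Qed.

End LastPassageRecursion.

(** * The joint law of last passage times along a boundary *)

Section BoundaryDistribution.
Context (R : realType).
Variables (n : nat) (b : nat -> R) (B : {poly R} -> R -> R).
Hypotheses (n0 : (0 < n)%N) (resB : residue_functional n b B).
Hypothesis b_gt0 : forall l, (l < n)%N -> 0 < b l.
Local Notation mu := (@lebesgue_measure R).
Local Notation cdf := (bd_cdf n b B).
Context (d : measure_display) (T : measurableType d) (P : probability T R).
Variables (I : choiceType) (D : set I) (omega : I -> {RV P >-> R}) (site : nat -> nat -> I).
Hypothesis siteD : forall i c, (i <= c)%N -> (c < n)%N -> D (site i c).
Hypothesis site_inj : forall i c i' c', (i <= c < n)%N -> (i' <= c' < n)%N ->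
  site i c = site i' c' -> (i, c) = (i', c').
Hypothesis indep : mutually_independent D omega.
Hypothesis law : forall i c, (i <= c)%N -> (c < n)%N ->
  has_exponential_law (omega (site i c)) (b i + b c).

(** The positive part is almost surely the variable itself, and it makes the
    monotonicity of last passage times hold everywhere. *)
Definition weight (t : T) (i c : nat) : R := Num.max (omega (site i c) t) 0.

Lemma weight_ge0 t i c : 0 <= weight t i c.
Proof. by rewrite /weight le_max lexx orbT. Qed.

Definition other_sites (i c : nat) : {fset I} :=
  [fset x in [seq site p.1 p.2 | p <- [seq (i', c') | i' <- iota 0 n, c' <- iota 0 n] &
    (p.1 <= p.2)%N && (p != (i, c))]]%fset.

Lemma mem_other_sites i c i' c' : (i' <= c')%N -> (c' < n)%N -> (i', c') != (i, c) ->
  site i' c' \in other_sites i c.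
Proof.
move=> ic' cn' ne; rewrite /other_sites inE /=; apply/mapP; exists (i', c') => //.
rewrite mem_filter ic' ne /=; apply/allpairsP; exists (i', c'); split => //.
  by rewrite mem_iota (leq_ltn_trans ic').
by rewrite mem_iota.
Qed.

Lemma other_sitesP i c x : x \in other_sites i c ->
  exists p : nat * nat, [/\ (p.1 <= p.2)%N, (p.2 < n)%N, p != (i, c) & x = site p.1 p.2].
Proof.
rewrite /other_sites inE /= => /mapP[p]; rewrite mem_filter => /andP[/andP[pp pne]].
move=> /allpairsP[q [_ ]]; rewrite mem_iota add0n => /andP[_ qn] pq ->.
by exists p; split => //; rewrite pq.
Qed.

(** One family of other weights serves for all the events that occur while the
    weight at [(i, c)] is added. *)
Lemma independent_site i c (A : set T) (E : set R) : (i <= c)%N -> (c < n)%N ->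
  <<s cylinders omega (other_sites i c) >> A -> measurable E ->
  (P (A `&` omega (site i c) @^-1` E) = P A * P (omega (site i c) @^-1` E))%E.
Proof.
move=> ic cn; apply: (independent_cylinders indep); last 2 first.
- exact: siteD.
- apply/negP => /other_sitesP[p [pp pn pne]] /site_inj; rewrite ic cn pp pn => /(_ erefl erefl) e.
  by rewrite e -surjective_pairing eqxx in pne.
- by move=> x /= /other_sitesP[p [pp pn _ ->]]; exact: siteD.
Qed.

Local Notation sub_type i c := (g_sigma_algebraType (cylinders omega (other_sites i c))).

Lemma measurable_other_weight i c i' c' : (i' <= c')%N -> (c' < n)%N -> (i', c') != (i, c) ->
  measurable_fun setT (fun t : sub_type i c => weight t i' c').
Proof.
move=> ic' cn' ne; apply: measurable_maxr => //.
move=> _ E mE; rewrite setTI; apply: sub_sigma_algebra.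
exists (fun x => if x == site i' c' then E else setT) => [x|]; first by case: ifP.
apply/seteqP; split => t /=.
  by move=> Et x /= _; rewrite /=; case: eqP => // ->.
by move=> /(_ (site i' c') (mem_other_sites ic' cn' ne)) /=; rewrite eqxx.
Qed.

(** The boundary reached when the weights of the columns before [c] and those
    of the cells [(i, c)] with [k <= i] have been taken into account. *)
Definition bd_lpp (c k : nat) (t : T) (r : nat) : R :=
  if (k <= r)%N then lpp (weight t) r c else lpp (weight t) r c.-1.

Lemma measurable_bd_lpp c k r : (c < n)%N -> (k < c)%N -> (r <= c)%N ->
  measurable_fun setT (fun t : sub_type k c => bd_lpp c k.+1 t r).
Proof.
move=> cn kc rc; rewrite /bd_lpp; case: ltnP => kr.
  apply: measurable_lpp => // i' c' ri' ic' cc'; apply: measurable_other_weight => //.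
    exact: leq_ltn_trans cn.
  by apply/eqP => -[e _]; move: ri'; rewrite e leqNgt kr.
apply: measurable_lpp => [|i' c' _ ic' cc'].
  by rewrite -ltnS prednK ?(leq_ltn_trans _ kc)// (leq_ltn_trans kr kc).
have c'c : (c' < c)%N by rewrite (leq_ltn_trans cc')// prednK// (leq_ltn_trans _ kc).
apply: measurable_other_weight => //; first exact: ltn_trans cn.
by apply/eqP => -[_ e]; rewrite e ltnn in c'c.
Qed.

Definition bd_event (c k : nat) (a : nat -> R) : set T :=
  [set t | forall r, (r <= c)%N -> bd_lpp c k t r <= a r].

Definition bd_correct (c k : nat) : Prop := forall a : nat -> R,
  (forall r, (r < c)%N -> a r.+1 <= a r) -> 0 <= a c ->
  fine (P (bd_event c k a)) = cdf c k a.

Lemma bd_lpp_ge0 c k t r : 0 <= bd_lpp c k t r.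
Proof. by rewrite /bd_lpp; case: ifP => _; apply: lpp_ge0 => i j; exact: weight_ge0. Qed.

(** Conditionally on the other weights, the new boundary is below [a] when the
    new weight plus [max (lpp k.+1 c) (lpp k c.-1)] is at most [a k] and the
    other entries are below [a]. The latter constraint is put into the variable
    [Y] by giving it a value above [a k] where it fails. *)
Lemma bd_correct_site c k : (c < n)%N -> (k < c)%N -> bd_correct c k.+1 -> bd_correct c k.
Proof.
move=> cn kc ih a a_noninc ac0.
have amono i j : (i <= j)%N -> (j <= c)%N -> a j <= a i.
  elim: j => [|j jh]; first by rewrite leqn0 => /eqP ->.
  rewrite leq_eqVlt => /predU1P[->//|ij] jc.
  exact: le_trans (a_noninc _ jc) (jh ij (ltnW jc)).
have ak0 : 0 <= a k by rewrite (le_trans ac0)// amono// ltnW.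
have c0 : (0 < c)%N by rewrite (leq_ltn_trans _ kc).
pose O : set T := [set t | forall r, (r <= c)%N -> r != k -> bd_lpp c k.+1 t r <= a r].
pose M t := Num.max (bd_lpp c k.+1 t k.+1) (bd_lpp c k.+1 t k).
pose Y t := if `[< O t >] then M t else a k + 1.
have mM : measurable_fun setT (M : sub_type k c -> R).
  apply: measurable_maxr; apply: measurable_bd_lpp => //; exact: ltnW.
have mO : measurable (O : set (sub_type k c)).
  rewrite (_ : O = \bigcap_(r in [set r | (r <= c)%N && (r != k)])
      [set t | bd_lpp c k.+1 t r <= a r]); last first.
    apply/seteqP; split => t /= Ot r; first by move=> /andP[]; exact: Ot.
    by move=> rc rk; apply: Ot; rewrite /= rc.
  apply: bigcap_measurableType => r /= /andP[rc _].
  rewrite -[X in measurable X]setTI.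
  exact: (measurable_bd_lpp cn kc rc measurableT (measurable_itv `]-oo, a r])).
have mY : measurable_fun setT (Y : sub_type k c -> R).
  apply: measurable_fun_ifT => //.
  by apply: (measurable_fun_bool true); rewrite setTI (_ : _ @^-1` _ = O)//; apply/seteqP;
    split => t /= /asboolP.
have sY E : measurable E -> <<s cylinders omega (other_sites k c) >> (Y @^-1` E).
  by move=> mE; have := mY measurableT E mE; rewrite setTI.
have mYT : measurable_fun setT (Y : T -> R).
  by move=> _ E mE; rewrite setTI; exact: sub_sigma_cylinders (sY _ mE).
pose YV : {RV P >-> R} := HB.pack (Y : T -> R) (isMeasurableFun.Build _ _ _ _ _ mYT).
have lam0 : 0 < b k + b c by rewrite addr_gt0// b_gt0// (ltn_trans kc).
have YVindep A E : measurable A -> measurable E ->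
    (P (YV @^-1` A `&` omega (site k c) @^-1` E) =
     P (YV @^-1` A) * P (omega (site k c) @^-1` E))%E.
  by move=> mA mE; apply: independent_site => //; [exact: ltnW|exact: sY].
have Y0 t : 0 <= YV t.
  rewrite /= /Y; case: ifP => _; last by rewrite addr_ge0.
  by rewrite /M le_max bd_lpp_ge0.
have ME t : lpp (weight t) k c = weight t k c + M t.
  rewrite /M /bd_lpp leqnn ltnn -(prednK c0) lppS ?prednK// -ltnS prednK//.
have otherE t r : r != k -> bd_lpp c k.+1 t r = bd_lpp c k t r.
  by move=> rk; rewrite /bd_lpp ltn_neqAle eq_sym rk.
have -> : bd_event c k a = [set t | YV t + Num.max (omega (site k c) t) 0 <= a k].
  apply/seteqP; split => t /=.
    move=> Et; rewrite /Y ifT; last first.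
      by apply/asboolP => r rc rk; rewrite otherE//; exact: Et.
    have := Et k (ltnW kc); rewrite /bd_lpp leqnn ME addrC; exact.
  rewrite /Y; case: asboolP => [Ot|_ /= h].
    move=> h r rc; have [->|rk] := eqVneq r k.
      by rewrite /bd_lpp leqnn ME addrC.
    by rewrite -otherE//; exact: Ot.
  have := weight_ge0 t k c; rewrite /weight => w0; exfalso; move: h w0; lra.
rewrite (exponential_convolution_ge0 lam0 (law (ltnW kc) cn) YVindep Y0 ak0).
apply: (bd_cdf_site resB b_gt0 cn kc a_noninc ac0).
  exact: (integrable_exponential_convolution YV (a k) lam0).
move=> w /andP[w0 wa]; congr (_ * _).
set s := a k - w; have s0 : 0 <= s by rewrite subr_ge0.
have sa : s <= a k by rewrite gerBl.
rewrite -ih.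
- congr (fine (P _)); apply/seteqP; split => t /=.
    rewrite /Y; case: asboolP => [Ot Ms|_ /= h]; last by exfalso; move: h sa; lra.
    have Ms1 : bd_lpp c k.+1 t k.+1 <= s by apply: le_trans Ms; rewrite /M le_max lexx.
    have Ms2 : bd_lpp c k.+1 t k <= s by apply: le_trans Ms; rewrite /M le_max lexx orbT.
    move=> r rc; rewrite /bd_cut; case: ltngtP => [rk|kr|->//].
      by apply: Ot => //; rewrite neq_ltn rk.
    rewrite le_min Ot//=; last by rewrite neq_ltn kr orbT.
    apply: le_trans Ms1; rewrite /bd_lpp leqnn kr; apply: lpp_le => // i j; exact: weight_ge0.
  move=> Et; rewrite /Y ifT.
    rewrite /M ge_max; apply/andP; split.
      have := Et k.+1 kc; rewrite /bd_cut ltnNge leqnSn /= gtn_eqF//.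
      by rewrite le_min => /andP[].
    by have := Et k (ltnW kc); rewrite /bd_cut ltnn eqxx.
  apply/asboolP => r rc rk; have := Et r rc; rewrite /bd_cut (negbTE rk).
  by case: ifP => // _; rewrite le_min => /andP[].
- move=> r rc; rewrite /bd_cut; case: (ltngtP r.+1 k) => [rk|kr|rk].
  + by rewrite /= a_noninc.
  + have [_|rk] := eqVneq r k; first by rewrite /= ge_min lexx orbT.
    by rewrite /= le_min !ge_min a_noninc//= lexx orbT.
  + by rewrite /= (le_trans sa)// -rk a_noninc.
- by rewrite /bd_cut ltnNge (ltnW kc) /= gtn_eqF// le_min ac0.
Qed.

(** The convolution formula with a variable that is identically [0]. *)
Lemma exponential_cdf (W : {RV P >-> R}) (lam s : R) : 0 < lam -> 0 <= s ->
  has_exponential_law W lam -> fine (P [set t | Num.max (W t) 0 <= s]) = 1 - expR (- lam * s).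
Proof.
move=> lam0 s0 lawW.
have mZ : measurable_fun setT (fun _ : T => 0 : R) by exact: measurable_cst.
pose Z : {RV P >-> R} := HB.pack (fun _ : T => 0 : R) (isMeasurableFun.Build _ _ _ _ _ mZ).
have ZW A E : measurable A -> measurable E ->
    (P (Z @^-1` A `&` W @^-1` E) = P (Z @^-1` A) * P (W @^-1` E))%E.
  move=> mA mE; have [A0|A0] := pselect (A 0).
    by rewrite (_ : Z @^-1` A = setT) ?setTI ?probability_setT ?mul1e//; apply/seteqP; split.
  by rewrite (_ : Z @^-1` A = set0) ?set0I ?measure0 ?mul0e//; apply/seteqP; split.
have := exponential_convolution_ge0 lam0 lawW ZW (fun _ => lexx 0) s0.
rewrite (_ : [set t | _] = [set t | Num.max (W t) 0 <= s]); last first.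
  by apply/seteqP; split => t /=; rewrite add0r.
move=> ->.
have dF (x : R) : is_derive x 1 (fun w => - expR (- lam * w)) (lam * expR (- lam * x)).
  refine (is_derive_eq (is_deriveN (is_derive_expE
    (is_derive_mulcE (- lam) (is_derive_id x 1)))) _); ring.
have cF : continuous (fun w => lam * expR (- lam * w)).
  move=> x; exact: is_derive_continuous (is_derive_mulcE lam (is_derive_expE
    (is_derive_mulcE (- lam) (is_derive_id x 1)))).
have := Rintegral_primitive s0 dF cF.
rewrite mulr0 expR0 opprK addrC => <-.
apply: eq_Rintegral => w; rewrite inE /= in_itv /= => /andP[w0 ws].
rewrite (_ : [set t | _] = setT) ?probability_setT ?mul1r//.
by apply/seteqP; split => // t _ /=; rewrite subr_ge0.
Qed.

(** The weight of a diagonal cell is [L(c, c)] itself, and it is independent of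
    the boundary of the column before. *)
Lemma bd_correct_corner c : (c < n)%N -> ((0 < c)%N -> bd_correct c.-1 0) -> bd_correct c c.
Proof.
move=> cn ih a a_noninc ac0.
pose A : set T := [set t | forall r, (r < c)%N -> lpp (weight t) r c.-1 <= a r].
have sA : <<s cylinders omega (other_sites c c) >> A.
  rewrite (_ : A = \bigcap_(r in [set r | (r < c)%N])
    [set t | lpp (weight t) r c.-1 <= a r]); last by apply/seteqP; split.
  apply: (@bigcap_measurableType _ (sub_type c c)) => r /= rc.
  rewrite -[X in measurable X]setTI.
  have m : measurable_fun setT (fun t : sub_type c c => lpp (weight t) r c.-1).
    have c0 : (0 < c)%N by rewrite (leq_ltn_trans _ rc).
    apply: measurable_lpp => [|i' c' _ ic' cc']; first by rewrite -ltnS prednK.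
    have c'c : (c' < c)%N by rewrite (leq_ltn_trans cc')// prednK.
    apply: measurable_other_weight => //; first exact: ltn_trans cn.
    by apply/eqP => -[_ e]; rewrite e ltnn in c'c.
  exact: (m measurableT _ (measurable_itv `]-oo, a r])).
have -> : bd_event c c a = A `&` omega (site c c) @^-1` [set x | Num.max x 0 <= a c].
  apply/seteqP; split => t /=.
    move=> Et; split => [r rc|].
      by have := Et r (ltnW rc); rewrite /bd_lpp leqNgt rc.
    by have := Et c (leqnn c); rewrite /bd_lpp leqnn lpp_corner.
  move=> [At wa] r; rewrite leq_eqVlt => /predU1P[->|rc]; rewrite /bd_lpp.
    by rewrite leqnn lpp_corner.
  by rewrite leqNgt rc; exact: At.
have mE : measurable [set x : R | Num.max x 0 <= a c].
  rewrite -[X in measurable X]setTI.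
  have m : measurable_fun setT (fun x : R => Num.max x 0) by exact: measurable_maxr.
  exact: (m measurableT _ (measurable_itv `]-oo, a c])).
rewrite (independent_site (leqnn c) cn sA mE) fineM ?fin_num_measure//; last 2 first.
- exact: sub_sigma_cylinders sA.
- exact: measurable_RV.
have lam0 : 0 < b c + b c by rewrite addr_gt0// b_gt0.
have := exponential_cdf lam0 ac0 (law (leqnn c) cn).
have -> : - (b c + b c) = - (2 * b c) by ring.
rewrite (_ : [set t | _] = omega (site c c) @^-1` [set x | Num.max x 0 <= a c])// => ->.
case: c cn ih a_noninc ac0 @A sA mE lam0 => [|c] cn ih a_noninc ac0 A sA mE lam0.
  rewrite (bd_cdf_corner00 n0 resB) (_ : A = setT) ?probability_setT ?mul1r//.
  by apply/seteqP; split.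
rewrite (bd_cdf_corner n0 resB b_gt0)// mulrC -ih//.
- move=> r rc; apply: a_noninc; exact: ltnW.
- exact: le_trans ac0 (a_noninc _ _).
Qed.

(** The weights are added column by column, starting from the diagonal cell in
    each column. *)
Lemma bd_correct_all c k : (c < n)%N -> (k <= c)%N -> bd_correct c k.
Proof.
elim: c k => [|c ihc] k cn kc.
  by move: kc; rewrite leqn0 => /eqP ->; exact: bd_correct_corner.
have corner : bd_correct c.+1 c.+1.
  by apply: bd_correct_corner => // _; apply: ihc => //; exact: ltnW.
have H j : (j <= c.+1)%N -> bd_correct c.+1 (c.+1 - j).
  elim: j => [|j jh] jc; first by rewrite subn0.
  apply: bd_correct_site => //; first by rewrite subSS ltnS leq_subr.
  by rewrite subnSK//; apply: jh; exact: ltnW.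
by have := H (c.+1 - k)%N (leq_subr _ _); rewrite subKn.
Qed.

End BoundaryDistribution.

Local Open Scope complex_scope.

(** * Fredholm determinants of finite rank kernels *)

Section PrincipalMinors.
Context (R : comUnitRingType).

(** Two triangular factorizations of one block matrix. *)
Lemma det_1_mulmxC m n (A : 'M[R]_(m, n)) (C : 'M[R]_(n, m)) :
  \det (1%:M + A *m C) = \det (1%:M + C *m A).
Proof.
have e1 : block_mx 1%:M A (- C) 1%:M =
    block_mx 1%:M 0 (- C) 1%:M *m block_mx 1%:M A 0 (1%:M + C *m A).
  rewrite mulmx_block !mul1mx !mul0mx !mulmx1 ?mulmx0 !addr0 mulNmx addrC.
  by rewrite addrK.
have e2 : block_mx 1%:M A (- C) 1%:M =
    block_mx 1%:M A 0 1%:M *m block_mx (1%:M + A *m C) 0 (- C) 1%:M.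
  rewrite mulmx_block !mul1mx !mul0mx !mulmx1 ?mulmx0 !add0r mulmxN.
  by rewrite addrK.
have := congr1 determinant e1; rewrite e2 !det_mulmx.
by rewrite !det_ublock !det_lblock !det1 !mul1r mulr1.
Qed.

(** Its determinant is the principal minor of [N] on [S], without a change of
    dimension. *)
Definition minor_rows n (N : 'M[R]_n) (S : {set 'I_n}) : 'M[R]_n :=
  \matrix_(i, j) (if i \in S then N i j else (i == j)%:R).

(** Expanding the product over the rows chooses, in each row, [N] or [1]. *)
Lemma det_1D n (N : 'M[R]_n) : \det (1%:M + N) = \sum_S \det (minor_rows N S).
Proof.
rewrite /determinant exchange_big /=; apply: eq_bigr => s _.
rewrite -mulr_sumr; congr (_ * _).
rewrite (eq_bigr (fun i => N i (s i) + (i == s i)%:R)) => [|i _]; last first.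
  by rewrite !mxE addrC.
by rewrite bigA_distr; apply: eq_bigr => S _; apply: eq_bigr => i _; rewrite mxE.
Qed.

(** With [E] the matrix of the injection [e], the rows of [1 + E E^T (N - 1)]
    outside the image of [e] are those of the identity, and exchanging the two
    factors gives [1 + E^T (N - 1) E = E^T N E]. *)
Lemma det_mxsub_inj n k (N : 'M[R]_n) (e : {ffun 'I_k -> 'I_n}) : injective e ->
  \det (mxsub e e N) = \det (minor_rows N (e @: [set: 'I_k]%SET)).
Proof.
move=> ei; pose E : 'M[R]_(n, k) := \matrix_(i, l) (i == e l)%:R.
have EN m (M : 'M[R]_(n, m)) : E^T *m M = rowsub e M.
  apply/matrixP => l j; rewrite !mxE (bigD1 (e l))//= !mxE eqxx mul1r big1 ?addr0// => i il.
  by rewrite !mxE (negbTE il) mul0r.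
have NE m (M : 'M[R]_(m, n)) : M *m E = colsub e M.
  apply/matrixP => j l; rewrite !mxE (bigD1 (e l))//= !mxE eqxx mulr1 big1 ?addr0// => i il.
  by rewrite !mxE (negbTE il) mulr0.
have -> : minor_rows N (e @: [set: 'I_k]%SET) = 1%:M + E *m (E^T *m (N - 1%:M)).
  rewrite EN; apply/matrixP => i j; rewrite mxE [RHS]mxE [1%:M i j]mxE [(E *m _) i j]mxE.
  case: imsetP => [[l _ ->]|il].
    rewrite (bigD1 l)//= !mxE eqxx mul1r big1 ?addr0; first by rewrite addrC subrK.
    by move=> l' l'l; rewrite !mxE (inj_eq ei) eq_sym (negbTE l'l) mul0r.
  rewrite big1 ?addr0// => l _; rewrite !mxE; case: eqP => [iel|_]; last by rewrite mul0r.
  by case: il; exists l; rewrite ?inE.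
rewrite det_1_mulmxC -mulmxA NE EN; congr (\det _); apply/matrixP => l l'.
by rewrite !mxE (inj_eq ei) addrC subrK.
Qed.

Lemma det_mxsub_ninj n k (N : 'M[R]_n) (e : {ffun 'I_k -> 'I_n}) : ~~ injectiveb e ->
  \det (mxsub e e N) = 0.
Proof.
move=> /injectivePn[l [l' ll' el]]; apply: (determinant_alternate ll') => j.
by rewrite !mxE el.
Qed.

(** Noninjective [e] repeat a row; the injective ones with a given image [S] all
    give the principal minor on [S], and there are [k!] of them. *)
Lemma sum_det_mxsub n k (N : 'M[R]_n) :
  \sum_(e : {ffun 'I_k -> 'I_n}) \det (mxsub e e N) =
  k`!%:R * \sum_(S : {set 'I_n} | #|S| == k) \det (minor_rows N S).
Proof.
rewrite (bigID (fun e : {ffun 'I_k -> 'I_n} => injectiveb e))/=.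
rewrite [X in _ + X]big1 ?addr0; last by move=> e; exact: det_mxsub_ninj.
rewrite (partition_big (fun e : {ffun 'I_k -> 'I_n} => e @: [set: 'I_k]%SET)
  (fun S : {set 'I_n} => #|S| == k)) /=; last first.
  by move=> e /injectiveP ei; rewrite card_imset// cardsT card_ord.
rewrite mulr_sumr; apply: eq_bigr => S /eqP Sk.
rewrite (eq_bigr (fun=> \det (minor_rows N S))); last first.
  by move=> e /andP[/injectiveP ei /eqP <-]; exact: det_mxsub_inj.
rewrite sumr_const mulr_natl; congr (_ *+ _).
have <- : #|[set e : {ffun 'I_k -> 'I_n} in ffun_on (mem S) | injectiveb e]| = k`!.
  by rewrite card_inj_ffuns_on card_ord Sk ffactnn.
rewrite cardsE; apply: eq_card => e; rewrite [RHS]inE [LHS]unfold_in [LHS]/= andbC.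
case: (boolP (injectiveb e)) => [/injectiveP ei|]; last by rewrite !andbF.
rewrite !andbT; apply/eqP/ffun_onP => [<- l|eS]; first by rewrite imset_f.
apply/eqP; rewrite eqEcard card_imset// cardsT card_ord Sk leqnn andbT.
by apply/fintype.subsetP => _ /imsetP[l _ ->]; exact: eS.
Qed.

End PrincipalMinors.

Lemma det_1B_minors (F : numFieldType) n (N : 'M[F]_n) m : (n <= m)%N ->
  \det (1%:M - N) = \sum_(k < m.+1) (-1) ^+ k / k`!%:R *
    \sum_(e : {ffun 'I_k -> 'I_n}) \det (mxsub e e N).
Proof.
move=> nm; rewrite det_1D (partition_big (fun S : {set 'I_n} => inord #|S| : 'I_m.+1) predT)//=.
apply: eq_bigr => k _.
rewrite (eq_bigr (fun e : {ffun 'I_k -> 'I_n} => (-1) ^+ k * \det (mxsub e e (- N)))); last first.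
  move=> e _; rewrite (_ : mxsub e e (- N) = -1 *: mxsub e e N).
    by rewrite detZ mulrA -expr2 sqrr_sign mul1r.
  by apply/matrixP => i j; rewrite !mxE mulN1r.
rewrite -mulr_sumr sum_det_mxsub.
rewrite (_ : forall a, (-1) ^+ k / k`!%:R * ((-1) ^+ k * (k`!%:R * a)) = a :> F); last first.
  move=> a; have k0 : k`!%:R != 0 :> F by rewrite pnatr_eq0 -lt0n fact_gt0.
  by rewrite mulrACA -expr2 sqrr_sign mul1r mulrA mulVf// mul1r.
apply: eq_bigl => S; rewrite -val_eqE /= inordK// ltnS (leq_trans _ nm)//.
by have := max_card (mem S); rewrite card_ord.
Qed.

Section PowerIntegral.
Context (R : realType) (d : measure_display) (T : measurableType d).
Variable mu : {sigma_finite_measure set T -> \bar R}.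
Local Open Scope ereal_scope.

(** Fubini, one coordinate at a time. *)
Lemma integral_power_measure k (h : 'I_k -> T -> R) :
  (forall i, mu.-integrable setT (EFin \o h i)) ->
  (power_measure mu k).-integrable setT (fun z => (\prod_i h i (tnth z i))%R%:E) /\
  \int[power_measure mu k]_z (\prod_i h i (tnth z i))%R%:E =
    (\prod_i \int[mu]_x h i x)%R%:E.
Proof.
elim: k h => [|k ih] h inth.
  split.
    under eq_fun do rewrite big_ord0.
    by apply: finite_measure_integrable_cst.
  rewrite (eq_integral (fun=> 1)) => [|z _]; last by rewrite big_ord0.
  by rewrite big_ord0 integral_dirac// diracT mul1e.
have [intH valH] := ih (fun i => h (lift ord0 i)) (fun i => inth (lift ord0 i)).
pose H (z : k.-tuple T) := (\prod_i h (lift ord0 i) (tnth z i))%R.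
pose phi (p : T * k.-tuple T) : k.+1.-tuple T := [tuple of p.1 :: p.2].
have mphi : measurable_fun setT phi.
  exact: (measurable_cons measurable_fst measurable_snd).
have mh i : measurable_fun setT (h i).
  by apply/measurable_EFinP; exact: measurable_int (inth i).
pose f (z : k.+1.-tuple T) := (\prod_i h i (tnth z i))%R%:E.
have mf : measurable_fun setT f.
  apply/measurable_EFinP; apply: measurable_prod => i _.
  by apply: measurableT_comp => //; exact: measurable_tnth.
have fphi : f \o phi = fun p => (h ord0 p.1 * H p.2)%R%:E.
  apply/funext => p; rewrite /f /= big_ord_recl; congr (_%:E); congr (_ * _)%R.
  by apply: eq_bigr => i _; rewrite tnthS; congr (h _ (tnth _ _)); exact: val_inj.
have mfphi : measurable_fun setT (f \o phi) by exact: measurableT_comp.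
have intHfin : \int[power_measure mu k]_z `|(H z)%:E| < +oo.
  by have /integrableP[_] := intH.
have inthfin : \int[mu]_x `|(h ord0 x)%:E| < +oo.
  by have /integrableP[_] := inth ord0.
have mHE : measurable_fun setT (fun z => (H z)%:E) by exact: measurable_int intH.
have intfphi : (mu \x power_measure mu k).-integrable setT (f \o phi).
  apply/(integrable12ltyP _ _ mfphi).
  have absE x z : `|(f \o phi) (x, z)| = `|(h ord0 x)%:E| * `|(H z)%:E|.
    by rewrite fphi EFinM abseM.
  under eq_integral => x _.
    under eq_integral => z _ do rewrite absE.
    rewrite ge0_integralZl//; last exact: measurableT_comp.
    over.
  rewrite ge0_integralZr//.
  - by rewrite lte_mul_pinfty// ?integral_ge0// ge0_fin_numE ?integral_ge0.
  - by apply: measurableT_comp => //; exact/measurable_EFinP.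
  - exact: integral_ge0.
have intp : (power_measure mu k.+1).-integrable setT f.
  exact: (integrable_pushforward mphi mf intfphi measurableT).
split; first exact: intp.
transitivity (\int[mu \x power_measure mu k]_p (f \o phi) p).
  exact: (integral_pushforward mphi mf intfphi measurableT).
rewrite -(integral12_prod_meas1 intfphi).
have fE x z : (f \o phi) (x, z) = (h ord0 x)%:E * (H z)%:E by rewrite fphi EFinM.
under eq_integral => x _.
  rewrite /fubini_F.
  under eq_integral => z _ do rewrite fE.
  rewrite integralZl//=.
  rewrite valH.
  over.
rewrite integralZr//=; last exact: inth.
by rewrite big_ord_recl EFinM /Rintegral fineK//; exact: integrable_fin_num (inth ord0).
Qed.

End PowerIntegral.

Section HasIntegral.
Context (R : realType) (d : measure_display) (T : measurableType d).
Variable mu : {measure set T -> \bar R}.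

Definition has_integral (F : T -> R) (v : R) : Prop :=
  mu.-integrable setT (EFin \o F) /\ (\int[mu]_x (F x)%:E = v%:E)%E.

Lemma has_integralZ (k : R) F v : has_integral F v -> has_integral (fun x => k * F x) (k * v).
Proof.
move=> [iF vF]; split.
  by apply: eq_integrable (integrableZl measurableT k iF) => // x _; rewrite /= EFinM.
under eq_integral do rewrite EFinM.
by rewrite integralZl// vF EFinM.
Qed.

Lemma has_integral_sum (I : Type) (r : seq I) (F : I -> T -> R) (v : I -> R) :
  (forall i, has_integral (F i) (v i)) ->
  has_integral (fun x => \sum_(i <- r) F i x) (\sum_(i <- r) v i).
Proof.
move=> h; elim: r => [|i r [ir vr]].
  split; rewrite ?big_nil.
    by apply: eq_integrable (integrable0 _ _) => // x _; rewrite /= big_nil.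
  by under eq_integral do rewrite big_nil; rewrite integral0.
have [iF vF] := h i; split.
  apply: eq_integrable (integrableD measurableT iF ir) => // x _.
  by rewrite /= big_cons EFinD.
under eq_integral do rewrite big_cons EFinD.
by rewrite integralD// vF vr big_cons EFinD.
Qed.

End HasIntegral.

Section FiniteRank.
Context (R : realType) (d : measure_display) (T : measurableType d).
Variable mu : {sigma_finite_measure set T -> \bar R}.
Variables (n : nat) (f g : 'I_n -> T -> R).
Hypothesis intfg : forall j l, mu.-integrable setT (fun x => (g j x * f l x)%:E).

Definition finite_rank (x y : T) : R[i] := (\sum_(l < n) f l x * g l y)%:C.

Definition gram_mx : 'M[R]_n := \matrix_(j, l) \int[mu]_x (g j x * f l x).

(** The expansion behind the Cauchy-Binet formula, arranged so that each product
    has one factor per coordinate of [z]. *)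
Lemma finite_rank_minor k (z : k.-tuple T) :
  kernel_minor finite_rank z =
  (\sum_(e : {ffun 'I_k -> 'I_n}) \sum_(s : 'S_k) (-1) ^+ s *
    \prod_i (g (e (s i)) (tnth z i) * f (e i) (tnth z i)))%:C.
Proof.
rewrite /kernel_minor.
rewrite (_ : \matrix_(i < k, j < k) finite_rank (tnth z i) (tnth z j) =
  map_mx (real_complex R) (\matrix_(i, j) (\sum_(l < n) f l (tnth z i) * g l (tnth z j)))).
  rewrite det_map_mx; congr (_%:C); rewrite /determinant exchange_big /=.
  rewrite (reindex_inj invg_inj) /=; apply: eq_bigr => s _.
  rewrite -mulr_sumr odd_permV; congr (_ * _).
  under eq_bigr do rewrite mxE.
  rewrite bigA_distr_bigA /=; apply: eq_bigr => e _.
  rewrite big_split /= [RHS]big_split /= mulrC; congr (_ * _).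
  rewrite (reindex_inj (@perm_inj _ s)) /=; apply: eq_bigr => i _.
  by rewrite permK.
by apply/matrixP => i j; rewrite !mxE.
Qed.

Lemma integral_finite_rank_minor k :
  has_integral (power_measure mu k) (fun z => complex.Re (kernel_minor finite_rank z))
    (\sum_(e : {ffun 'I_k -> 'I_n}) \det (mxsub e e gram_mx)).
Proof.
have -> : (fun z : k.-tuple T => complex.Re (kernel_minor finite_rank z)) = fun z =>
    \sum_(e : {ffun 'I_k -> 'I_n}) \sum_(s : 'S_k) (-1) ^+ s *
    \prod_i (g (e (s i)) (tnth z i) * f (e i) (tnth z i)).
  by apply/funext => z; rewrite finite_rank_minor.
apply: has_integral_sum => e; rewrite -det_tr /determinant.
apply: has_integral_sum => s; apply: has_integralZ.
have [iP vP] := @integral_power_measure _ _ _ mu k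
  (fun i x => g (e (s i)) x * f (e i) x) (fun i => intfg _ _).
split; first exact: iP.
rewrite vP; congr (_%:E); apply: eq_bigr => i _.
by rewrite !mxE.
Qed.

Definition fredholm_coef k : R :=
  (-1) ^+ k / k`!%:R * \sum_(e : {ffun 'I_k -> 'I_n}) \det (mxsub e e gram_mx).

Lemma fredholm_term_finite_rank k : fredholm_term mu finite_rank k = (fredholm_coef k)%:C.
Proof.
have [iP vP] := integral_finite_rank_minor k.
rewrite /fredholm_term /cintegral /Rintegral vP /=.
rewrite (eq_integral (fun=> 0%E)) => [|z _]; last by rewrite finite_rank_minor.
rewrite integral0 /= /fredholm_coef rmorphM /= fmorph_div rmorphXn rmorphN1 rmorph_nat.
by [].
Qed.

Lemma fredholm_partial_finite_rank m : (n <= m)%N ->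
  fredholm_partial mu finite_rank m = (\det (1%:M - gram_mx))%:C.
Proof.
move=> nm; rewrite /fredholm_partial (det_1B_minors _ nm).
rewrite -(big_mkord xpredT fredholm_coef) big_ltn// rmorphD rmorph_sum /=.
congr (_ + _); last by apply: eq_bigr => k _; exact: fredholm_term_finite_rank.
rewrite /fredholm_coef expr0 fact0 divr1 mul1r (eq_bigr (fun=> 1)) => [|e _]; last first.
  exact: det_mx00.
by rewrite sumr_const card_ffun !card_ord expn0.
Qed.

(** The series stops at the rank, and its sum is the expansion of
    [det (1 - gram_mx)] into principal minors. *)
Lemma fredholm_finite_rank :
  fredholm_defined mu finite_rank /\
  fredholm_det mu finite_rank = (\det (1%:M - gram_mx))%:C.
Proof.
have ev : \forall m \near \oo, fredholm_partial mu finite_rank m = (\det (1%:M - gram_mx))%:C.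
  by exists n => // m /= nm; exact: fredholm_partial_finite_rank.
have cv : fredholm_partial mu finite_rank m @[m --> \oo] -->
  ((\det (1%:M - gram_mx))%:C : (R[i] : numFieldType)).
  by apply: cvg_near_cst.
split.
  split; last by apply/cvg_ex; eexists; exact: cv.
  move=> k; split; first by have [] := integral_finite_rank_minor k.
  apply: eq_integrable (integrable0 _ _) => // z _.
  by rewrite finite_rank_minor.
exact: cvg_lim cv.
Qed.

End FiniteRank.

(** * Contour integrals *)

Section ComplexCurves.
Context (R : realType).
Local Notation mu := (@lebesgue_measure R).
Local Notation Re := (@complex.Re R).
Local Notation Im := (@complex.Im R).
Implicit Types (F G H : R -> R[i]) (z w c : R[i]).

Lemma complex_eqP z w : Re z = Re w -> Im z = Im w -> z = w.
Proof. by case: z => a b; case: w => a' b' /= -> ->. Qed.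

Lemma ReM z w : Re (z * w) = Re z * Re w - Im z * Im w.
Proof. by case: z => a b; case: w. Qed.

Lemma ImM z w : Im (z * w) = Re z * Im w + Im z * Re w.
Proof. by case: z => a b; case: w. Qed.

Lemma ReD z w : Re (z + w) = Re z + Re w.
Proof. by case: z => a b; case: w. Qed.

Lemma ImD z w : Im (z + w) = Im z + Im w.
Proof. by case: z => a b; case: w. Qed.

Definition sqnorm z : R := Re z ^+ 2 + Im z ^+ 2.

Lemma sqnorm_neq0 z : z != 0 -> sqnorm z != 0.
Proof.
case: z => a b; rewrite /sqnorm /=; apply: contraNneq => /eqP.
rewrite paddr_eq0 ?sqr_ge0// !sqrf_eq0 => /andP[/eqP -> /eqP ->].
by rewrite eq_complex /= !eqxx.
Qed.

Lemma ReV z : Re z^-1 = Re z / sqnorm z.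
Proof. by case: z. Qed.

Lemma ImV z : Im z^-1 = - (Im z / sqnorm z).
Proof. by case: z => a b; rewrite /sqnorm. Qed.

Definition curve_cont F (t : R) : Prop :=
  {for t, continuous (Re \o F)} /\ {for t, continuous (Im \o F)}.

Definition curve_derive F (dF : R[i]) (t : R) : Prop :=
  is_derive t 1 (Re \o F) (Re dF) /\ is_derive t 1 (Im \o F) (Im dF).

Lemma curve_derive_cont F dF t : curve_derive F dF t -> curve_cont F t.
Proof. by move=> [rF iF]; split;
  [exact: is_derive_continuous rF|exact: is_derive_continuous iF]. Qed.

Lemma curve_cont_cst c t : curve_cont (fun=> c) t.
Proof. by split; exact: cst_continuous. Qed.

Lemma curve_contD F G t : curve_cont F t -> curve_cont G t ->
  curve_cont (fun t => F t + G t) t.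
Proof.
move=> [rF iF] [rG iG]; split.
  rewrite (_ : _ \o _ = fun t => Re (F t) + Re (G t)); last by apply/funext => y; exact: ReD.
  exact: (continuousD rF rG).
rewrite (_ : _ \o _ = fun t => Im (F t) + Im (G t)); last by apply/funext => y; exact: ImD.
exact: (continuousD iF iG).
Qed.

Lemma curve_contM F G t : curve_cont F t -> curve_cont G t ->
  curve_cont (fun t => F t * G t) t.
Proof.
move=> [rF iF] [rG iG]; split.
  rewrite (_ : _ \o _ = fun t => Re (F t) * Re (G t) - Im (F t) * Im (G t)); last first.
    by apply/funext => y; exact: ReM.
  exact: (continuousB (continuousM rF rG) (continuousM iF iG)).
rewrite (_ : _ \o _ = fun t => Re (F t) * Im (G t) + Im (F t) * Re (G t)); last first.
  by apply/funext => y; exact: ImM.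
exact: (continuousD (continuousM rF iG) (continuousM iF rG)).
Qed.

Lemma curve_derive_cst c t : curve_derive (fun=> c) 0 t.
Proof. by split; exact: is_derive_cstE. Qed.

Lemma curve_deriveD F G dF dG t : curve_derive F dF t -> curve_derive G dG t ->
  curve_derive (fun t => F t + G t) (dF + dG) t.
Proof.
move=> [rF iF] [rG iG]; split.
  rewrite (_ : _ \o _ = fun t => Re (F t) + Re (G t)); last by apply/funext => y; exact: ReD.
  by rewrite ReD; exact: is_derive_addE rF rG.
rewrite (_ : _ \o _ = fun t => Im (F t) + Im (G t)); last by apply/funext => y; exact: ImD.
by rewrite ImD; exact: is_derive_addE iF iG.
Qed.

Lemma curve_deriveM F G dF dG t : curve_derive F dF t -> curve_derive G dG t ->
  curve_derive (fun t => F t * G t) (dF * G t + F t * dG) t.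
Proof.
move=> [rF iF] [rG iG]; split.
  rewrite (_ : _ \o _ = fun t => Re (F t) * Re (G t) - Im (F t) * Im (G t)); last first.
    by apply/funext => y; exact: ReM.
  refine (is_derive_eq (is_derive_subE (is_derive_mulE rF rG) (is_derive_mulE iF iG)) _).
  by rewrite ReD !ReM /=; ring.
rewrite (_ : _ \o _ = fun t => Re (F t) * Im (G t) + Im (F t) * Re (G t)); last first.
  by apply/funext => y; exact: ImM.
refine (is_derive_eq (is_derive_addE (is_derive_mulE rF iG) (is_derive_mulE iF rG)) _).
by rewrite ImD !ImM /=; ring.
Qed.

Lemma curve_deriveV F dF t : F t != 0 -> curve_derive F dF t ->
  curve_derive (fun t => (F t)^-1) (- dF / F t ^+ 2) t.
Proof.
move=> Ft0 [rF iF]; have n0 := sqnorm_neq0 Ft0.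
have dn : is_derive t 1 (fun y => sqnorm (F y)) (2 * (Re (F t) * Re dF + Im (F t) * Im dF)).
  rewrite (_ : (fun y => _) = fun y => Re (F y) * Re (F y) + Im (F y) * Im (F y)).
    refine (is_derive_eq (is_derive_addE (is_derive_mulE rF rF) (is_derive_mulE iF iF)) _).
    rewrite /=; ring.
  by apply/funext => y; rewrite /sqnorm !expr2.
have dv := @is_deriveV R (fun y => sqnorm (F y)) t _ 1 n0 dn.
have -> : - dF / F t ^+ 2 = -1 * (dF * (F t)^-1 * (F t)^-1).
  by rewrite mulN1r expr2 invfM mulrA mulNr mulNr.
have Re1 z : Re (-1 * z) = - Re z by rewrite mulN1r; case: (z).
have Im1 z : Im (-1 * z) = - Im z by rewrite mulN1r; case: (z).
split.
  rewrite (_ : _ \o _ = fun t => Re (F t) * (sqnorm (F t))^-1); last first.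
    by apply/funext => y; rewrite /= ReV.
  refine (is_derive_eq (is_derive_mulE rF dv) _).
  rewrite Re1 !ReM !ImM !ReV !ImV /GRing.scale /=.
  by move: n0; rewrite /sqnorm => n0; field.
rewrite (_ : _ \o _ = fun t => -1 * (Im (F t) * (sqnorm (F t))^-1)); last first.
  by apply/funext => y; rewrite /= ImV mulN1r.
refine (is_derive_eq (is_derive_mulcE (-1) (is_derive_mulE iF dv)) _).
rewrite Im1 !ImM !ReM !ReV !ImV /GRing.scale /=.
by move: n0; rewrite /sqnorm => n0; field.
Qed.

Lemma curve_derive_exp F dF t : curve_derive F dF t ->
  curve_derive (fun t => cexp (F t)) (dF * cexp (F t)) t.
Proof.
move=> [rF iF].
have dc : is_derive t 1 (fun y => cos (Im (F y))) (- (Im dF * sin (Im (F t)))).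
  refine (is_derive_eq (is_derive1_comp (f := cos) (g := Im \o F) (is_derive_cos _) iF) _).
  by rewrite /=; ring.
have ds : is_derive t 1 (fun y => sin (Im (F y))) (Im dF * cos (Im (F t))).
  refine (is_derive_eq (is_derive1_comp (f := sin) (g := Im \o F) (is_derive_sin _) iF) _).
  by rewrite /=; ring.
have de := is_derive_expE rF.
split.
  refine (is_derive_eq (is_derive_mulE de dc) _).
  by rewrite ReM /=; ring.
refine (is_derive_eq (is_derive_mulE de ds) _).
by rewrite ImM /=; ring.
Qed.

Definition cont01 F : Prop := forall t, 0 <= t <= 1 -> curve_cont F t.

Lemma within01 (f : R -> R) : (forall t : R, 0 <= t <= 1 -> {for t, continuous f}) ->
  {within `[0, 1], continuous f}.
Proof.
by move=> cf; apply: continuous_in_subspaceT => t /set_mem /=; rewrite in_itv /=; exact: cf.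
Qed.

Lemma integrable01 F : cont01 F -> cintegrable mu `[0, 1] F.
Proof.
move=> cF; split.
  apply: (@continuous_compact_integrable R (Re \o F)); first exact: segment_compact.
  by apply: within01 => t /cF[].
apply: (@continuous_compact_integrable R (Im \o F)); first exact: segment_compact.
by apply: within01 => t /cF[].
Qed.

Local Notation int01 := (cintegral mu `[0, 1]).

Lemma eq_int01 F G : (forall t, 0 <= t <= 1 -> F t = G t) -> int01 F = int01 G.
Proof.
move=> FG; apply: complex_eqP; rewrite /=; apply: eq_Rintegral => t;
  by move=> /set_mem /=; rewrite in_itv /= => /FG ->.
Qed.

Lemma int01D F G : cont01 F -> cont01 G -> int01 (fun t => F t + G t) = int01 F + int01 G.
Proof.
move=> /integrable01[rF iF] /integrable01[rG iG]; apply: complex_eqP.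
  rewrite ReD /= -RintegralD//; apply: eq_Rintegral => t _; exact: ReD.
rewrite ImD /= -RintegralD//; apply: eq_Rintegral => t _; exact: ImD.
Qed.

Lemma int01Z c F : cont01 F -> int01 (fun t => c * F t) = c * int01 F.
Proof.
move=> /integrable01[rF iF].
have zF (k : R) (f : R -> R) : mu.-integrable `[0, 1] (fun t => (f t)%:E) ->
    mu.-integrable `[0, 1] (EFin \o (fun t => k * f t)).
  move=> h; apply: eq_integrable (integrableZl _ k h) => // t _; by rewrite /= EFinM.
apply: complex_eqP.
  rewrite ReM /= -!RintegralZl// -RintegralB//; try exact: zF.
  by apply: eq_Rintegral => t _; exact: ReM.
rewrite ImM /= -!RintegralZl// -RintegralD//; try exact: zF.
by apply: eq_Rintegral => t _; exact: ImM.
Qed.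

(** The fundamental theorem of calculus for each component. *)
Lemma int01_primitive H dH : (forall t : R, 0 <= t <= 1 -> curve_derive H (dH t) t) ->
  cont01 dH -> int01 dH = H 1 - H 0.
Proof.
move=> dHt cdH.
have ftc (f F : R -> R) : (forall t : R, 0 <= t <= 1 -> is_derive t 1 F (f t)) ->
    (forall t : R, 0 <= t <= 1 -> {for t, continuous f}) ->
    \int[mu]_(t in `[0, 1]) f t = F 1 - F 0.
  move=> dF cf; rewrite /Rintegral (@continuous_FTC2 _ f F)//.
  - exact: within01.
  - split.
    + move=> t; rewrite in_itv /= => /andP[t0 t1].
      by have := dF t; rewrite !ltW// => /(_ isT)[].
    + apply: cvg_at_right_filter; apply: is_derive_continuous; apply: dF.
      by rewrite lexx ler01.
    + apply: cvg_at_left_filter; apply: is_derive_continuous; apply: dF.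
      by rewrite lexx ler01.
  - move=> t; rewrite in_itv /= => /andP[t0 t1]; rewrite derive1E.
    by have := dF t; rewrite !ltW// => /(_ isT)[].
have ReB z w : Re (z - w) = Re z - Re w by case: (z) => a b; case: (w).
have ImB z w : Im (z - w) = Im z - Im w by case: (z) => a b; case: (w).
apply: complex_eqP.
  rewrite ReB /=; apply: (ftc (fun t => Re (dH t)) (fun t => Re (H t))).
    by move=> t /dHt[].
  by move=> t /cdH[].
rewrite ImB /=; apply: (ftc (fun t => Im (dH t)) (fun t => Im (H t))).
  by move=> t /dHt[].
by move=> t /cdH[].
Qed.

End ComplexCurves.

Section Contour.
Context (R : realType) (m : nat) (g : 'I_m -> R -> R[i]).
Hypothesis gclosed : closed_contour g.
Local Notation Re := (@complex.Re R).
Local Notation Im := (@complex.Im R).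
Local Notation oint := (contour_integral g).
Implicit Types (f h : R[i] -> R[i]).

Lemma arc_derive k t : curve_derive (g k) (arc_deriv (g k) t) t.
Proof.
have [gk _] := gclosed; have [dr di _ _] := gk k.
by split; rewrite /arc_deriv /= derive1E; exact/derivableP.
Qed.

Lemma arc_deriv_cont k t : curve_cont (arc_deriv (g k)) t.
Proof.
have [gk _] := gclosed; have [_ _ cr ci] := gk k.
by split; [exact: cr|exact: ci].
Qed.

Definition cont_on f : Prop := forall k, cont01 (fun t => f (g k t)).

Lemma cont_on_cst c : cont_on (fun=> c).
Proof. by move=> k t _; exact: curve_cont_cst. Qed.

Lemma cont_on_id : cont_on id.
Proof. by move=> k t _; exact: curve_derive_cont (arc_derive k t). Qed.

Lemma cont_onD f h : cont_on f -> cont_on h -> cont_on (fun w => f w + h w).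
Proof. by move=> cf ch k t t01; apply: curve_contD; [exact: cf|exact: ch]. Qed.

Lemma cont_onM f h : cont_on f -> cont_on h -> cont_on (fun w => f w * h w).
Proof. by move=> cf ch k t t01; apply: curve_contM; [exact: cf|exact: ch]. Qed.

Definition avoids (z : R[i]) : Prop := forall k t, 0 <= t <= 1 -> g k t != z.

Lemma sub_derive z k t : curve_derive (fun t => g k t - z) (arc_deriv (g k) t) t.
Proof.
by have := curve_deriveD (arc_derive k t) (curve_derive_cst (- z) t); rewrite addr0.
Qed.

Lemma cont_onV z : avoids z -> cont_on (fun w => (w - z)^-1).
Proof.
move=> gz k t t01; apply: curve_derive_cont.
by apply: curve_deriveV (sub_derive z k t); rewrite subr_eq0 gz.
Qed.

Lemma exp_derive (x : R) k t :
  curve_derive (fun t => cexp (x%:C * g k t)) (x%:C * arc_deriv (g k) t * cexp (x%:C * g k t)) t.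
Proof.
apply: curve_derive_exp.
by have := curve_deriveM (curve_derive_cst x%:C t) (arc_derive k t); rewrite mul0r add0r.
Qed.

Lemma cont_on_exp (x : R) : cont_on (fun w => cexp (x%:C * w)).
Proof. by move=> k t _; exact: curve_derive_cont (exp_derive x k t). Qed.

Lemma integrand_cont f k : cont_on f -> cont01 (fun t => f (g k t) * arc_deriv (g k) t).
Proof. by move=> cf t t01; apply: curve_contM; [exact: cf|exact: arc_deriv_cont]. Qed.

Lemma eq_oint f h : (forall k t, 0 <= t <= 1 -> f (g k t) = h (g k t)) -> oint f = oint h.
Proof.
move=> fh; apply: eq_bigr => k _; apply: eq_int01 => t t01; by rewrite fh.
Qed.

Lemma ointD f h : cont_on f -> cont_on h -> oint (fun w => f w + h w) = oint f + oint h.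
Proof.
move=> cf ch; rewrite /contour_integral -big_split /=; apply: eq_bigr => k _.
rewrite -int01D; try exact: integrand_cont.
by apply: eq_int01 => t _; rewrite mulrDl.
Qed.

Lemma ointZ c f : cont_on f -> oint (fun w => c * f w) = c * oint f.
Proof.
move=> cf; rewrite /contour_integral mulr_sumr; apply: eq_bigr => k _.
rewrite -int01Z; last exact: integrand_cont.
by apply: eq_int01 => t _; rewrite mulrA.
Qed.

(** The increments of a primitive cancel around a closed contour. *)
Lemma oint_primitive f H : cont_on f ->
  (forall k t, 0 <= t <= 1 -> curve_derive (fun t => H (g k t)) (f (g k t) * arc_deriv (g k) t)
    t) ->
  oint f = 0.
Proof.
move=> cf dH; rewrite /contour_integral.
rewrite (eq_bigr (fun k => H (g k 1) - H (g k 0))); last first.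
  move=> k _.
  by rewrite (@int01_primitive _ (fun t => H (g k t)))//; [exact: dH|exact: integrand_cont].
rewrite sumrB; have [_ gend] := gclosed.
rewrite (eq_bigr (fun k => H (g (ordS k) 0))) => [|k _]; last by rewrite gend.
by rewrite [X in _ - X](reindex_inj (@ordS_inj m)) subrr.
Qed.

Lemma oint_exp (x : R) : oint (fun w => cexp (x%:C * w)) = 0.
Proof.
have [->|x0] := eqVneq x 0.
  have cexp0 w : cexp (0%:C * w) = 1.
    by rewrite mul0r /cexp /= expR0 cos0 sin0 mulr0 mulr1.
  rewrite (eq_oint (h := fun=> 1)) => [|k t _]; last exact: cexp0.
  apply: (@oint_primitive (fun=> 1) id); first exact: cont_on_cst.
  by move=> k t _; rewrite mul1r; exact: arc_derive.
apply: (@oint_primitive _ (fun w => (x%:C)^-1 * cexp (x%:C * w))); first exact: cont_on_exp.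
move=> k t _; have := curve_deriveM (curve_derive_cst (x%:C)^-1 t) (exp_derive x k t).
have xC0 : x%:C != 0 by rewrite fmorph_eq0.
rewrite mul0r add0r (_ : (x%:C)^-1 * _ = cexp (x%:C * g k t) * arc_deriv (g k) t)//.
by rewrite -mulrA mulKf// mulrC.
Qed.

Lemma cont_onX f j : cont_on f -> cont_on (fun w => f w ^+ j).
Proof.
move=> cf; elim: j => [|j ih].
  have -> : (fun w => f w ^+ 0) = fun=> 1 by apply/funext => w; rewrite expr0.
  exact: cont_on_cst.
have -> : (fun w => f w ^+ j.+1) = fun w => f w * f w ^+ j.
  by apply/funext => w; rewrite exprS.
exact: cont_onM.
Qed.

Lemma curve_deriveX (F : R -> R[i]) dF t j : curve_derive F dF t ->
  curve_derive (fun t => F t ^+ j.+1) (j.+1%:R * F t ^+ j * dF) t.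
Proof.
move=> dFt; elim: j => [|j ih]; first by rewrite expr0 !mul1r.
rewrite (_ : (fun t => _) = fun t => F t * F t ^+ j.+1); last first.
  by apply/funext => y; rewrite exprS.
have := curve_deriveM dFt ih; rewrite (_ : dF * _ + _ = j.+2%:R * F t ^+ j.+1 * dF)//.
by rewrite exprS -[j.+2%:R]natr1; ring.
Qed.

Lemma oint_invX z j : avoids z -> oint (fun w => (w - z)^-1 ^+ j.+2) = 0.
Proof.
move=> gz.
apply: (@oint_primitive _ (fun w => - (j.+1%:R)^-1 * (w - z)^-1 ^+ j.+1)).
  by apply: cont_onX; exact: cont_onV.
move=> k t t01; have gz0 : g k t - z != 0 by rewrite subr_eq0 gz.
have dV := curve_deriveV gz0 (sub_derive z k t).
have := curve_deriveM (curve_derive_cst (- (j.+1%:R)^-1) t) (curve_deriveX j dV).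
rewrite mul0r add0r (_ : _ * (_ * _ * _) = (g k t - z)^-1 ^+ j.+2 * arc_deriv (g k) t)//.
have j0 : j.+1%:R != 0 :> R[i] by rewrite pnatr_eq0.
rewrite -exprVn [_ ^+ j.+2]exprS [_ ^+ j.+1]exprS.
by set u := (_ - z)^-1; field.
Qed.

Definition invprod (s : seq R[i]) (w : R[i]) : R[i] := \prod_(z <- s) (w - z)^-1.

Lemma cont_on_invprod s : (forall z, z \in s -> avoids z) -> cont_on (invprod s).
Proof.
elim: s => [|z s ih] sz.
  have -> : invprod [::] = fun=> 1 by apply/funext => w; rewrite /invprod big_nil.
  exact: cont_on_cst.
have -> : invprod (z :: s) = fun w => (w - z)^-1 * invprod s w.
  by apply/funext => w; rewrite /invprod big_cons.
apply: cont_onM; first by apply: cont_onV; apply: sz; rewrite inE eqxx.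
by apply: ih => y ys; apply: sz; rewrite inE ys orbT.
Qed.

Definition twopi_i : R[i] := 0 +i* (2 * pi).

Lemma twopi_i_neq0 : twopi_i != 0.
Proof. by rewrite /twopi_i eq_complex /= eqxx /= mulf_neq0// gt_eqF// pi_gt0. Qed.

Lemma oint_inv z : encloses_ccw g z -> oint (fun w => (w - z)^-1) = twopi_i.
Proof.
move=> [_]; rewrite /winding_number -/twopi_i => /(congr1 (fun u => twopi_i * u)).
by rewrite mulrA mulfV ?twopi_i_neq0// mul1r mulr1.
Qed.

(** Partial fractions reduce to a power of a single factor, which has a
    primitive when its exponent is at least two. *)
Lemma oint_invprod s : (forall z, z \in s -> encloses_ccw g z) -> (1 < size s)%N ->
  oint (invprod s) = 0.
Proof.
have [N] := ubnP (size s); elim: N s => // N ih [//|z1 s] /= sN zs s1.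
have av z : z \in z1 :: s -> avoids z by move=> /zs[].
have [alls|] := boolP (all (pred1 z1) s).
  have -> : invprod (z1 :: s) = fun w => (w - z1)^-1 ^+ (size s).-1.+2.
    apply/funext => w; rewrite /invprod big_cons (all_pred1P _ _ alls) size_nseq.
    by rewrite prednK// exprS big_nseq iter_mulr_1.
  by apply: oint_invX; apply: av; rewrite inE eqxx.
move=> /allPn[z2 z2s /= z21].
have z12 : z1 - z2 != 0 by rewrite subr_eq0 eq_sym.
set s' := rem z2 s.
have sperm : perm_eq s (z2 :: s') by exact: perm_to_rem.
have ss' : size s = (size s').+1 by rewrite (perm_size sperm).
have mem' z : z \in s' -> z \in z1 :: s by move=> zs'; rewrite inE (mem_rem zs') orbT.
have z1in : z1 \in z1 :: s by rewrite inE eqxx.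
have z2in : z2 \in z1 :: s by rewrite inE z2s orbT.
have sub1 z : z \in z1 :: s' -> encloses_ccw g z.
  by rewrite inE => /predU1P[->|/mem' h]; apply: zs.
have sub2 z : z \in z2 :: s' -> encloses_ccw g z.
  by rewrite inE => /predU1P[->|/mem' h]; apply: zs.
rewrite (eq_oint (h := fun w => (z1 - z2)^-1 *
  (invprod (z1 :: s') w + -1 * invprod (z2 :: s') w))); last first.
  move=> k t t01; rewrite /invprod !big_cons (perm_big _ sperm) /= big_cons.
  have h1 : g k t - z1 != 0 by rewrite subr_eq0 (av _ z1in).
  have h2 : g k t - z2 != 0 by rewrite subr_eq0 (av _ z2in).
  by field; rewrite z12 h1 h2.
have c1 : cont_on (invprod (z1 :: s')) by apply: cont_on_invprod => z /sub1[].
have c2 : cont_on (invprod (z2 :: s')) by apply: cont_on_invprod => z /sub2[].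
have c2' : cont_on (fun w => -1 * invprod (z2 :: s') w) by apply: cont_onM => //;
  exact: cont_on_cst.
rewrite ointZ; last exact: cont_onD.
rewrite ointD// ointZ// mulN1r.
suff -> : oint (invprod (z1 :: s')) = oint (invprod (z2 :: s')) by rewrite subrr mulr0.
clearbody s'; case: s' sperm ss' mem' sub1 sub2 c1 c2 c2' => [|z3 s'] _ ss' _ sub1 sub2 _ _ _.
  have e z : invprod [:: z] = fun w => (w - z)^-1.
    by apply/funext => w; rewrite /invprod big_cons big_nil mulr1.
  by rewrite !e !oint_inv//; [apply: sub2|apply: sub1]; rewrite inE eqxx.
by rewrite !ih//= -ss' -ltnS.
Qed.

End Contour.

(** * Contour integrals are residue functionals *)

Section ParametricIntegral.
Context (R : realType).
Local Notation mu := (@lebesgue_measure R).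
Local Notation Re := (@complex.Re R).
Local Notation Im := (@complex.Im R).
Local Notation int01 := (cintegral mu `[0, 1]).

Lemma curve_cont_exp (F : R -> R[i]) t : curve_cont F t -> curve_cont (fun t => cexp (F t)) t.
Proof.
move=> [cr ci].
have ce : {for t, continuous (fun t => expR (Re (F t)))}.
  by apply: (continuous_comp (f := Re \o F)) => //; exact: continuous_expR.
have cc : {for t, continuous (fun t => cos (Im (F t)))}.
  by apply: (continuous_comp (f := Im \o F)) => //; exact: continuous_cos.
have cs : {for t, continuous (fun t => sin (Im (F t)))}.
  by apply: (continuous_comp (f := Im \o F)) => //; exact: continuous_sin.
by split; apply: continuousM.
Qed.

(** Differentiation under the integral sign: for [y] within [1] of [x] the
    derivative is dominated by [exp ((|x| + 1) |Re G|)] times a norm of [G h],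
    which is continuous in [t]. *)
Lemma derive_int01_exp (G h : R -> R[i]) (x : R) : cont01 G -> cont01 h ->
  is_derive x 1 (fun x => Re (int01 (fun t => cexp (x%:C * G t) * h t)))
    (Re (int01 (fun t => cexp (x%:C * G t) * (G t * h t)))).
Proof.
move=> cG ch.
pose f (y t : R) := Re (cexp (y%:C * G t) * h t).
pose k t := G t * h t.
have ck : cont01 k by move=> t t01; apply: curve_contM; [exact: cG|exact: ch].
have cE (y : R) (l : R -> R[i]) : cont01 l -> cont01 (fun t => cexp (y%:C * G t) * l t).
  move=> cl t t01; apply: curve_contM; last exact: cl.
  by apply: curve_cont_exp; apply: curve_contM; [exact: curve_cont_cst|exact: cG].
have df (y t : R) : is_derive y 1 (f^~ t) (Re (cexp (y%:C * G t) * k t)).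
  have cy : curve_derive (fun y : R => y%:C : R[i]) 1 y.
    by split; [exact: (is_derive_id y 1)|exact: (is_derive_cst (0 : R) y 1)].
  have := curve_deriveM (curve_derive_exp (curve_deriveM cy (curve_derive_cst (G t) y)))
    (curve_derive_cst (h t) y).
  move=> [d _]; refine (is_derive_eq d _); congr (Re _).
  by rewrite mul1r mulr0 addr0 mulr0 addr0 /k; ring.
have d1 (y t : R) : partial1of2 f y t = Re (cexp (y%:C * G t) * k t).
  by rewrite partial1of2E; case: (df y t).
pose M := `|x| + 1.
pose D t := expR (M * `|Re (G t)|) * (`|Re (k t)| + `|Im (k t)|).
have Ix : `]x - 1, x + 1[%classic x by rewrite /= in_itv /= ltrBlDr !ltrDl ltr01.
have D0 t : 0 <= D t by rewrite mulr_ge0 ?expR_ge0// addr_ge0.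
have mI : measurable (`[0, 1]%classic : set R) by exact: measurable_itv.
have intf (y : R) : `]x - 1, x + 1[%classic y -> mu.-integrable `[0, 1] (EFin \o f y).
  by move=> _; case: (integrable01 (cE y h ch)).
have derf (y t : R) : `]x - 1, x + 1[%classic y -> `[0, 1]%classic t -> derivable (f^~ t) y 1.
  by move=> _ _; case: (df y t).
have intD : mu.-integrable `[0, 1] (EFin \o D).
  apply: continuous_compact_integrable; first exact: segment_compact.
  apply: within01 => t t01.
  have cn (u : R -> R) : {for t, continuous u} -> {for t, continuous (fun t => `|u t|)}.
    by move=> cu; rewrite /continuous_at; apply: cvg_norm; exact: cu.
  have [c1 c2] := ck t t01; have [c3 _] := cG t t01.
  apply: continuousM; last by apply: continuousD; exact: cn.
  apply: (continuous_comp (f := fun t => M * `|Re (G t)|)); last exact: continuous_expR.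
  by apply: continuousM; [exact: cst_continuous|exact: cn].
have bound (y t : R) : `]x - 1,
  x + 1[%classic y -> `[0, 1]%classic t -> `|partial1of2 f y t| <= D t.
  rewrite /= in_itv /= => /andP[y1 y2] _; rewrite d1 ReM /D.
  have eb : expR (Re (y%:C * G t)) <= expR (M * `|Re (G t)|).
    rewrite ler_expR ReM /= mul0r subr0 (le_trans (ler_norm _))// normrM ler_wpM2r//.
    rewrite /M; have := ler_norm x; have := ler_norm (- x); rewrite normrN.
    by rewrite ler_norml; lra.
  have e0 : 0 <= expR (M * `|Re (G t)|) by exact: expR_ge0.
  rewrite (le_trans (ler_normB _ _))// mulrDr lerD//.
    rewrite normrM ler_wpM2r//= normrM ger0_norm ?expR_ge0//.
    by rewrite -[leRHS]mulr1 ler_pM ?expR_ge0// ler_norml cos_geN1 cos_le1.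
  rewrite normrM ler_wpM2r//= normrM ger0_norm ?expR_ge0//.
  by rewrite -[leRHS]mulr1 ler_pM ?expR_ge0// ler_norml sin_geN1 sin_le1.
have := @derivable_under_integral R _ _ mu f _ mI x (x - 1) (x + 1) Ix intf derf D D0 intD bound.
have := @differentiation_under_integral R _ _ mu f _ mI x (x - 1) (x + 1) Ix intf derf D D0 intD
  bound.
rewrite derive1E => e dv; refine (is_derive_eq (derivableP dv) _).
by rewrite e /=; apply: eq_Rintegral => t _; rewrite d1.
Qed.

End ParametricIntegral.

Section ContourResidue.
Context (R : realType) (m : nat) (g : 'I_m -> R -> R[i]).
Hypothesis gclosed : closed_contour g.
Local Notation Re := (@complex.Re R).
Local Notation Im := (@complex.Im R).
Local Notation oint := (contour_integral g).
Local Notation toC := (map_poly (real_complex R)).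

Lemma derive_oint_exp h (x : R) : cont_on g h ->
  is_derive x 1 (fun x => Re (oint (fun w => cexp (x%:C * w) * h w)))
    (Re (oint (fun w => cexp (x%:C * w) * (w * h w)))).
Proof.
move=> ch.
have ReS (F : 'I_m -> R[i]) : Re (\sum_(k < m) F k) = \sum_(k < m) Re (F k).
  by apply: (big_morph Re (@ReD R)).
rewrite /contour_integral ReS.
rewrite (_ : (fun x => _) = fun x : R => \sum_(k < m) Re (cintegral lebesgue_measure `[0, 1]
  (fun t => cexp (x%:C * g k t) * h (g k t) * arc_deriv (g k) t))); last by apply/funext => y.
apply: is_derive_sumE => k.
have ck : cont01 (fun t => h (g k t) * arc_deriv (g k) t) by exact: integrand_cont.
have := derive_int01_exp x (@cont_on_id _ _ _ gclosed k) ck.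
have -> : (fun x0 : R => Re (cintegral lebesgue_measure `[0, 1]
    (fun t : R => cexp (x0%:C * g k t) * (h (g k t) * arc_deriv (g k) t)))) =
  (fun x0 : R => Re (cintegral lebesgue_measure `[0, 1]
    (fun t : R => cexp (x0%:C * g k t) * h (g k t) * arc_deriv (g k) t))).
  by apply/funext => y; congr (Re _); apply: eq_int01 => t _; rewrite mulrA.
move=> d; refine (is_derive_eq d _); congr (Re _); apply: eq_int01 => t _; ring.
Qed.

Lemma cont_on_poly (p : {poly R[i]}) : cont_on g (horner p).
Proof.
elim/poly_ind: p => [|p c ih].
  have -> : horner (0 : {poly R[i]}) = fun=> 0 by apply/funext => w; rewrite horner0.
  exact: cont_on_cst.
have -> : horner (p * 'X + c%:P) = fun w => p.[w] * w + c.
  by apply/funext => w; rewrite !hornerE.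
apply: cont_onD; last exact: cont_on_cst.
exact: (cont_onM ih (cont_on_id gclosed)).
Qed.

(** Entire integrands: [oint_exp] gives the constant polynomials, and
    multiplication by [w] is differentiation of the zero function. *)
Lemma oint_exp_poly (p : {poly R[i]}) (x : R) :
  oint (fun w => cexp (x%:C * w) * p.[w]) = 0.
Proof.
have cep (q : {poly R[i]}) (y : R) : cont_on g (fun w => cexp (y%:C * w) * q.[w]).
  by apply: cont_onM; [exact: cont_on_exp|exact: cont_on_poly].
suff H q (y : R) : Re (oint (fun w => cexp (y%:C * w) * q.[w])) = 0.
  apply: complex_eqP; rewrite ?H//.
  have := H ((0 -i* 1) *: p) x.
  have -> : (fun w => cexp (x%:C * w) * ((0 -i* 1) *: p).[w]) =
     fun w => (0 -i* 1) * (cexp (x%:C * w) * p.[w]).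
    by apply/funext => w; rewrite hornerZ mulrCA.
  by rewrite (ointZ gclosed _ (cep p x)) ReM /= mul0r mulN1r opprK add0r.
elim/poly_ind: q y => [|q c ih] y.
  have -> : (fun w => cexp (y%:C * w) * (0 : {poly R[i]}).[w]) = fun w => 0 * (cexp (y%:C * w)).
    by apply/funext => w; rewrite horner0 mulr0 mul0r.
  by rewrite (ointZ gclosed _ (cont_on_exp gclosed y)) mul0r.
have -> : (fun w => cexp (y%:C * w) * (q * 'X + c%:P).[w]) =
    fun w => cexp (y%:C * w) * (q * 'X).[w] + c * cexp (y%:C * w).
  by apply/funext => w; rewrite hornerD hornerC mulrDr [c * _]mulrC.
rewrite (ointD gclosed (cep _ _) (cont_onM (cont_on_cst g c) (cont_on_exp gclosed y))).
rewrite (ointZ gclosed _ (cont_on_exp gclosed y)).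
rewrite oint_exp// mulr0 addr0.
have d := derive_oint_exp y (cont_on_poly q).
have d0 : is_derive y 1 (fun x => Re (oint (fun w => cexp (x%:C * w) * q.[w]))) 0.
  rewrite (_ : (fun _ => _) = fun=> 0); last by apply/funext => z; exact: ih.
  exact: is_derive_cst.
have -> : (fun w => cexp (y%:C * w) * (q * 'X).[w]) = fun w => cexp (y%:C * w) * (w * q.[w]).
  by apply/funext => w; rewrite hornerMX [w * _]mulrC.
by case: d => _ <-; case: d0.
Qed.

(** Dividing [p] by [X - z] gives a quotient over one pole fewer, and a constant
    over all the poles, which contributes only if there is a single one. *)
Lemma oint_poly_invprod s (p : {poly R[i]}) : (forall z, z \in s -> encloses_ccw g z) ->
  (0 < size s)%N -> (size p <= size s)%N ->
  oint (fun w => p.[w] * invprod s w) = twopi_i R * p`_(size s).-1.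
Proof.
elim: s p => // z s ih p zs _ /= ps.
have [q pq] : exists q, p = q * ('X - z%:P) + p.[z]%:P.
  have /factor_theorem[q e] : root (p - p.[z]%:P) z by rewrite /root !hornerE subrr.
  by exists q; rewrite -e subrK.
have av w : w \in z :: s -> avoids g w by move=> /zs[].
have avz : avoids g z by apply: av; rewrite inE eqxx.
have cI : cont_on g (invprod (z :: s)) by exact: cont_on_invprod.
have cJ : cont_on g (invprod s) by apply: cont_on_invprod => // w ws; apply: av;
  rewrite inE ws orbT.
have sq : (size q <= size s)%N.
  have [->|q0] := eqVneq q 0; first by rewrite size_poly0.
  have e : q * ('X - z%:P) = p - p.[z]%:P by apply/eqP; rewrite eq_sym subr_eq; apply/eqP;
    exact: pq.
  have := size_Mmonic q0 (monicXsubC z); rewrite e size_XsubC addn2 /= => sz.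
  have : (size (p - p.[z]%:P)%R <= maxn (size p) 1)%N.
    by rewrite (leq_trans (size_polyD _ _))// size_polyN geq_max leq_maxl /= size_polyC;
      case: (_ != 0); rewrite leq_max ?orbT.
  by rewrite -[(size q <= _)%N]ltnS -sz => /leq_trans; apply; rewrite geq_max ps.
rewrite (eq_oint (h := fun w => q.[w] * invprod s w + p.[z] * invprod (z :: s) w)); last first.
  move=> k t t01; rewrite {1}pq !hornerE /invprod big_cons.
  have h : g k t - z != 0 by rewrite subr_eq0 avz.
  by field.
have cqJ := cont_onM (cont_on_poly q) cJ.
rewrite (ointD gclosed cqJ (cont_onM (cont_on_cst g _) cI)).
rewrite (ointZ gclosed _ cI).
case: s ih sq zs ps av cI cJ cqJ => [|z' s] ih sq zs ps av cI cJ cqJ.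
  have q0 : q = 0 by apply/eqP; rewrite -size_poly_eq0 -leqn0.
  have e1 : invprod [:: z] = fun w => (w - z)^-1.
    by apply/funext => w; rewrite /invprod big_cons big_nil mulr1.
  rewrite e1 oint_inv; last by apply: zs; rewrite inE.
  have -> : (fun w => q.[w] * invprod [::] w) = fun w => 0 * 1.
    by apply/funext => w; rewrite q0 horner0 !mul0r.
  rewrite (ointZ gclosed _ (cont_on_cst g 1)).
  by rewrite mul0r add0r mulrC {2}pq q0 mul0r add0r coefC.
rewrite oint_invprod// mulr0 addr0 ih//; last by move=> w ws; apply: zs; rewrite inE ws orbT.
congr (_ * _); rewrite [in RHS]pq coefD coefC /= addr0 mulrBr coefB coefMX /=.
by rewrite coefMC (nth_default _ sq) mul0r subr0.
Qed.

Variables (n : nat) (b : nat -> R).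
Hypothesis n0 : (0 < n)%N.
Hypothesis genc : forall l, (l < n)%N -> encloses_ccw g (b l)%:C.
Local Notation s := [seq (b l)%:C | l <- iota 0 n].

Definition contour_residue (f : {poly R}) (x : R) : R[i] :=
  (twopi_i R)^-1 * oint (fun w => cexp (x%:C * w) * ((toC f).[w] * invprod s w)).

Let s_enc z : z \in s -> encloses_ccw g z.
Proof. by move=> /mapP[l]; rewrite mem_iota add0n => /andP[_ ln] ->; exact: genc. Qed.

Let cont_inv : cont_on g (invprod s).
Proof. by apply: cont_on_invprod => // z /s_enc[]. Qed.

Let cont_h f : cont_on g (fun w => (toC f).[w] * invprod s w).
Proof. exact: (cont_onM (cont_on_poly _) cont_inv). Qed.

Let cont_f f (x : R) : cont_on g (fun w => cexp (x%:C * w) * ((toC f).[w] * invprod s w)).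
Proof. exact: (cont_onM (cont_on_exp gclosed x) (cont_h f)). Qed.

(** Multiples of [rootprod b 0 n] cancel the poles and leave an entire integrand;
    at [x = 0] the integrand is rational. The constant [c] serves to treat the
    real part, with [c = 1], and the imaginary part, with [c = - i], at once. *)
Let residue_ax c (B := fun (f : {poly R}) (x : R) => Re (c * contour_residue f x)) :
  [/\ forall x, linear (B^~ x : {poly R} -> R^o),
      forall f (x : R), is_derive x 1 (B f) (B ('X * f) x),
      forall f x, B (rootprod b 0 n * f) x = 0 &
      forall f : {poly R}, (size f <= n)%N -> B f 0 = Re (c * (f`_n.-1)%:C)].
Proof.
have BE (f : {poly R}) (x : R) : B f x =
  Re (oint (fun w => cexp (x%:C * w) * ((c * (twopi_i R)^-1) * ((toC f).[w] * invprod s w)))).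
  rewrite /B /contour_residue mulrA -(ointZ gclosed _ (cont_f f x)); congr (Re _).
  by apply: eq_oint => k t _; rewrite mulrCA.
split.
- move=> x k f h; rewrite /B /contour_residue.
  have -> : (fun w => cexp (x%:C * w) * ((toC (k *: f + h)).[w] * invprod s w)) =
    fun w => k%:C * (cexp (x%:C * w) * ((toC f).[w] * invprod s w)) +
       (cexp (x%:C * w) * ((toC h).[w] * invprod s w)).
    by apply/funext => w; rewrite rmorphD /= map_polyZ /=
      hornerD hornerZ mulrDl mulrDr -mulrA mulrCA.
  rewrite (ointD gclosed (cont_onM (cont_on_cst g _) (cont_f f x)) (cont_f h x)).
  rewrite (ointZ gclosed _ (cont_f f x)) !mulrDr ReD; congr (_ + _).
  by rewrite [_^-1 * (k%:C * _)]mulrCA [c * (k%:C * _)]mulrCA [LHS]ReM /= mul0r subr0.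
- move=> f x.
  have -> : B f = fun x => Re (oint
    (fun w => cexp (x%:C * w) * ((c * (twopi_i R)^-1) * ((toC f).[w] * invprod s w)))).
    by apply/funext => y.
  refine (is_derive_eq (derive_oint_exp x (cont_onM (cont_on_cst g _) (cont_h f))) _).
  rewrite BE; congr (Re _); apply: eq_oint => k t _.
  rewrite rmorphM /= map_polyX hornerM hornerX; set u := cexp _; set p := (toC f).[_];
    set q := invprod _ _.
  by set z := g k t; set r := c / _; clear; ring.
- move=> f x.
  rewrite BE (eq_oint (h := fun w => cexp (x%:C * w) * ((c * (twopi_i R)^-1) *: toC f).[w]))
    ?oint_exp_poly//.
  move=> k t t01; rewrite hornerZ rmorphM /= hornerM; congr (_ * (_ * _)).
  have -> : (toC (rootprod b 0 n)).[g k t] = (invprod s (g k t))^-1.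
    rewrite /invprod /rootprod rmorph_prod /= horner_prod big_map -prodfV /index_iota subn0.
    by apply: eq_bigr => l _; rewrite invrK rmorphB /= map_polyX map_polyC /= !hornerE.
  rewrite mulrC mulrA divff ?mul1r//.
  rewrite /invprod big_map prodf_seq_neq0; apply/allP => l ln.
  have [av _] : encloses_ccw g (b l)%:C by apply: s_enc; exact: map_f.
  by rewrite /= invr_eq0 subr_eq0 av.
- move=> f fn; rewrite /B /contour_residue.
  have -> : (fun w => cexp (0%:C * w) * ((toC f).[w] * invprod s w)) = fun w => (toC f).[w] *
    invprod s w.
    by apply/funext => w; rewrite mul0r /cexp /= expR0 cos0 sin0 mulr0 mulr1 mul1r.
  rewrite oint_poly_invprod//.
  + by rewrite mulKf ?twopi_i_neq0// size_map size_iota coef_map.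
  + by rewrite size_map size_iota.
  + by rewrite size_map size_iota (leq_trans (size_poly _ _)).
Qed.

Theorem contour_residue_functional :
  residue_functional n b (fun f x => Re (contour_residue f x)).
Proof.
have := residue_ax 1.
have -> : (fun (f : {poly R}) x => Re (contour_residue f x)) =
   (fun (f : {poly R}) x => Re (1 * contour_residue f x)).
  by apply/funext => f; apply/funext => x; rewrite mul1r.
move=> [a1 a2 a3 a4]; split => // f fn; by rewrite a4// mul1r.
Qed.

(** The rules are real and so are the initial values; by uniqueness so is the
    functional. *)
Lemma contour_residue_real f x :
  contour_residue f x = (Re (contour_residue f x))%:C.
Proof.
apply: complex_eqP => //=.
have ImE z : Im z = Re ((0 -i* 1) * z) by rewrite ReM /= mul0r mulN1r opprK add0r.
rewrite ImE; have [a1 a2 a3 a4] := residue_ax (0 -i* 1).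
apply: (residue_unique a1 a2 a3 _ f x) => h.
have annP z : Re ((0 -i* 1) * contour_residue (rootprod b 0 n * z) 0) = 0 := a3 z 0.
have lin0 k p q : Re ((0 -i* 1) * contour_residue (k *: p + q) 0) =
   k * Re ((0 -i* 1) * contour_residue p 0) + Re ((0 -i* 1) * contour_residue q 0) := a1 0 k p q.
set Q := rootprod b 0 n in annP.
have Qm : Q \is monic by exact: rootprod_monic.
have e : h = 1 *: (Q * (h %/ Q)) + h %% Q by rewrite scale1r mulrC -divp_eq.
rewrite e lin0 annP mulr0 add0r a4 ?ReM /= ?mulr0 ?mul0r ?subr0//.
by have := ltn_modpN0 h (monic_neq0 Qm); rewrite size_rootprod subn0.
Qed.

End ContourResidue.

(** * Lattice paths *)

Section LatticePaths.
Context (R : realType) (m : nat) (w : nat * nat -> R).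

(** The vertex with diagonal coordinates [i <= c]: the corner of [Delta] is
    [cell 0 m], and its boundary consists of the vertices [cell i i]. *)
Definition cell (i c : nat) : nat * nat := (i.+1, m.+1 - c)%N.

Local Notation L := (lpp (fun i c => w (cell i c))).

Lemma cellS i c : (c < m.+1)%N -> cell i c = (i.+1, (m.+1 - c.+1).+1)%N.
Proof. by move=> cm; rewrite /cell subSS subSn. Qed.

(** The first step of a path from the cell [(i, c)] leads to [(i + 1, c)] or to
    [(i, c - 1)], and its length is [c - i] since the steps raise the sum of the
    coordinates by one. *)
Lemma path_weight_le i c s : (i <= c <= m)%N -> path ur_step (cell i c) s ->
  size s = (c - i)%N -> path_weight w (cell i c :: s) <= L i c.
Proof.
rewrite /path_weight; elim: s i c => [|q s ih] i c /andP[ic cm] /=.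
  move=> _ /esym/eqP; rewrite subn_eq0 => ci.
  have -> : i = c by apply/eqP; rewrite eqn_leq ic ci.
  by rewrite big_seq1 lpp_corner.
case: c ic cm => [|c] ic cm; first by rewrite sub0n.
move=> /andP[st ps] sz; have ic' : (i <= c)%N by rewrite -ltnS -subn_gt0 -sz.
rewrite big_cons lppS// lerD2l; move: st; rewrite /ur_step => /orP[] /eqP qE.
  have qc : q = cell i.+1 c.+1 by rewrite qE.
  rewrite qc in ps *; rewrite le_max ih ?ltnS ?ic' ?cm//.
  by move: sz; lia.
have qc : q = cell i c by rewrite qE /= -cellS// ltnW.
by rewrite qc in ps *; rewrite le_max ih ?orbT ?ic' ?(ltnW cm)//; move: sz; lia.
Qed.

Lemma path_weight_attained i c : (i <= c <= m)%N ->
  exists s, [/\ path ur_step (cell i c) s, size s = (c - i)%N &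
    path_weight w (cell i c :: s) = L i c].
Proof.
move e : (c - i)%N => k; elim: k i c e => [|k ih] i c e /andP[ic cm].
  exists [::]; split => //; rewrite /path_weight big_seq1.
  have -> : i = c by apply/eqP; rewrite eqn_leq ic -subn_eq0 e.
  by rewrite lpp_corner.
case: c ic cm e => [|c] ic cm e; first by rewrite sub0n in e.
have ic' : (i <= c)%N by rewrite -ltnS -subn_gt0 e.
rewrite lppS//.
have step2 : ur_step (cell i c.+1) (cell i c).
  by rewrite /ur_step [cell i c]cellS ?eqxx ?orbT// ltnW.
have [s1 [ps1 sz1 <-]] : exists s, [/\ path ur_step (cell i.+1 c.+1) s, size s = k &
    path_weight w (cell i.+1 c.+1 :: s) = L i.+1 c.+1].
  by apply: ih; [lia|rewrite ltnS ic'].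
have [s2 [ps2 sz2 <-]] : exists s, [/\ path ur_step (cell i c) s, size s = k &
    path_weight w (cell i c :: s) = L i c].
  by apply: ih; [lia|rewrite ic' ltnW].
have [_|_] := leP.
  exists (cell i c :: s2); split; rewrite /= ?step2 ?sz2//.
  by rewrite /path_weight [LHS]big_cons.
exists (cell i.+1 c.+1 :: s1); split; rewrite /= ?ps1 ?sz1// ?andbT;
  first by rewrite /ur_step eqxx.
by rewrite /path_weight [LHS]big_cons.
Qed.

Lemma all_in_Delta n p s : (1 <= p.1)%N -> (1 <= p.2)%N ->
  (p.1 + p.2 + size s <= n.+1)%N -> path ur_step p s -> all (in_Delta n) (p :: s).
Proof.
elim: s p => [|q s ih] p p1 p2 /= sz.
  by move=> _; rewrite /in_Delta p1 p2 -(addn0 (p.1 + p.2)%N) sz.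
move=> /andP[st ps]; apply/andP; split.
  by rewrite /in_Delta p1 p2 (leq_trans _ sz)// leq_addr.
have h : (p.1 + p.2 + size s < n.+1)%N by rewrite -addnS.
apply: ih => //; move: st; rewrite /ur_step => /orP[] /eqP -> //=; move: h; lia.
Qed.

Lemma Pi_flat_lpp : Pi_flat m.+1 w = L 0 m.
Proof.
have c0 : cell 0 m = (1, 1)%N by rewrite /cell subSnn.
have [[s us Pis] Pi_ub] := @Pi_flat_max R m.+1 w (ltn0Sn m).
apply/eqP; rewrite eq_le; apply/andP; split.
  rewrite Pis; move: us; rewrite /ur_path;
    case: s {Pis} => [|p s] // /and4P[/= /eqP -> ps _ /andP[_ /eqP e]].
  have := sum_last_ur ps; rewrite e /= => sz.
  by rewrite -c0; apply: path_weight_le; rewrite ?leqnn// ?c0// subn0; lia.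
have [s' [ps sz <-]] := @path_weight_attained 0 m (leqnn m).
apply: Pi_ub; rewrite /ur_path; rewrite c0 in ps *.
have al : all (in_Delta m.+1) ((1, 1)%N :: s') by apply: all_in_Delta => //=; move: sz; lia.
apply/and4P; split => //=.
rewrite /in_bdDelta (allP al) ?mem_last//= (sum_last_ur ps) sz /=.
by apply/eqP; lia.
Qed.

End LatticePaths.

(** * The distribution of the point-to-line last passage time *)

(** When the whole boundary has the same argument, the determinant is the one
    that splits off [1 - gram], and the two exponentials cancel. *)
Lemma bd_cdf_flat (R : realType) (m : nat) (b : nat -> R) (B : {poly R} -> R -> R) (A : R) :
  residue_functional m.+1 b B -> 0 <= A -> (forall l, (l < m.+1)%N -> 0 < b l) ->
  bd_cdf m.+1 b B m 0 (fun=> A) = \det (1%:M - gram m.+1 b B A).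
Proof.
move=> resB A0 b_gt0; rewrite /bd_cdf big_ord0 divr1 -det_tr.
have -> : (bd_mx m.+1 b B m 0 (fun=> A))^T =
    \matrix_(s < m.+1, r < m.+1) flat_fun B (rootprod b 0 s) (diffprod b r.+1 m.+1) A.
  by apply/matrixP => s r; rewrite !mxE /row_op /= rootprod_nil mulr1.
rewrite (det_flat_fun (ltn0Sn m) resB A0 b_gt0).
have -> : \sum_(r < m.+1) b r * A = A * \sum_(r < m.+1) b r by rewrite -mulr_suml mulrC.
set u := A * _; set e := (-1) ^+ _; set D := \det _.
have ee : e * e = 1 by rewrite -expr2 sqrr_sign.
have uu : expR (- u) * expR u = 1 by rewrite -expRD addNr expR0.
have -> : e * expR (- u) * (e * expR u * D) = (e * e) * (expR (- u) * expR u) * D by ring.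
by rewrite ee uu !mul1r.
Qed.

Section FlatLastPassage.
Context (R : realType) (d : measure_display) (T : measurableType d).
Variables (P : probability T R) (m : nat) (beta : nat -> R).
Variable omega : nat * nat -> {RV P >-> R}.
Local Notation n := m.+1.
Hypothesis beta_gt0 : forall i, (1 <= i <= n)%N -> 0 < beta i.
Hypothesis indep : mutually_independent [set p | in_Delta n p] omega.
Hypothesis law : forall i j, in_Delta n (i, j) ->
  has_exponential_law (omega (i, j)) (beta i + beta (n + 1 - j)%N).
Let b l := beta l.+1.
Local Notation site := (cell m).

Let b_gt0 l : (l < n)%N -> 0 < b l.
Proof. by move=> ln; exact: beta_gt0. Qed.

Let siteD i c : (i <= c)%N -> (c < n)%N -> [set p | in_Delta n p] (site i c).
Proof.
by move=> ic cn; rewrite /= /in_Delta /cell /=; move: ic cn; lia.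
Qed.

Let site_inj i c i' c' : (i <= c < n)%N -> (i' <= c' < n)%N ->
  site i c = site i' c' -> (i, c) = (i', c').
Proof. by move=> h h' [-> e]; congr pair; move: h h' e; lia. Qed.

Let law_site i c : (i <= c)%N -> (c < n)%N ->
  has_exponential_law (omega (site i c)) (b i + b c).
Proof.
move=> ic cn; have := law (siteD ic cn).
by rewrite /b (_ : (n + 1 - (m.+1 - c))%N = c.+1)//; move: cn; lia.
Qed.

Lemma exponential_lt0 (W : {RV P >-> R}) (lam : R) : has_exponential_law W lam ->
  P [set t | W t < 0] = 0%E.
Proof.
move=> lawW; have := lawW `]-oo, 0[%classic (measurable_itv _).
rewrite /exponential_prob (eq_integral (fun=> 0%E)) ?integral0.
  by move=> <-; congr (P _); apply/seteqP; split => t; rewrite /= in_itv.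
by move=> x /set_mem; rewrite /= in_itv /= => x0; rewrite lt0_exponential_pdf.
Qed.

Let neg : set T := \bigcup_(p in [set p : nat * nat | (p.1 <= p.2 < n)%N])
  [set t | omega (site p.1 p.2) t < 0].

Let measurable_lt0 i c : measurable [set t | omega (site i c) t < 0].
Proof.
rewrite -[X in measurable X]setTI.
exact: (@measurable_funPT _ _ _ _ (omega (site i c)) measurableT `]-oo,
  0[%classic (measurable_itv _)).
Qed.

Let neg_finite : finite_set [set p : nat * nat | (p.1 <= p.2 < n)%N].
Proof.
apply: (@sub_finite_set _ _ (`I_n `*` `I_n)); last by apply: finite_setX; exact: finite_II.
by move=> p /= /andP[h1 h2]; split => //=; exact: leq_ltn_trans h2.
Qed.

Let measurable_neg : measurable neg.
Proof. by apply: fin_bigcup_measurable => // p _; exact: measurable_lt0. Qed.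

Let neg0 : P neg = 0%E.
Proof.
apply/eqP; rewrite eq_le measure_ge0 andbT.
rewrite (le_trans (content_sub_fsum P neg_finite (fun p _ => measurable_lt0 p.1 p.2)
  measurable_neg (@subset_refl _ neg)))//.
rewrite fsbig1// => -[i c] /= /andP[ic cn].
exact: exponential_lt0 (law_site ic cn).
Qed.

Let weight_omega t i c : ~ neg t -> (i <= c < n)%N ->
  weight omega site t i c = omega (site i c) t.
Proof.
move=> nt ic; rewrite /weight max_l// leNgt; apply/negP => h.
by apply: nt; exists (i, c).
Qed.

(** Negative weights have probability zero, so the weights may be replaced by
    their positive parts, whose last passage times are covered by
    [bd_correct_all]. For [a < 0] both sides vanish, the right one because its
    argument is [0]. *)
Lemma flat_last_passage_cdf B (a : R) : residue_functional n b B ->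
  fine (P [set t | Pi_flat n (fun p => omega p t) <= a]) =
  bd_cdf n b B m 0 (fun=> Num.max a 0).
Proof.
move=> resB.
pose E := [set t | Pi_flat n (fun p => omega p t) <= a].
pose E' := [set t | lpp (weight omega site t) 0 m <= a].
have mlpp (w : T -> nat -> nat -> R) :
    (forall i c, (0 <= i)%N -> (i <= c)%N -> (c <= m)%N ->
      measurable_fun setT (fun t => w t i c)) ->
    measurable [set t | lpp (w t) 0 m <= a].
  move=> mw; rewrite -[X in measurable X]setTI.
  exact: (measurable_lpp (leq0n m) mw measurableT (measurable_itv `]-oo, a])).
have Elpp : E = [set t | lpp (fun i c => omega (site i c) t) 0 m <= a].
  by apply/seteqP; split => t; rewrite /E /= Pi_flat_lpp.
have mE : measurable E.
  by rewrite Elpp; apply: mlpp => i c _ _ _; exact: measurable_funPT.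
have mE' : measurable E'.
  apply: mlpp => i c _ _ _; apply: measurable_maxr; last exact: measurable_cst.
  exact: measurable_funPT.
have EE' t : ~ neg t -> E t <-> E' t.
  move=> nt; rewrite Elpp /E' /= (eq_lpp (w' := weight omega site t))// => i c _ ic cm.
  by rewrite weight_omega// ic.
have le_P (F G : set T) : measurable F -> measurable G -> F `<=` G `|` neg -> (P F <= P G)%E.
  move=> mF mG FG; apply: (@le_trans _ _ (P (G `|` neg))).
    by apply: le_measure => //; apply/mem_set => //; exact: (measurableU _ _ mG measurable_neg).
  by apply: (le_trans (measureU2 P mG measurable_neg)); rewrite [X in (_ + X)%E]neg0 adde0.
have -> : P E = P E'.
  apply/eqP; rewrite eq_le; apply/andP; split; apply: le_P => // t.
    by move=> Et; have [nt|nt] := pselect (neg t); [right|left; apply/(EE' t nt)].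
  by move=> Et; have [nt|nt] := pselect (neg t); [right|left; apply/(EE' t nt)].
have w0 t i c : 0 <= weight omega site t i c by exact: weight_ge0.
have [a0|a0] := leP 0 a.
  rewrite -(bd_correct_all (ltn0Sn m) resB b_gt0 siteD site_inj indep law_site (ltnSn m)
    (leq0n m))//.
  congr (fine (P _)); apply/seteqP; split => t /=.
    by move=> Et r rm; rewrite /bd_lpp /= (le_trans _ Et)// lpp_le.
  by move=> /(_ 0%N (leq0n m)).
rewrite bd_cdf0// (_ : E' = set0) ?measure0//.
apply/seteqP; split => // t; rewrite /E' /= leNgt (lt_le_trans a0)//.
exact: lpp_ge0.
Qed.

End FlatLastPassage.

(** * The Fredholm determinant of the kernel *)

Section FlatKernel.
Context (R : realType) (m : nat) (g : 'I_m -> R -> R[i]) (n : nat) (beta : nat -> R).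
Hypothesis gclosed : closed_contour g.
Hypothesis n0 : (0 < n)%N.
Hypothesis genc : forall i, (1 <= i <= n)%N -> encloses_ccw g (beta i)%:C.
Let b l := beta l.+1.
Let B (f : {poly R}) (x : R) := complex.Re (contour_residue g n b f x).

Let genc_b l : (l < n)%N -> encloses_ccw g (b l)%:C.
Proof. by move=> ln; exact: genc. Qed.

Let resB : residue_functional n b B.
Proof. exact: (contour_residue_functional gclosed n0 genc_b). Qed.

(** The signs of [beta_i - w = - (w - beta_i)] and the one in front of the
    integral combine to [(-1) ^+ n.+1]. *)
Lemma flat_kernelE x y :
  flat_kernel n beta g x y = ((-1) ^+ n.+1 * B (sumprod b 0 n) (- (x + y)))%:C.
Proof.
rewrite rmorphM /= -(contour_residue_real gclosed n0 genc_b) /flat_kernel /contour_residue.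
rewrite rmorphXn rmorphN1 exprS mulN1r mulNr mulNr -/(twopi_i R); congr (- _).
set s := [seq _ | _ <- _].
pose h w := cexp ((- (x + y))%:C * w) *
  ((map_poly (real_complex R) (sumprod b 0 n)).[w] * invprod s w).
have ch : cont_on g h.
  apply: (cont_onM (cont_on_exp gclosed _)).
  apply: (cont_onM (cont_on_poly gclosed _)).
  apply: (cont_on_invprod gclosed) => z /mapP[l]; rewrite mem_iota add0n => /andP[_ ln] ->.
  by case: (genc_b ln).
rewrite mulrCA -(ointZ gclosed _ ch); congr (_ * _); apply: eq_oint => k t _.
rewrite /h [RHS]mulrCA rmorphN; congr (_ * _).
rewrite big_add1 /= /sumprod rmorph_prod horner_prod /invprod big_map.
rewrite /index_iota subn0 -big_split /=.
have -> : (-1) ^+ n = \prod_(l <- iota 0 n) (-1) :> R[i].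
  by rewrite -[n in LHS]subn0 -prodr_const_nat /index_iota subn0.
rewrite -big_split /=; apply: eq_bigr => l _.
rewrite rmorphD /= map_polyX map_polyC /= !hornerE addrC.
by rewrite -[(beta l.+1)%:C - _]opprB invrN mulrN /= mulN1r mulNr.
Qed.
End FlatKernel.

Section CutoffKernel.
Context (R : realType) (n : nat) (b : nat -> R) (B : {poly R} -> R -> R) (a : R).
Hypotheses (n0 : (0 < n)%N) (resB : residue_functional n b B).
Hypothesis b_gt0 : forall l, (l < n)%N -> 0 < b l.
Local Notation A := (Num.max a 0).
Local Notation mu := (@lebesgue_measure R).

Let A0 : 0 <= A.
Proof. by rewrite le_max lexx orbT. Qed.

Let f (l : 'I_n) (x : R) := chi a x * decay_left n b B A l x.
Let g (l : 'I_n) (y : R) := decay_right n b B A l y * chi a y.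

Let gf j l : (fun x => g j x * f l x) =
  (fun x => decay_right n b B A j x * decay_left n b B A l x) \_ `[A, +oo[.
Proof.
apply/funext => x; rewrite /f /g /chi patchE indicE.
have -> : (x \in [set u | A <= u]) = (x \in `[A, +oo[%classic).
  by apply/idP/idP => /set_mem h; apply/mem_set; move: h; rewrite /= in_itv /= andbT.
by case: ifP => _; rewrite /= ?mulr1 ?mul1r// mulr0 mul0r.
Qed.

(** Cutting off both families of factors of [hankel_split] by [chi] turns the
    Gram matrix over the line into the one over [[A, +oo[]. *)
Lemma fredholm_hankel (K : R -> R -> R[i]) :
  (forall x y, K x y = ((-1) ^+ n.+1 * B (sumprod b 0 n) (- (x + y)))%:C) ->
  fredholm_defined mu (cutoff a K) /\
  fredholm_det mu (cutoff a K) = (\det (1%:M - gram n b B A))%:C.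
Proof.
move=> KE.
have -> : cutoff a K = finite_rank f g.
  apply/funext => x; apply/funext => y.
  rewrite /cutoff /finite_rank KE (hankel_split n0 resB A) -!rmorphM /=; congr (_%:C).
  rewrite mulr_sumr mulr_suml; apply: eq_bigr => l _; rewrite /f /g; ring.
have intgf j l : mu.-integrable setT (fun x => (g j x * f l x)%:E).
  have mA : measurable (`[A, +oo[%classic : set (measurableTypeR R)) by exact: measurable_itv.
  have int_pair := integrable_pairing n0 resB b_gt0 A0 (sumprod b 0 n * rootprod b 0 j)
    (rootprod b l.+1 n).
  have := (integrable_mkcond _ mA).1 (integrableZl mA ((-1) ^+ n.+1) int_pair).
  apply: eq_integrable => // x _.
  have /(congr1 (fun h => (h x)%:E)) := gf j l.
  rewrite /= => ->; rewrite !patchE; case: ifP => // _.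
  by rewrite /decay_right /decay_left -mulrA EFinM.
have [dK ->] := fredholm_finite_rank intgf; split => //.
congr (\det (_ - _))%:C; apply/matrixP => j l; rewrite !mxE [RHS]Rintegral_mkcond.
by rewrite -gf.
Qed.

End CutoffKernel.

Theorem theorem3 (R : realType) (d : measure_display) (T : measurableType d)
    (P : probability T R) (n : nat) (beta : nat -> R)
    (omega : nat * nat -> {RV P >-> R}) (m : nat) (gamma : 'I_m -> R -> R[i])
    (a : R)
    (hn : (1 <= n)%N)
    (hbeta : forall i, (1 <= i <= n)%N -> 0 < beta i)
    (hindep : mutually_independent [set p | in_Delta n p] omega)
    (hlaw : forall i j, in_Delta n (i, j) ->
      has_exponential_law (omega (i, j)) (beta i + beta (n + 1 - j)%N))
    (hgamma : closed_contour gamma)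
    (hpoles : forall i, (1 <= i <= n)%N -> encloses_ccw gamma (beta i)%:C) :
  let K := cutoff a (flat_kernel n beta gamma) in
  fredholm_defined lebesgue_measure K /\
  (fine (P [set t | Pi_flat n (fun p => omega p t) <= a]))%:C =
    fredholm_det lebesgue_measure K.
Proof.
move=> K; rewrite /K; case: n hn hbeta hindep hlaw hpoles {K} => // k _ beta_gt0 indep law poles.
pose b l := beta l.+1.
have b_gt0 l : (l < k.+1)%N -> 0 < b l by move=> lk; exact: beta_gt0.
have b_enc l : (l < k.+1)%N -> encloses_ccw gamma (b l)%:C by move=> lk; exact: poles.
have resB := contour_residue_functional hgamma (ltn0Sn k) b_enc.
have [dK ->] := fredholm_hankel a (ltn0Sn k) resB b_gt0 (flat_kernelE hgamma (ltn0Sn k) poles).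
split => //; congr (_%:C).
rewrite (flat_last_passage_cdf beta_gt0 indep law a resB) bd_cdf_flat//.
by rewrite le_max lexx orbT.
Qed.
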